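(* Consider the control system $y'(t)=f(y(t),u(t))$, $u(t)\in U$, the compact state constraint set $Y\subset\mathbb{R}^m$ on which the system is viable, the running cost $k$, the optimal values $V_T(y_0)$, $h_\lambda(y_0)$, and the optimal values $k^*(y_0)$ and $d^*(y_0)$ of the infinite dimensional linear programming problem and its dual defined in the context. Let $\delta_0>0$, let (A1)–(A7) denote the properties listed in the context, and let $y_0\in Y$. If (A1), (A2), (A4), (A5) hold, then $$d^*(y_0)\le\liminf_{T\to\infty}V_T(y_0)\le\limsup_{T\to\infty}V_T(y_0)\le k^*(y_0).$$ If (A1), (A3), (A6), (A7) hold, then $$d^*(y_0)\le\liminf_{\lambda\downarrow0}h_\lambda(y_0)\le\limsup_{\lambda\downarrow0}h_\lambda(y_0)\le k^*(y_0).$$ Consequently, if (A1)–(A7) hold and $d^*(y_0)=k^*(y_0)$, then the limits $\lim_{T\to\infty}V_T(y_0)$ and $\lim_{\lambda\downarrow0}h_\lambda(y_0)$ exist and $$d^*(y_0)=\liminf_{T\to\infty}V_T(y_0)=\limsup_{T\to\infty}V_T(y_0)=k^*(y_0),\qquad d^*(y_0)=\liminf_{\lambda\downarrow0}h_\lambda(y_0)=\limsup_{\lambda\downarrow0}h_\lambda(y_0)=k^*(y_0);$$ in particular $$\lim_{T\to\infty}V_T(y_0)=\lim_{\lambda\downarrow0}h_\lambda(y_0)=d^*(y_0)=k^*(y_0).$$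
   Context: Setting. $U$ is a compact metric space; $f:\mathbb{R}^m\times U\to\mathbb{R}^m$ is continuous and Lipschitz in $y$ uniformly in $u\in U$; $k:\mathbb{R}^m\times U\to\mathbb{R}$ is continuous. $\mathcal{U}$ is the set of measurable functions $u:[0,\infty)\to U$, and $y(\cdot,y_0,u)$ is the solution of $y'(t)=f(y(t),u(t))$, $y(0)=y_0$. $Y\subset\mathbb{R}^m$ is a nonempty compact set equal to the closure of its interior. $\mathcal{U}_T(y_0)$ (resp. $\mathcal{U}(y_0)$) is the set of $u\in\mathcal{U}$ with $y(t,y_0,u)\in Y$ for all $t\in[0,T]$ (resp. all $t\ge 0$). Standing assumption (viability): $\mathcal{U}(y_0)\ne\emptyset$ for every $y_0\in Y$. Optimal values: for $T,\lambda>0$, $$V_T(y_0)=\frac1T\inf_{u\in\mathcal{U}_T(y_0)}\int_0^T k(y(t,y_0,u),u(t))\,dt,\qquad h_\lambda(y_0)=\lambda\inf_{u\in\mathcal{U}(y_0)}\int_0^\infty e^{-\lambda t}k(y(t,y_0,u),u(t))\,dt.$$ Linear programs. $\mathcal{P}(Y\times U)$ and $\mathcal{M}_+(Y\times U)$ are the Borel probability measures and the finite nonnegative Borel measures on $Y\times U$. $C^1$ is the space of continuously differentiable functions $\mathbb{R}^m\to\mathbb{R}$; gradients are row vectors. $$W=\Big\{\gamma\in\mathcal{P}(Y\times U):\int_{Y\times U}\nabla\phi(y)f(y,u)\,\gamma(dy,du)=0\ \ \forall\phi\in C^1\Big\}.$$ $\Omega(y_0)$ is the set of $(\gamma,\xi)\in\mathcal{P}(Y\times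 U)\times\mathcal{M}_+(Y\times U)$ with $\gamma\in W$ and $$\int_{Y\times U}(\phi(y_0)-\phi(y))\,\gamma(dy,du)+\int_{Y\times U}\nabla\phi(y)f(y,u)\,\xi(dy,du)=0\quad\forall\phi\in C^1,$$ and $k^*(y_0)=\inf_{(\gamma,\xi)\in\Omega(y_0)}\int_{Y\times U}k(y,u)\,\gamma(dy,du)$ (with $\inf\emptyset=+\infty$). $d^*(y_0)$ is the supremum of $\mu$ over all triplets $(\mu,\psi,\eta)\in\mathbb{R}\times C^1\times C^1$ such that for all $(y,u)\in Y\times U$ $$k(y,u)+(\psi(y_0)-\psi(y))+\nabla\eta(y)f(y,u)-\mu\ge0,\qquad \nabla\psi(y)f(y,u)\ge0.$$ Occupational measures. For $u\in\mathcal{U}_T(y_0)$ with trajectory $y(\cdot)$, $\gamma_{u,T}(Q)=\frac1T\int_0^T 1_Q(y(t),u(t))\,dt$ for Borel $Q\subset Y\times U$. For $u\in\mathcal{U}(y_0)$, $\gamma^\lambda_u(Q)=\lambda\int_0^\infty e^{-\lambda t}1_Q(y(t),u(t))\,dt$. $\Gamma_T$ is the set of all $\gamma_{u,T}$ with $y_0\in Y$, $u\in\mathcal{U}_T(y_0)$; $\Theta^\lambda$ is the set of all $\gamma_u^\lambda$ with $y_0\in Y$, $u\in\mathcal{U}(y_0)$; $\mathrm{co}$ denotes convex hull. Metric. $\rho(\gamma',\gamma'')=\sum_{j\ge1}2^{-j}\left|\int q_j\,d\gamma'-\int q_j\,d\gamma''\right|$ on $\mathcal{P}(Y\times U)$,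 where $(q_j)$ is a fixed sequence of Lipschitz functions dense in the unit ball of $C(Y\times U)$ (it metrizes weak$^*$ convergence); $\rho(\gamma,\Gamma)=\inf_{\gamma'\in\Gamma}\rho(\gamma,\gamma')$ and $\rho_H(\Gamma_1,\Gamma_2)=\max\{\sup_{\gamma\in\Gamma_1}\rho(\gamma,\Gamma_2),\sup_{\gamma\in\Gamma_2}\rho(\gamma,\Gamma_1)\}$. Enlarged problems. $Y^\delta=Y+\delta\bar B$ ($\bar B$ the closed unit ball). For $y_0\in Y^\delta$, $\mathcal{U}^\delta_T(y_0)$, $\mathcal{U}^\delta(y_0)$, $V^\delta_T(y_0)$, $h^\delta_\lambda(y_0)$ are defined exactly as $\mathcal{U}_T(y_0)$, $\mathcal{U}(y_0)$, $V_T(y_0)$, $h_\lambda(y_0)$ but with the constraint $y(t)\in Y^\delta$ instead of $y(t)\in Y$. Assumptions, for a given $\delta_0>0$: (A1) for all $\delta\in(0,\delta_0)$, $\mathcal{U}^\delta(y_0)\neq\emptyset$ for all $y_0\in Y^\delta$. (A2) for all $\delta\in(0,\delta_0)$ and $T>0$, $V^\delta_T(\cdot)$ is Lipschitz on $Y^\delta$. (A3) for all $\delta\in(0,\delta_0)$ and $\lambda>0$, $h^\delta_\lambda(\cdot)$ is Lipschitz on $Y^\delta$. (A4) for every $y_0\in Y$, $\lim_{T\to\infty,\ \delta\to0}|V_T(y_0)-V_T^\delta(y_0)|=0$ (joint limit). (A5) $\lim_{T\to\infty}\rho_H(\mathrm{co}\,\Gamma_T,W)=0$. (A6) for every $y_0\in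 Y$, $\lim_{\lambda\downarrow0,\ \delta\to0}|h_\lambda(y_0)-h_\lambda^\delta(y_0)|=0$ (joint limit). (A7) $\lim_{\lambda\downarrow0}\rho_H(\mathrm{co}\,\Theta^\lambda,W)=0$. *)

(* Defs.v *)
From HB Require Import structures.
From mathcomp Require Import all_boot all_order all_algebra.
From mathcomp Require Import all_classical all_reals all_analysis.

Set Implicit Arguments.
Unset Strict Implicit.
Unset Printing Implicit Defensive.

Import Order.TTheory GRing.Theory Num.Theory.
Import numFieldNormedType.Exports.

Local Open Scope classical_set_scope.
Local Open Scope ring_scope.

(* measurableType requires a distinguished point, metricType does not provide
   one. *)
#[short(type="pmetricType")]
HB.structure Definition PointedMetric (K : numDomainType) :=
  {T of Pointed T & Metric K T}.

Notation borel T := (g_sigma_algebraType (@open T)) (only parsing).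

Section control.
Context {R : realType} {m : nat} {U : pmetricType R}.

Local Notation state := 'rV[R]_m.
Local Notation mu := (@lebesgue_measure R).

Implicit Types (f : state * U -> state) (k : state * U -> R).
Implicit Types (Y K : set state) (x y : state).

(* The norm `|_| of 'rV[R]_m is the max norm. It is used below only for
   continuity and Lipschitz conditions, which do not depend on the norm; the
   ball in Y^delta is the Euclidean one. *)
Definition enorm x : R := Num.sqrt (\sum_i x ord0 i ^+ 2).

Definition enlarge Y (delta : R) : set state :=
  [set y + z | y in Y & z in [set z | enorm z <= delta]].

Definition lipschitz_in_state f : Prop :=
  exists L : R, forall (u : U) x x',
    `|f (x, u) - f (x', u)| <= L * `|x - x'|.

(* Only the values on [0, +oo[ of controls and trajectories matter.
   Measurability is from the Borel sets of the line to those of U. As U is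
   separable, a Lebesgue-measurable control equals a Borel one almost
   everywhere, and trajectories and integrals do not see null sets. *)
Definition control (u : R -> U) : Prop :=
  measurable_fun (`[0, +oo[ : set R) (u : R -> borel U).

(* Solutions are taken in the sense of Caratheodory: y is continuous and
   y(t) = y0 + \int_0^t f(y(s), u(s)) ds for t >= 0. *)
Definition is_solution f y0 (u : R -> U) (y : R -> state) : Prop :=
  {within `[0, +oo[, continuous y} /\
  forall t, 0 <= t -> forall i,
    y t ord0 i =
      y0 ord0 i + \int[mu]_(s in `[0, t]) f (y s, u s) ord0 i.

(* A control is kept together with its trajectory; the latter is determined on
   [0, +oo[ by the control when f is continuous and Lipschitz in the state. *)
Definition admissible f K (I : set R) y0 : set ((R -> U) * (R -> state)) :=
  [set p | [/\ control p.1, is_solution f y0 p.1 p.2 &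
               forall t, I t -> K (p.2 t)]].

Definition adm_upto f K (T : R) y0 := admissible f K `[0, T] y0.

Definition adm_inf f K y0 := admissible f K `[0, +oo[ y0.

Local Open Scope ereal_scope.

Definition V f k K (T : R) y0 : \bar R :=
  T^-1%:E * ereal_inf
    [set \int[mu]_(t in `[0%R, T]) (k (p.2 t, p.1 t))%:E
      | p in adm_upto f K T y0].

Definition h f k K (lambda : R) y0 : \bar R :=
  lambda%:E * ereal_inf
    [set \int[mu]_(t in `[0%R, +oo[)
           (expR (- (lambda * t)) * k (p.2 t, p.1 t))%:E
      | p in adm_inf f K y0].

(* Borel measures on Y x U are represented by the Borel measures on R^m x U
   that vanish outside Y x U. *)
Definition prob := probability (borel (state * U)%type) R.

Definition fmeas := {finite_measure set (borel (state * U)%type) -> \bar R}.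

Definition cyl Y : set (state * U) := Y `*` setT.

Definition P_ Y : set prob := [set g : prob | g (~` cyl Y) = 0].

Definition M_ Y : set fmeas := [set xi : fmeas | xi (~` cyl Y) = 0].

Definition C1 (phi : state -> R) : Prop :=
  (forall x, differentiable phi x) /\
  (forall v : state, continuous (fun x => 'd phi x v)).

(* nabla phi(y) f(y, u) *)
Definition drift f (phi : state -> R) (z : state * U) : R :=
  'd phi (z.1) (f z).

Definition W f Y : set prob :=
  [set g : prob | P_ Y g /\
    forall phi, C1 phi -> \int[g]_(z in cyl Y) (drift f phi z)%:E = 0].

Definition Omega f Y y0 : set (prob * fmeas) :=
  [set p | [/\ W f Y p.1, M_ Y p.2 &
    forall phi, C1 phi ->
      \int[p.1]_(z in cyl Y) (phi y0 - phi z.1)%:E +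
      \int[p.2]_(z in cyl Y) (drift f phi z)%:E = 0]].

Definition kstar f k Y y0 : \bar R :=
  ereal_inf [set \int[p.1]_(z in cyl Y) (k z)%:E | p in Omega f Y y0].

Definition dual_feasible f k Y y0 (c : R) (psi eta : state -> R) : Prop :=
  [/\ C1 psi, C1 eta &
    forall z, cyl Y z ->
      (0 <= k z + (psi y0 - psi z.1) + drift f eta z - c)%R /\
      (0 <= drift f psi z)%R].

Definition dstar f k Y y0 : \bar R :=
  ereal_sup [set c%:E | c in
    [set c | exists psi eta, dual_feasible f k Y y0 c psi eta]].

(* Since Q ranges over all Borel subsets of R^m x U, these conditions force
   the measures to vanish outside Y x U. *)
Definition Gamma f Y (T : R) : set prob :=
  [set g : prob | exists y0 p, [/\ Y y0, adm_upto f Y T y0 p &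
    forall Q : set (borel (state * U)%type), measurable Q ->
      g Q = T^-1%:E * \int[mu]_(t in `[0%R, T]) (\1_Q (p.2 t, p.1 t))%:E]].

Definition Theta f Y (lambda : R) : set prob :=
  [set g : prob | exists y0 p, [/\ Y y0, adm_inf f Y y0 p &
    forall Q : set (borel (state * U)%type), measurable Q ->
      g Q = lambda%:E * \int[mu]_(t in `[0%R, +oo[)
              (expR (- (lambda * t)) * \1_Q (p.2 t, p.1 t))%:E]].

Definition co (G : set prob) : set prob :=
  [set g : prob | exists (n : nat) (a : 'I_n -> R) (gs : 'I_n -> prob),
    [/\ forall i, (0 <= a i)%R, (\sum_i a i = 1)%R, forall i, G (gs i) &
        forall Q : set (borel (state * U)%type), measurable Q -> g Q = \sum_i (a i)%:E * gs i Q]].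

(* (q j) consists of Lipschitz functions and is dense in the unit ball of
   C(Y x U); the values of q j outside Y x U are irrelevant. *)
Definition test_sequence Y (q : nat -> state * U -> R) : Prop :=
  [/\ forall j, exists L : R, forall z w, cyl Y z -> cyl Y w ->
        (`|q j z - q j w| <= L * (`|z.1 - w.1| + mdist z.2 w.2))%R,
      forall j z, cyl Y z -> (`|q j z| <= 1)%R &
      forall g : state * U -> R, {within cyl Y, continuous g} ->
        (forall z, cyl Y z -> (`|g z| <= 1)%R) ->
        forall e : R, (0 < e)%R ->
          exists j, forall z, cyl Y z -> (`|g z - q j z| <= e)%R].

(* The index j starts at 0, hence the weight 2^-(j+1). *)
Definition rho Y (q : nat -> state * U -> R) (g g' : prob) : \bar R :=
  \sum_(0 <= j <oo) (2 ^- j.+1 *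
    `|\int[g]_(z in cyl Y) q j z - \int[g']_(z in cyl Y) q j z|)%R%:E.

Definition rho_set Y q (g : prob) (G : set prob) : \bar R :=
  ereal_inf [set rho Y q g g' | g' in G].

Definition rhoH Y q (G1 G2 : set prob) : \bar R :=
  maxe (ereal_sup [set rho_set Y q g G2 | g in G1])
       (ereal_sup [set rho_set Y q g G1 | g in G2]).

(* In \bar R, |v x - v x'| = +oo as soon as v x or v x' is infinite, so that
   v is finite on K. *)
Definition lipschitz_ext K (v : state -> \bar R) : Prop :=
  exists L : R, forall x x', K x -> K x' ->
    `|v x - v x'| <= (L * `|x - x'|)%:E.

Definition A1 f Y (delta0 : R) : Prop :=
  forall delta : R, (0 < delta < delta0)%R ->
  forall y0, enlarge Y delta y0 -> adm_inf f (enlarge Y delta) y0 !=set0.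

Definition A2 f k Y (delta0 : R) : Prop :=
  forall delta T : R, (0 < delta < delta0)%R -> (0 < T)%R ->
  lipschitz_ext (enlarge Y delta) (V f k (enlarge Y delta) T).

Definition A3 f k Y (delta0 : R) : Prop :=
  forall delta lambda : R, (0 < delta < delta0)%R -> (0 < lambda)%R ->
  lipschitz_ext (enlarge Y delta) (h f k (enlarge Y delta) lambda).

Definition A4 f k Y : Prop :=
  forall y0, Y y0 ->
  `|V f k Y p.1 y0 - V f k (enlarge Y p.2) p.1 y0|
    @[p --> filter_prod (pinfty_nbhs R) (at_right (0 : R))] --> 0.

Definition A5 f Y q : Prop :=
  rhoH Y q (co (Gamma f Y T)) (W f Y) @[T --> +oo%R] --> 0.

Definition A6 f k Y : Prop :=
  forall y0, Y y0 ->
  `|h f k Y p.1 y0 - h f k (enlarge Y p.2) p.1 y0|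
    @[p --> filter_prod (at_right (0 : R)) (at_right (0 : R))] --> 0.

Definition A7 f Y q : Prop :=
  rhoH Y q (co (Theta f Y lambda)) (W f Y) @[lambda --> 0%R^'+] --> 0.

Definition liminf_V f k Y y0 : \bar R :=
  limf_einf (fun T : R => V f k Y T y0) (pinfty_nbhs R).

Definition limsup_V f k Y y0 : \bar R :=
  limf_esup (fun T : R => V f k Y T y0) (pinfty_nbhs R).

Definition liminf_h f k Y y0 : \bar R :=
  limf_einf (fun lambda : R => h f k Y lambda y0) (at_right (0 : R)).

Definition limsup_h f k Y y0 : \bar R :=
  limf_esup (fun lambda : R => h f k Y lambda y0) (at_right (0 : R)).

End control.

(* Main.v *)
Require Import Defs.
From HB Require Import structures.
From mathcomp Require Import all_boot all_order all_algebra.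
From mathcomp Require Import all_classical all_reals all_analysis.
From mathcomp Require Import measurable_realfun.
From mathcomp Require Import uniform_distribution exponential_distribution.
From mathcomp Require Import ring lra.

Set Implicit Arguments.
Unset Strict Implicit.
Unset Printing Implicit Defensive.

Import Order.TTheory GRing.Theory Num.Theory.
Import numFieldNormedType.Exports.

Local Open Scope classical_set_scope.
Local Open Scope ring_scope.

(* Both optimal values have the form v(x) = inf E k(y(t), u(t)) over the
   admissible pairs (u, y) starting at x, where the time t is random: uniform on
   [0, T] for V_T, exponential of parameter lambda for h_lambda. The only property
   of this law nu that matters is [slow]: if |c| <= M, shifting t by s changes
   E c(t) by at most 2 M kappa s, where kappa = 1/T or lambda tends to 0.

   Lower bound. If (c, psi, eta) is dual feasible, psi increases along
   trajectories, so the mean of k over [t, t + 1] is at least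
   c - (eta(y(t + 1)) - eta(y(t))); take expectations in t and use slowness.

   Upper bound. Let v be the value for the constraint set Y^delta, and M a bound
   of |k| there. Dynamic programming along constant controls gives
   v(x + s f(x, u)) >= v(x) - 2 M kappa s - O(s^2) near Y. As v is Lipschitz, its
   averages over small boxes are C^1 functions phi close to v which inherit this
   bound: grad phi(y) f(y, u) >= - 2 M kappa - eps on Y x U. For (gamma, xi) in
   Omega(y0), the constraint tested on phi yields
   phi(y0) <= int phi dgamma + (2 M kappa + eps) xi(Y x U).
   Finally int phi dgamma is at most int k dgamma up to a small error: by (A5) or
   (A7), gamma is a limit of convex combinations of occupational measures, for
   laws nu' with arbitrarily small kappa', and along a trajectory in Y
   E v(y(t)) <= E E k(y(t + s), u(t + s)), with s of law nu and t of law nu',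
   which differs little from E k(y(t), u(t)) by the slowness of nu'. *)

(** The enlargement is forced by constant controls: from a boundary point of Y such a control may
    leave Y at once, and no regularity of the value on Y itself is assumed. In Y^delta every point
    near Y has room, so a short arc with constant control followed by any admissible trajectory is a
    competitor. This one-sided inequality is all that is extracted from dynamic programming. The
    order of the limits matters. The joint limit in (A4) or (A6) lets delta be fixed first, the
    horizon or the discount rate moving afterwards. For a fixed law nu, the Lipschitz constant of v
    may be arbitrarily large: eps is sent to 0 while nu, hence kappa, is fixed, so that only 2 M
    kappa xi(Y x U) survives. It vanishes with kappa, as xi is given and M does not depend on nu.
    The law nu' is chosen after nu, so kappa' can be small against the time scale of nu. *)

HB.instance Definition _ (S T : ptopologicalType) := Pointed.on (S * T)%type.

(** * Bounded integrands and Borel measurability *)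

Lemma bounded_integrable d (T : measurableType d) (R : realType)
    (P : {measure set T -> \bar R}) (D : set T) (F : T -> R) (M : R) :
  (P D < +oo)%E -> measurable D -> measurable_fun D F ->
  (forall x, D x -> `|F x| <= M) -> P.-integrable D (EFin \o F).
Proof.
move=> PD mD mF FM; apply: measurable_bounded_integrable => //.
exists M; split; first exact: num_real.
by move=> x Mx y Dy; exact: (le_trans (FM _ Dy) (ltW Mx)).
Qed.

Lemma Rintegral_le_abs d (T : measurableType d) (R : realType)
    (P : {measure set T -> \bar R}) (D : set T) (F G : T -> R) :
  measurable D -> P.-integrable D (EFin \o F) -> P.-integrable D (EFin \o G) ->
  (forall x, D x -> `|F x| <= G x) ->
  `|\int[P]_(x in D) F x| <= \int[P]_(x in D) G x.
Proof.
move=> mD iF iG FG; apply: le_trans (le_normr_Rintegral mD iF) _.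
by apply: le_Rintegral => //; exact: integrable_norm.
Qed.

Lemma open_borel_measurable (T : ptopologicalType) (A : set T) :
  open A -> measurable (A : set (borel T)).
Proof. by move=> oA; exact: sub_sigma_algebra. Qed.

Lemma closed_borel_measurable (T : ptopologicalType) (A : set T) :
  closed A -> measurable (A : set (borel T)).
Proof.
move=> cA; rewrite -[A]setCK; apply: measurableC.
by apply: open_borel_measurable; exact: closed_openC.
Qed.

Lemma continuous_within_borel_measurable (T : ptopologicalType) (R : realType)
    (D : set T) (F : T -> R) :
  closed D -> {within D, continuous F} ->
  measurable_fun (D : set (borel T)) (F : borel T -> R).
Proof.
move=> cD /continuousP cF.
apply: (measurability _ (RGenOpens.measurableE R)) => _ [_ [a [b ->] <-]].
have /open_subspaceP[V oV VD] := cF _ (@interval_open R (BRight a) (BLeft b) isT isT).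
rewrite setIC -VD; apply: measurableI; first exact: open_borel_measurable.
exact: closed_borel_measurable.
Qed.

Lemma continuous_borel_measurable (T : ptopologicalType) (R : realType)
    (F : T -> R) :
  continuous F -> measurable_fun setT (F : borel T -> R).
Proof.
move=> cF; apply: continuous_within_borel_measurable; first exact: closedT.
by apply: continuous_subspaceT => x; exact: cF.
Qed.

(* No second countability is needed: as the first component is continuous, an
   open set of the product is hit at time t iff, for some rational r close to t,
   the second component lies in the interior of the common sections of that
   set over the times near r. *)
Lemma measurable_pair_borel (R : realType) (S V : ptopologicalType)
    (y : R -> S) (u : R -> V) :
  continuous y -> measurable_fun setT (u : R -> borel V) ->
  measurable_fun setT ((fun t => (y t, u t)) : R -> borel (S * V)%type).
Proof.
move=> cy mu; apply: (@measurability _ _ _ (borel (S * V)%type) setT _ (@open (S * V)%type)); first by [].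
move=> _ [Q oQ <-].
rewrite setTI.
pose O (r e : rat) := interior [set v : V | forall s : R, `|s - ratr r| < ratr e -> Q (y s, v)].
rewrite (_ : _ @^-1` _ = \bigcup_(r : rat) \bigcup_(e : rat)
  ([set t : R | `|t - ratr r| < ratr e] `&` u @^-1` (O r e))); last first.
  apply/seteqP; split => [t /= Qt|t [r _ [e _ [/= tre /interior_subset]]]]; last exact.
  move: oQ; rewrite openE => /(_ _ Qt)[/= [A B] [/= At Bt] ABQ].
  have /nbhs_ballP[d /= d0 dA] := cy t _ At.
  have [e] := @rat_in_itvoo R 0 (d / 2) ltac:(by rewrite divr_gt0).
  rewrite in_itv /= => /andP[e0 ed].
  have [r] := @rat_in_itvoo R (t - ratr e) (t + ratr e) ltac:(lra).
  rewrite in_itv /= => /andP[re1 re2].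
  exists r => //; exists e => //; split => /=.
    by rewrite ltr_norml; apply/andP; split; lra.
  apply: filterS Bt => v Bv s; rewrite ltr_norml => /andP[s1 s2].
  apply: (ABQ (y s, v)); split => //=; apply: dA.
  by rewrite /ball /= ltr_norml; apply/andP; split; lra.
apply: bigcupT_measurable_rat => r; apply: bigcupT_measurable_rat => e.
apply: measurableI.
  rewrite (_ : [set _ | _] = `](ratr r - ratr e : R), (ratr r + ratr e)[%classic); first exact: measurable_itv.
  by apply/seteqP; split => t /=; rewrite in_itv /= ltr_norml => /andP[? ?]; apply/andP; split; lra.
rewrite -[X in measurable X]setTI; apply: mu => //.
by apply: open_borel_measurable; exact: open_interior.
Qed.

(** * Translation invariance of Lebesgue measure *)

Lemma lebesgue_measure_shift (R : realType) (s : R) (A : set R) :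
  measurable A ->
  pushforward lebesgue_measure (fun t : measurableTypeR R => (t + s : measurableTypeR R)%R) A = lebesgue_measure A.
Proof.
have ms : measurable_fun setT (fun t : measurableTypeR R => (t + s : measurableTypeR R)%R).
  exact: measurable_funD.
move=> mA; apply/esym; apply: (@lebesgue_measure_unique R [the measure _ _ of pushforward lebesgue_measure (fun t : measurableTypeR R => (t + s : measurableTypeR R)%R)]) => //= _ [[a b]] _ <-.
rewrite /pushforward (_ : _ @^-1` _ = `](a - s), (b - s)]%classic); last first.
  by apply/seteqP; split => t /=; rewrite !in_itv /= => /andP[? ?]; apply/andP; split; lra.
rewrite /= !lebesgue_measure_itv /= !lte_fin ltrD2r.
by case: ifP => // _; rewrite -!EFinD; congr EFin; lra.
Qed.

(** Change of variables for the pushforward by a translation, which is Lebesgue measure again. *)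
Lemma integral_shift (R : realType) (s : R) (D : set R) (F : R -> \bar R) :
  measurable D -> measurable_fun setT F ->
  lebesgue_measure.-integrable D F ->
  (\int[lebesgue_measure]_(t in [set t : R | D (t + s)%R]) F (t + s)%R =
   \int[lebesgue_measure]_(t in D) F t)%E.
Proof.
have ms : measurable_fun setT (fun t : measurableTypeR R => (t + s : measurableTypeR R)%R).
  exact: measurable_funD.
move=> mD mF iF.
rewrite [RHS](_ : _ = \int[pushforward lebesgue_measure (fun t : measurableTypeR R => (t + s : measurableTypeR R)%R)]_(t in D) F t)%E; last first.
  by apply: eq_measure_integral => A mA _; rewrite /= lebesgue_measure_shift.
have iFs : lebesgue_measure.-integrable ((fun t : measurableTypeR R => (t + s : measurableTypeR R)%R) @^-1` D)
   (F \o (fun t : measurableTypeR R => (t + s : measurableTypeR R)%R)).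
  apply/integrableP; split.
    by apply: measurable_funTS; exact: measurableT_comp.
  have /integrableP[_] := iF; apply: le_lt_trans.
  rewrite [leRHS](_ : _ = \int[pushforward lebesgue_measure (fun t : measurableTypeR R => (t + s : measurableTypeR R)%R)]_(t in D) `|F t|)%E; last first.
    by apply: eq_measure_integral => A mA _; rewrite /= lebesgue_measure_shift.
  rewrite ge0_integral_pushforward//.
  by apply: measurable_funTS; exact: measurableT_comp.
by rewrite integral_pushforward.
Qed.
Lemma Rintegral_shift (R : realType) (s : R) (D : set R) (F : R -> R) :
  measurable D -> measurable_fun setT F ->
  lebesgue_measure.-integrable D (EFin \o F) ->
  \int[lebesgue_measure]_(t in [set t : R | D (t + s)]) F (t + s) =
  \int[lebesgue_measure]_(t in D) F t.
Proof.
move=> mD mF iF; congr fine.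
by rewrite -(integral_shift s mD _ iF)//; exact/measurable_EFinP.
Qed.

(** * Laws with a density, and their slowness *)

Section density.
Context d (T : measurableType d) (R : realType).
Variables (mu nu : {measure set T -> \bar R}) (w : T -> R).
Hypotheses (mw : measurable_fun setT w) (w0 : forall x, 0 <= w x).
Hypothesis nuE : forall A, measurable A -> nu A = (\int[mu]_(x in A) (w x)%:E)%E.
Import HBNNSimple.
Local Open Scope ereal_scope.

Let integral_density_nnsfun (g : {nnsfun T >-> R}) :
  \int[nu]_x (g x)%:E = \int[mu]_x (g x * w x)%:E.
Proof.
under [LHS]eq_integral do rewrite fimfunE -fsumEFin//.
rewrite ge0_integral_fsum//; last 2 first.
- by move=> r; exact/measurable_EFinP/measurableT_comp.
- by move=> n x _; rewrite EFinM nnfun_muleindic_ge0.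
transitivity (\int[mu]_x (\sum_(r \in range g) (r * \1_(g @^-1` [set r]) x)%:E * (w x)%:E)).
  rewrite ge0_integral_fsum//; last 2 first.
  - move=> r; apply: emeasurable_funM; last exact/measurable_EFinP.
    by apply/measurable_EFinP; exact: measurable_funM.
  - by move=> n x _; rewrite mule_ge0 ?lee_fin// -lee_fin EFinM nnfun_muleindic_ge0.
  apply: eq_fsbigr => r _.
  rewrite integralZl_indic_nnsfun//= integral_indic// setIT nuE//.
  under [RHS]eq_integral do rewrite EFinM -muleA.
  (* The function [g] takes no negative value; this case is split off because the scalar [r] is
     pulled out below by a rule for nonnegative factors. *)
  have [r0|r0] := ltP r 0%R.
    rewrite (_ : g @^-1` [set r] = set0); last first.
      by apply/seteqP; split => // x /= gxr; move: r0; rewrite -gxr ltNge fun_ge0.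
    rewrite integral_set0 mule0 integral0_eq// => x _.
    by rewrite indic0 mul0e mule0.
  rewrite ge0_integralZl//; last 2 first.
    apply: emeasurable_funM; last exact/measurable_EFinP.
    exact/measurable_EFinP.
    by move=> x _; rewrite mule_ge0// lee_fin.
  congr (_ * _); rewrite integral_mkcond; apply: eq_integral => x _.
  by rewrite epatch_indic/= muleC.
apply: eq_integral => x _; rewrite EFinM [in RHS]fimfunE -fsumEFin//.
rewrite ge0_mule_fsuml// => r.
by rewrite EFinM nnfun_muleindic_ge0.
Qed.

Lemma ge0_integral_density (F : T -> \bar R) :
  measurable_fun setT F -> (forall x, 0 <= F x) ->
  \int[nu]_x F x = \int[mu]_x (F x * (w x)%:E).
Proof.
move=> mF F0; pose f_ := nnsfun_approx measurableT mF.
transitivity (limn (fun n => \int[nu]_x (f_ n x)%:E)).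
  rewrite -monotone_convergence//.
  - by apply: eq_integral => x _; apply/esym/cvg_lim => //; exact: cvg_nnsfun_approx.
  - by move=> n; exact/measurable_EFinP.
  - by move=> n x _; rewrite lee_fin.
  - by move=> x _ a b ab; rewrite lee_fin; exact/lefP/nd_nnsfun_approx.
transitivity (limn (fun n => \int[mu]_x ((f_ n x)%:E * (w x)%:E))); last first.
  rewrite -monotone_convergence//.
  - apply: eq_integral => x _; apply/cvg_lim => //.
    by apply: cvgeZr => //; exact: cvg_nnsfun_approx.
  - by move=> n; apply: emeasurable_funM; exact/measurable_EFinP.
  - by move=> n x _; rewrite mule_ge0// lee_fin.
  - move=> x _ a b ab; rewrite lee_wpmul2r ?lee_fin//.
    exact/lefP/nd_nnsfun_approx.
congr (limn _); apply/funext => n; rewrite integral_density_nnsfun.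
by under eq_integral do rewrite EFinM.
Qed.

(** As [w] is nonnegative, multiplying by it commutes with taking positive and negative parts. *)
Lemma Rintegral_density (F : T -> R) :
  measurable_fun setT F -> nu.-integrable setT (EFin \o F) ->
  (\int[nu]_x F x = \int[mu]_x (F x * w x))%R.
Proof.
move=> mF iF; rewrite /Rintegral; congr fine.
have mF' : measurable_fun setT (EFin \o F) by exact/measurable_EFinP.
rewrite [LHS]integralE [RHS]integralE; congr (_ - _).
  rewrite (ge0_integral_density (measurable_funepos mF'))//.
  by apply: eq_integral => x _; rewrite !funeposE /= EFinM maxe_pMl ?mul0e ?lee_fin.
rewrite (ge0_integral_density (measurable_funeneg mF'))//.
apply: eq_integral => x _; rewrite !funenegE /= -mulNr EFinM.
by rewrite maxe_pMl ?lee_fin// mul0e.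
Qed.

End density.

Section integrable_real.
Context d (T : measurableType d) (R : realType) (mu : {measure set T -> \bar R}).
Variables (D : set T) (F G : T -> R).
Hypotheses (mD : measurable D) (iF : mu.-integrable D (EFin \o F))
  (iG : mu.-integrable D (EFin \o G)).

Lemma integrable_addr : mu.-integrable D (EFin \o (fun x => F x + G x)).
Proof. exact: (integrableD mD iF iG). Qed.

Lemma integrable_subr : mu.-integrable D (EFin \o (fun x => F x - G x)).
Proof. exact: (integrableB mD iF iG). Qed.

Lemma integrable_mull (a : R) : mu.-integrable D (EFin \o (fun x => a * F x)).
Proof. exact: (integrableZl mD a iF). Qed.

End integrable_real.

(** The second clause says, through bounded test functions, that the law and its translate by [s]
    differ by at most [2 * kappa * s] in total variation. The first one makes negative times
    irrelevant, where trajectories are extended artificially. *)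
Definition slow (R : realType) (kappa : R) (nu : probability (measurableTypeR R) R) :=
  nu `]-oo, 0[%classic = 0%E /\
  forall (c : R -> R) (M s : R), measurable_fun setT c ->
    (forall t, `|c t| <= M) -> 0 <= s ->
    `|\int[nu]_t c (t + s) - \int[nu]_t c t| <= 2 * M * kappa * s.

Lemma bounded_prob_integrable d (T : measurableType d) (R : realType)
    (P : probability T R) (F : T -> R) (M : R) :
  measurable_fun setT F -> (forall x, `|F x| <= M) ->
  P.-integrable setT (EFin \o F).
Proof.
move=> mF FM; apply: (bounded_integrable (M := M)) => //.
by rewrite [X in (X < _)%E]probability_setT ltry.
Qed.

Lemma prob_Rintegral_cst d (T : measurableType d) (R : realType)
    (P : probability T R) (a : R) : \int[P]_x a = a.
Proof. by rewrite Rintegral_cst// [X in fine X]probability_setT mulr1. Qed.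

Section slow_density.
Context (R : realType) (nu : probability (measurableTypeR R) R) (w : R -> R) (kappa : R).
Local Notation mu := (@lebesgue_measure R).
Hypotheses (mw : measurable_fun setT w) (w0 : forall x, 0 <= w x).
Hypothesis nuE : forall A, measurable A -> nu A = (\int[mu]_(x in A) (w x)%:E)%E.
Hypotheses (w_neg : forall t, t < 0 -> w t = 0) (w_le : forall t, w t <= kappa).
Hypothesis w_decr : forall t s, 0 <= t -> 0 <= s -> w (t + s) <= w t.

(** After a translation the difference of expectations is the integral of [c t * (w (t - s) - w t)].
    The bracket has integral zero and is negative only on [[0, s]], where it is at least [- kappa];
    hence its L1 norm is at most [2 * kappa * s]. *)
Lemma slow_density : slow kappa nu.
Proof.
have iw : mu.-integrable setT (EFin \o w).
  apply/integrableP; split; first exact/measurable_EFinP.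
  under eq_integral do rewrite /= ger0_norm//.
  by rewrite -nuE// [X in (X < _)%E]probability_setT ltry.
have w1 : \int[mu]_t w t = 1.
  by rewrite /Rintegral -nuE// [X in fine X]probability_setT.
split.
  by rewrite nuE//; apply: integral0_eq => t /=; rewrite in_itv/= => /w_neg ->.
move=> c M s mc cM s0.
have M0 : 0 <= M by exact: le_trans (cM 0).
have ms (v : R) : measurable_fun setT (fun t : R => t + v) by exact: measurable_funD.
have mws : measurable_fun setT (fun t : R => w (t + - s)) by exact: measurableT_comp.
have iws : mu.-integrable setT (EFin \o (fun t : R => w (t - s))).
  apply/integrableP; split; first exact/measurable_EFinP.
  under eq_integral do rewrite /= ger0_norm//.
  have := integral_shift (- s) measurableT (F := EFin \o w) _ iw.
  rewrite (_ : [set t | _] = setT)// => ->; last exact/measurable_EFinP.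
  by rewrite -nuE// [X in (X < _)%E]probability_setT ltry.
have icb (v b : R -> R) : measurable_fun setT b -> (forall t, `|b t| <= M) ->
    mu.-integrable setT (EFin \o v) -> mu.-integrable setT (EFin \o (fun t => b t * v t)).
  move=> mb bM iv.
  have iM : mu.-integrable setT (fun t => (M%:E * (v t)%:E)%E) by exact: integrableZl.
  apply: (le_integrable _ _ _ iM) => //.
    apply/measurable_EFinP/measurable_funM => //.
    by apply/measurable_EFinP; exact: measurable_int iv.
  move=> t _; rewrite /= lee_fin !normrM ler_wpM2r//.
  by rewrite (le_trans (bM t))// ler_norm.
have mcs : measurable_fun setT (fun t : R => c (t + s)) by exact: measurableT_comp.
rewrite !(@Rintegral_density _ _ _ mu nu w mw w0 nuE)//; last 2 first.
- exact: (@bounded_prob_integrable _ _ _ nu c M mc cM).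
- exact: (@bounded_prob_integrable _ _ _ nu _ M mcs (fun t => cM (t + s))).
have -> : \int[mu]_t (c (t + s) * w t) = \int[mu]_t (c t * w (t - s)).
  have := @Rintegral_shift R s setT (fun t => c t * w (t - s)) measurableT.
  rewrite (_ : [set t | _] = setT)// => <-.
  - by apply: eq_Rintegral => t _; rewrite addrK.
  - exact: measurable_funM.
  - exact: icb.
rewrite -RintegralB//; [|exact: icb|exact: icb].
(* This dominates the integrand: the indicator turns the negative part of the bracket into a
   positive one, and the two densities cancel on integration. *)
pose b t : R := M * (w (t - s) - w t + 2 * kappa * \1_`[0, s] t).
have i1 : mu.-integrable setT (EFin \o (\1_`[0, s] : R -> R)) by exact: integrable_indic_itv.
have iww := integrable_subr measurableT iws iw.
have ik1 := integrable_mull measurableT i1 (2 * kappa).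
have iwk := integrable_addr measurableT iww ik1.
have -> : 2 * M * kappa * s = \int[mu]_t b t.
  rewrite /b RintegralZl// RintegralD// RintegralB// RintegralZl//.
  have := @Rintegral_shift R (- s) setT w measurableT mw iw.
  rewrite (_ : [set t | _] = setT)// => ->.
  rewrite w1 subrr add0r /Rintegral integral_indic// setIT.
  rewrite /= lebesgue_measure_itv /= lte_fin; case: ltgtP s0 => //= [s0 _|<- _].
    by rewrite oppr0 addr0; ring.
  by rewrite !mulr0.
apply: Rintegral_le_abs => //.
- by apply: integrable_subr => //; exact: icb.
- exact: integrable_mull.
move=> t _; rewrite -mulrBr normrM /b; apply: ler_pM => //.
have k0 : 0 <= kappa by exact: le_trans (w_le 0).
rewrite indicE /=; have [ts|ts] := ltP t s.
  rewrite (w_neg (t := t - s)) ?subr_lt0// sub0r normrN ger0_norm//.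
  have [t0|t0] := ltP t 0; first by rewrite (w_neg t0) oppr0 add0r mulr_ge0// mulr_ge0.
  rewrite mem_set /= ?in_itv /= ?t0 ?(ltW ts)// mulr1.
  by have := w_le t; lra.
have := w_decr (t := t - s) (s := s); rewrite subr_ge0 => /(_ ts s0).
rewrite subrK => wts; rewrite ger0_norm ?subr_ge0//.
by rewrite lerDl mulr_ge0// mulr_ge0.
Qed.

End slow_density.

(** * Averages over two independent random times *)

Section prob_fubini.
Context d1 d2 (T1 : measurableType d1) (T2 : measurableType d2) (R : realType).
Variables (P : probability T1 R) (Q : probability T2 R).
Variables (f : T1 * T2 -> R) (M : R).
Hypotheses (mf : measurable_fun setT f) (fM : forall z, `|f z| <= M).

Let if_ : (P \x Q)%E.-integrable setT (EFin \o f).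
Proof.
apply: (bounded_integrable (M := M)) => //.
have PQ1 : (P \x Q)%E setT = 1%E.
  rewrite -setXTT product_measure1E//= [X in (X * _)%E]probability_setT.
  by rewrite [X in (_ * X)%E]probability_setT mule1.
by rewrite [X in (X < _)%E]PQ1 ltry.
Qed.

Let fin1 x : (\int[Q]_y (f (x, y))%:E)%E \is a fin_num.
Proof.
apply: integrable_fin_num => //; apply: (@bounded_prob_integrable _ _ _ Q _ M) => //.
exact: measurableT_comp.
Qed.

Let fin2 y : (\int[P]_x (f (x, y))%:E)%E \is a fin_num.
Proof.
apply: integrable_fin_num => //; apply: (@bounded_prob_integrable _ _ _ P _ M) => //.
exact: measurableT_comp.
Qed.

Lemma measurable_prob_section : measurable_fun setT (fun x => \int[Q]_y f (x, y)).
Proof.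
apply/measurable_EFinP.
have -> : EFin \o (fun x => \int[Q]_y f (x, y)) = fubini_F Q (EFin \o f).
  by apply/funext => x; rewrite /= /Rintegral fineK.
exact: (measurable_fubini_F if_).
Qed.

Lemma prob_Fubini :
  \int[P]_x \int[Q]_y f (x, y) = \int[Q]_y \int[P]_x f (x, y).
Proof.
rewrite {1}/Rintegral; under eq_integral do rewrite /Rintegral fineK//.
rewrite [RHS]/Rintegral; under [in RHS]eq_integral do rewrite /Rintegral fineK//.
by congr fine; exact: (Fubini if_).
Qed.

End prob_fubini.

Lemma prob_Rintegral_abs_le d (T : measurableType d) (R : realType)
    (P : probability T R) (F : T -> R) (M : R) :
  measurable_fun setT F -> (forall x, `|F x| <= M) -> `|\int[P]_x F x| <= M.
Proof.
move=> mF FM; rewrite -[leRHS](prob_Rintegral_cst P).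
apply: Rintegral_le_abs => //; first exact: (@bounded_prob_integrable _ _ _ P _ M).
by apply: (@bounded_prob_integrable _ _ _ P _ `|M|).
Qed.

Lemma prob_tail_small (R : realType) (nu : probability (measurableTypeR R) R) (e : R) :
  0 < e -> exists2 N : R, 0 <= N & fine (nu `]N, +oo[%classic) < e.
Proof.
move=> e0.
have := @nonincreasing_cvg_mu _ _ _ nu (fun n : nat => `]n%:R : R, +oo[%classic).
have -> : \bigcap_n `]n%:R : R, +oo[%classic = set0.
  apply/seteqP; split => // x /= /(_ (Num.truncn `|x|).+1 I) /=.
  rewrite in_itv /= andbT => H.
  have := truncnS_gt `|x|; rewrite ltNge => /negP; apply.
  by rewrite (le_trans (ltW H))// ler_norm.
rewrite measure0 => /(_ _ _ _ _) H.
have : (nu `]n%:R : R, +oo[%classic @[n --> \oo] --> 0)%E.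
  apply: H => //.
  - by rewrite (le_lt_trans (probability_le1 _ _))// ltry.
  - move=> m n mn; rewrite subsetEset => x /=; rewrite !in_itv /= !andbT.
    by apply: le_lt_trans; rewrite ler_nat.
move=> /fine_cvgP[_] /cvgrPdist_lt /(_ e e0) [n _ /(_ n (leqnn n))] /=.
rewrite sub0r normrN ger0_norm ?fine_ge0// => Hn.
by exists n%:R.
Qed.

Section slow_average.
Context (R : realType) (nu nu' : probability (measurableTypeR R) R).
Variables (kappa : R) (c : R -> R) (M : R).
Hypotheses (slow_nu' : slow kappa nu') (nu_neg : nu `]-oo, 0[%classic = 0%E).
Hypotheses (mc : measurable_fun setT c) (cM : forall t, `|c t| <= M).

Let mcD : measurable_fun setT (fun z : measurableTypeR R * measurableTypeR R => c (z.1 + z.2)).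
Proof. by apply: measurableT_comp => //; exact: measurable_funD. Qed.

Lemma measurable_average : measurable_fun setT (fun t : R => \int[nu]_s c (t + s)).
Proof. exact: (@measurable_prob_section _ _ _ _ _ nu nu _ M mcD). Qed.

Lemma average_bound (t : R) : `|\int[nu]_s c (t + s)| <= M.
Proof.
apply: prob_Rintegral_abs_le => //.
by apply: measurableT_comp => //; exact: measurable_funD.
Qed.

(** With the integral in [s] outermost, slowness of [nu'] handles the shifts [s <= N]; for longer
    shifts the trivial bound [2 * M] is paid with the probability of the tail. *)
Lemma slow_average_le (N : R) : 0 <= N ->
  `|\int[nu']_(t in [set: R]) \int[nu]_s c (t + s) - \int[nu']_t c t| <=
  2 * M * kappa * N + 2 * M * fine (nu `]N, +oo[%classic).
Proof.
move=> N0.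
have M0 : 0 <= M by exact: le_trans (cM 0).
rewrite (@prob_Fubini _ _ _ _ _ nu' nu _ M mcD)//.
have mc2 : measurable_fun setT (fun s : R => \int[nu']_t c (t + s)).
  under eq_fun do under eq_Rintegral do rewrite addrC.
  exact: (@measurable_prob_section _ _ _ _ _ nu' nu' _ M mcD).
have cb (s : R) : `|\int[nu']_t c (t + s)| <= M.
  apply: prob_Rintegral_abs_le => //.
  by apply: measurableT_comp => //; exact: measurable_funD.
have ic2 : nu.-integrable setT (EFin \o (fun s : R => \int[nu']_t c (t + s))).
  exact: (@bounded_prob_integrable _ _ _ nu _ M mc2 cb).
have icst (a : R) : nu.-integrable setT (EFin \o (fun=> a)).
  exact: (@bounded_prob_integrable _ _ _ nu _ `|a|).
have -> : \int[nu']_t c t = \int[nu]_s (\int[nu']_t c t) by rewrite prob_Rintegral_cst.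
rewrite -RintegralB//.
have iI (A : set R) : measurable A -> nu.-integrable setT (EFin \o (\1_A : R -> R)).
  move=> mA; apply: (@bounded_prob_integrable _ _ _ nu _ 1) => // x.
  by rewrite indicE; case: (_ \in _); rewrite /= ?normr1 ?normr0.
(* The bound must hold for every real [s], so negative shifts get an indicator of their own; [nu]
   does not charge it. *)
pose b s : R := 2 * M * kappa * N + (2 * M * \1_`]N, +oo[ s + 2 * M * \1_`]-oo, 0[ s).
have i1 := integrable_mull measurableT (iI _ (measurable_itv `]N, +oo[)) (2 * M).
have i2 := integrable_mull measurableT (iI _ (measurable_itv `]-oo, 0[)) (2 * M).
have i3 := integrable_addr measurableT i1 i2.
(* The sign of [kappa] comes from slowness itself: at [s = 1] it bounds an absolute value by
   [2 * M * kappa]. *)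
have k0 : 0 <= M * kappa.
  have [_ /(_ c M 1 mc cM ler01)] := slow_nu'.
  by move=> /(le_trans (normr_ge0 _)); rewrite mulr1 -mulrA pmulr_rge0.
have -> : 2 * M * kappa * N + 2 * M * fine (nu `]N, +oo[%classic) = \int[nu]_s b s.
  rewrite /b RintegralD// prob_Rintegral_cst RintegralD// !RintegralZl//; [|exact: iI|exact: iI].
  have H (A : set R) : measurable A -> \int[nu]_x (\1_A x : R) = fine (nu A).
    by move=> mA; rewrite /Rintegral integral_indic// setIT.
  rewrite (H _ (measurable_itv `]N, +oo[)) (H _ (measurable_itv `]-oo, 0[)).
  by rewrite [in X in _ = _ + (_ + _ * X)]nu_neg/= mulr0 addr0.
apply: Rintegral_le_abs => //.
- exact: integrable_subr.
- by apply: integrable_addr.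
move=> s _; rewrite /b !indicE /=.
have M20 : 0 <= 2 * M by rewrite mulr_ge0.
have a0 : 0 <= 2 * M * kappa * N by rewrite mulr_ge0// -mulrA mulr_ge0.
have tot : `|\int[nu']_t c (t + s) - \int[nu']_t c t| <= 2 * M.
  rewrite mulr_natl mulr2n (le_trans (ler_normB _ _))// lerD//.
  exact: prob_Rintegral_abs_le.
have [s0|s0] := ltP s 0.
  rewrite [X in 2 * M * X + _]/= [in X in _ <= _ + (_ + X)]mem_set//= ?in_itv//= mulr1.
  by rewrite (le_trans tot)// addrA lerDr addr_ge0// mulr_ge0.
have [sN|sN] := ltP N s.
  rewrite [in X in _ <= _ + (X + _)]mem_set//= ?in_itv//= ?sN// mulr1.
  by rewrite (le_trans tot)// addrCA lerDl addr_ge0// mulr_ge0.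
have [_ /(_ c M s mc cM s0)] := slow_nu'.
move=> /le_trans; apply; apply: (@le_trans _ _ (2 * M * kappa * N)).
  by rewrite ler_wpM2l// -mulrA mulr_ge0.
by rewrite lerDl addr_ge0// mulr_ge0.
Qed.

End slow_average.

Section nonneg_support.
Context (R : realType) (nu : probability (measurableTypeR R) R).
Hypothesis nu_neg : nu `]-oo, 0[%classic = 0%E.

Lemma Rintegral_nonneg_support (F : R -> R) (M : R) :
  measurable_fun setT F -> (forall t, `|F t| <= M) ->
  \int[nu]_t F t = \int[nu]_(t in `[0, +oo[) F t.
Proof.
move=> mF FM; congr fine.
rewrite (@negligible_integral _ _ _ nu setT `]-oo, 0[%classic)//.
- by rewrite setTD setCitvl.
- exact: (@bounded_prob_integrable _ _ _ nu F M mF FM).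
Qed.

Lemma le_Rintegral_nonneg_support (F G : R -> R) (M : R) :
  measurable_fun setT F -> (forall t, `|F t| <= M) ->
  measurable_fun setT G -> (forall t, `|G t| <= M) ->
  (forall t, 0 <= t -> F t <= G t) ->
  \int[nu]_t F t <= \int[nu]_t G t.
Proof.
move=> mF FM mG GM FG; rewrite (Rintegral_nonneg_support mF FM).
rewrite (Rintegral_nonneg_support mG GM); apply: le_Rintegral => //.
- apply: integrableS (@bounded_prob_integrable _ _ _ nu F M mF FM) => //.
- apply: integrableS (@bounded_prob_integrable _ _ _ nu G M mG GM) => //.
- by move=> t /=; rewrite in_itv /= andbT; exact: FG.
Qed.

Lemma eq_Rintegral_nonneg_support (F G : R -> R) (M : R) :
  measurable_fun setT F -> (forall t, `|F t| <= M) ->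
  measurable_fun setT G -> (forall t, `|G t| <= M) ->
  (forall t, 0 <= t -> F t = G t) ->
  \int[nu]_t F t = \int[nu]_t G t.
Proof.
move=> mF FM mG GM FG; apply/eqP; rewrite eq_le; apply/andP; split;
  by apply: (@le_Rintegral_nonneg_support _ _ M) => // t t0; rewrite FG.
Qed.

End nonneg_support.

Lemma Rintegral_split (R : realType) (g : R -> R) (a b c : R) : a <= b -> b <= c ->
  lebesgue_measure.-integrable `[a, c] (EFin \o g) ->
  \int[lebesgue_measure]_(s in `[a, c]) g s =
  \int[lebesgue_measure]_(s in `[a, b]) g s + \int[lebesgue_measure]_(s in `[b, c]) g s.
Proof.
move=> ab bc ig.
have := @Rintegral_itvB R g (BLeft a) (BRight c) b ig.
rewrite !bnd_simp => /(_ ab bc) H.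
rewrite -(Rintegral_itv_obnd_cbnd (r := b) (b := BRight c)) -?H; first by rewrite addrC subrK.
by apply: integrableS ig => //; apply: subset_itvr; rewrite bnd_simp.
Qed.

(** * Coordinates, and extension of functions of time to the whole line *)

Section matrix_norm.
Context (R : realType) (m : nat).
Implicit Types x : 'rV[R]_m.

Lemma row_norm_le x (b : R) : 0 <= b ->
  (forall i, `|x ord0 i| <= b) -> `|x| <= b.
Proof.
move=> b0 xb; rewrite [leLHS]/Num.Def.normr /= mx_normrE; apply/bigmax_leP; split => //.
by move=> [i j] _ /=; rewrite (ord1 i).
Qed.

Lemma row_coord_le x i : `|x ord0 i| <= `|x|.
Proof.
rewrite [leRHS]/Num.Def.normr /= mx_normrE.
by apply: (le_bigmax _ (fun ij => `|x ij.1 ij.2|) (ord0, i)).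
Qed.

End matrix_norm.

Lemma lipschitz_continuous (R : realType) (V W : normedModType R) (g : V -> W)
    (L : R) :
  (forall x y, `|g x - g y| <= L * `|x - y|) -> continuous g.
Proof.
move=> gL x; apply/cvgrPdist_lt => e e0; near=> y.
apply: le_lt_trans (gL x y) _.
apply: (@le_lt_trans _ _ ((`|L| + 1) * `|x - y|)).
  by rewrite ler_wpM2r// (le_trans (ler_norm _))// lerDl.
rewrite -ltr_pdivlMl ?ltr_pwDr// mulrC.
near: y; apply: (@cvgr_dist_lt _ _ _ (nbhs x) _ id x) => //.
by rewrite divr_gt0// ltr_pwDr.
Unshelve. all: by end_near. Qed.

(** Composition with this map freezes a control or a trajectory at its value at time 0 for negative
    times, which makes measurability and continuity global. *)
Definition pos {R : realType} (t : R) : R := Num.max 0 t.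

Section pos.
Context {R : realType}.
Implicit Types t : R.

Lemma pos_id t : 0 <= t -> pos t = t.
Proof. by move=> t0; rewrite /pos max_r. Qed.

Lemma pos_ge0 t : 0 <= pos t.
Proof. by rewrite /pos le_max lexx. Qed.

Lemma pos_lip t t' : `|pos t - pos t'| <= 1 * `|t - t'|.
Proof.
rewrite mul1r /pos; have [t0|t0] := leP 0 t; have [t0'|t0'] := leP 0 t' => //.
- by rewrite subr0 !ger0_norm//; lra.
- by rewrite sub0r normrN distrC !ger0_norm//; lra.
- by rewrite subrr normr0.
Qed.

Lemma continuous_pos : continuous (@pos R).
Proof. by apply: (@lipschitz_continuous R R^o R^o (@pos R) 1); exact: pos_lip. Qed.

Lemma measurable_pos : measurable_fun setT (@pos R).
Proof. exact: continuous_measurable_fun continuous_pos. Qed.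

End pos.

Lemma continuous_comp_pos (R : realType) (S : topologicalType) (y : R -> S) :
  {within `[0, +oo[, continuous y} -> continuous (y \o pos).
Proof.
move=> cy t.
have pt : `[0, +oo[%classic (pos t) by rewrite /= in_itv /= pos_ge0.
suff H : (pos x : subspace `[0, +oo[) @[x --> t] --> (pos t : subspace `[0, +oo[).
  rewrite /continuous_at /=; exact: (cvg_comp (pos : R -> subspace `[0, +oo[) (y : subspace `[0, +oo[ -> S) H (cy (pos t))).
have FF : Filter (pos x @[x --> t]) by exact: fmap_filter.
apply: (proj2 (@subspace_cvgP R `[0, +oo[%classic (pos @ t) (pos t) _ pt)) => A /= wA.
have {}wA : nbhs (pos t) (fun x => `[0, +oo[%classic x -> A x) := wA.
have cA : nbhs t (fun x => `[0, +oo[%classic (pos x) -> A (pos x)).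
  exact: (@continuous_pos R t _ wA).
change (nbhs t (fun x => A (pos x))).
apply: filterS cA => x; apply.
by rewrite /= in_itv /= pos_ge0.
Qed.

(** * Trajectories, their concatenation, and the value function *)

Section trajectories.
Context {R : realType} {m : nat} {U : pmetricType R}.
Local Notation state := 'rV[R]_m.
Local Notation mu := (@lebesgue_measure R).
Variables (f : state * U -> state) (K : set state).

(** The admissible pairs of [adm_inf], normalised to the whole line so that no subspace topology or
    restricted measurability has to be carried along. *)
Definition traj (x : state) (u : R -> U) (y : R -> state) :=
  [/\ measurable_fun setT (u : R -> borel U), continuous y,
      forall t, K (y t) &
      forall t, 0 <= t -> forall i,
        y t ord0 i = x ord0 i + \int[mu]_(s in `[0, t]) f (y s, u s) ord0 i].

Lemma traj_of_adm x p : adm_inf f K x p -> traj x (p.1 \o pos) (p.2 \o pos).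
Proof.
move=> [mu_ [cy yE] yK]; split.
- apply: (@measurable_comp _ _ _ R R (borel U) `[0, +oo[%classic (p.1 : R -> borel U) setT (@pos R)) => //.
  + by move=> _ [t _ <-]; rewrite /= in_itv /= pos_ge0.
  + exact: measurable_pos.
- exact: continuous_comp_pos.
- by move=> t; apply: yK; rewrite /= in_itv /= pos_ge0.
- move=> t t0 i; rewrite /= pos_id// yE//; congr (_ + _).
  apply: eq_Rintegral => s; rewrite inE /= in_itv /= => /andP[s0 _].
  by rewrite pos_id.
Qed.

Lemma adm_of_traj x u y : traj x u y -> adm_inf f K x (u, y).
Proof.
move=> [mu_ cy yK yE]; split => //=; first exact: measurable_funS mu_.
by split => //; apply: continuous_subspaceT.
Qed.

Lemma measurable_along (F : state * U -> R) (u : R -> U) (y : R -> state) :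
  continuous F -> measurable_fun setT (u : R -> borel U) -> continuous y ->
  measurable_fun setT (fun t => F (y t, u t)).
Proof.
move=> cF mu_ cy.
apply: (@measurableT_comp _ _ _ _ (borel (state * U)%type) _ (F : borel (state * U)%type -> R) _ (fun t => (y t, u t))).
  exact: (@continuous_borel_measurable (state * U)%type R F cF).
exact: (@measurable_pair_borel R state U y u cy mu_).
Qed.

Hypothesis f_cont : continuous f.
Variable B : R.
Hypothesis f_bound : forall z, K z.1 -> `|f z| <= B.

Lemma continuous_coord i : continuous (fun z => f z ord0 i).
Proof.
move=> z; apply: (@continuous_comp _ _ _ f (fun x : state => x ord0 i) z (@f_cont z)).
exact: coord_continuous.
Qed.

Section along.
Variables (u : R -> U) (y : R -> state).
Hypotheses (mu_ : measurable_fun setT (u : R -> borel U)) (cy : continuous y)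
  (yK : forall t, K (y t)).

Lemma measurable_field i : measurable_fun setT (fun t => f (y t, u t) ord0 i).
Proof. exact: (measurable_along (@continuous_coord i)). Qed.

Lemma field_le i t : `|f (y t, u t) ord0 i| <= B.
Proof. by apply: (le_trans (row_coord_le _ _)); apply: f_bound; exact: yK. Qed.

Lemma integrable_field i a b :
  mu.-integrable `[a, b] (EFin \o (fun t => f (y t, u t) ord0 i)).
Proof.
apply: (bounded_integrable (M := B)) => //.
- by rewrite /= lebesgue_measure_itv /=; case: ifP => _; rewrite ?ltry// -EFinB ltry.
- by apply: measurable_funTS; exact: measurable_field.
- by move=> t _; exact: field_le.
Qed.

End along.

Lemma traj_increment x u y a b i : traj x u y -> 0 <= a -> a <= b ->
  y b ord0 i = y a ord0 i + \int[mu]_(s in `[a, b]) f (y s, u s) ord0 i.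
Proof.
move=> [mu_ cy yK yE] a0 ab; rewrite (yE b (le_trans a0 ab)) (yE a a0) -addrA; congr (_ + _).
by apply: Rintegral_split => //; exact: integrable_field.
Qed.

Lemma shift_itv (a b s : R) : [set t : R | `[a, b]%classic (t + s)] = `[a - s, b - s]%classic.
Proof.
by apply/seteqP; split => t /=; rewrite !in_itv /= => /andP[? ?]; apply/andP; split; lra.
Qed.

Lemma traj_shift x u y s : traj x u y -> 0 <= s ->
  traj (y s) (fun t => u (t + s)) (fun t => y (t + s)).
Proof.
move=> T s0; have [mu_ cy yK yE] := T.
have ms : measurable_fun setT (fun t : R => t + s) by exact: measurable_funD.
split.
- exact: (measurableT_comp (f := (u : R -> borel U)) mu_ ms).
- move=> t; apply: (@continuous_comp _ _ _ (fun t => t + s) y); last exact: cy.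
  by apply: cvgD; [exact: cvg_id|exact: cvg_cst].
- by move=> t; exact: yK.
- move=> t t0 i; rewrite (traj_increment i T s0) ?lerDr//; congr (_ + _).
  rewrite -(Rintegral_shift s (D := `[s, t + s])).
  + by rewrite shift_itv subrr addrK.
  + by [].
  + exact: measurable_field.
  + exact: integrable_field.
Qed.

(** The initial arc of a concatenation: after time [s] it is bound neither by the constraint nor by
    the equation. Such arcs come from Picard paths of constant controls and from pairs admissible up
    to a finite horizon. *)
Definition traj_upto (s : R) (x : state) (u : R -> U) (y : R -> state) :=
  [/\ measurable_fun setT (u : R -> borel U), continuous y,
      forall t, 0 <= t <= s -> K (y t) &
      forall t, 0 <= t <= s -> forall i,
        y t ord0 i = x ord0 i + \int[mu]_(r in `[0, t]) f (y r, u r) ord0 i].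

Lemma traj_concat x s u1 y1 u2 y2 : 0 <= s ->
  traj_upto s x u1 y1 -> traj (y1 s) u2 y2 ->
  exists u y, [/\ traj x u y, forall t, 0 <= t -> u (t + s) = u2 t,
    forall t, 0 <= t -> y (t + s) = y2 t, forall t, 0 <= t <= s -> y t = y1 t &
    forall t, t < s -> u t = u1 t].
Proof.
move=> s0 [mu1 cy1 y1K y1E] T2; have [mu2 cy2 y2K y2E] := T2.
have y20 : y2 0 = y1 s.
  by apply/rowP => i; rewrite y2E// set_itv1 Rintegral_set1 addr0.
pose u t := if t < s then u1 t else u2 (t - s).
(* One formula for both pieces: the bracket vanishes up to time [s] because [y2 0 = y1 s].
   Continuity then follows from composition and sums, without gluing. *)
pose y t := y1 (Num.min (pos t) s) + (y2 (pos (t - s)) - y1 s).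
have ylt t : t <= s -> y t = y1 (pos t).
  move=> ts; rewrite /y min_l; last by rewrite /pos ge_max s0 ts.
  rewrite (_ : pos (t - s) = 0) ?y20 ?subrr ?addr0//.
  by rewrite /pos max_l// subr_le0.
have ygt t : s <= t -> y t = y2 (t - s).
  move=> st; rewrite /y min_r; last by rewrite /pos le_max st orbT.
  by rewrite pos_id ?subr_ge0// addrC subrK.
have yK t : K (y t).
  have [ts|/ltW st] := leP t s; last by rewrite ygt.
  by rewrite ylt//; apply: y1K; rewrite pos_ge0 /pos ge_max s0 ts.
have msub : measurable_fun setT (fun t : R => t - s) by exact: measurable_funB.
have mu_ : measurable_fun setT (u : R -> borel U).
  apply: measurable_fun_ifT => //; first exact: measurable_fun_ltr.
  exact: (measurableT_comp (f := (u2 : R -> borel U))).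
have cy : continuous y.
  have cmin : continuous (fun t : R => Num.min (pos t) s).
    move=> t; apply: (@continuous_comp _ _ _ pos (fun r => Num.min r s)).
      exact: continuous_pos.
    apply: (@lipschitz_continuous R R^o R^o (fun r : R => Num.min r s) 1) => a b.
    rewrite mul1r /Num.min; case: ltP => [as_|as_]; case: ltP => [bs|bs] //.
    - by rewrite distrC [leRHS]distrC !ger0_norm; lra.
    - by rewrite !ger0_norm; lra.
    - by rewrite subrr normr0.
  have csub : continuous (fun t : R => pos (t - s)).
    move=> t; apply: (@continuous_comp _ _ _ (fun t => t - s) pos); last exact: continuous_pos.
    by apply: cvgB; [exact: cvg_id|exact: cvg_cst].
  move=> t; apply: cvgD; first exact: (@continuous_comp _ _ _ (fun t : R => Num.min (pos t) s) y1 t (@cmin t) (@cy1 _)).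
  apply: cvgB; last exact: cvg_cst.
  exact: (@continuous_comp _ _ _ (fun t : R => pos (t - s)) y2 t (@csub t) (@cy2 _)).
(* At time [s] the control has already switched to [u2], so the integrals are compared on half-open
   intervals. *)
have eqs t : t <= s -> forall i,
    \int[mu]_(r in `[0, t]) f (y r, u r) ord0 i = \int[mu]_(r in `[0, t]) f (y1 r, u1 r) ord0 i.
  move=> ts i.
  have H : {in `[0, t[%classic, (fun r => f (y r, u r) ord0 i) =1 (fun r => f (y1 r, u1 r) ord0 i)}.
    move=> r; rewrite inE /= in_itv /= => /andP[r0 rt].
    have rs := lt_le_trans rt ts.
    by rewrite /u rs ylt ?ltW// pos_id.
  rewrite -Rintegral_itv_bndo_bndc; last first.
    by apply: integrableS (integrable_field mu_ cy yK i 0 t) => //; apply: subset_itvl; rewrite bnd_simp.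
  rewrite -Rintegral_itv_bndo_bndc; first exact: eq_Rintegral.
  apply: eq_integrable (integrableS _ _ _ (integrable_field mu_ cy yK i 0 t)) => //.
  - by move=> r rt; rewrite /= H.
  - by apply: subset_itvl; rewrite bnd_simp.
exists u, y; split.
- split => // t t0 i; have [ts|/ltW st] := leP t s.
    by rewrite ylt// pos_id// y1E ?t0// eqs.
  rewrite ygt// y2E ?subr_ge0// y1E ?s0 ?lexx// -addrA; congr (_ + _).
  rewrite (Rintegral_split s0 st); last exact: integrable_field.
  rewrite eqs//; congr (_ + _).
  rewrite -(Rintegral_shift (- s) (D := `[0, t - s])).
  + rewrite shift_itv opprK add0r subrK; apply: eq_Rintegral => r.
    rewrite inE /= in_itv /= => /andP[sr _].
    by rewrite ygt// /u ltNge sr.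
  + by [].
  + exact: measurable_field.
  + exact: integrable_field.
- by move=> t t0; rewrite /u ltNge lerDr t0 /= addrK.
- by move=> t t0; rewrite ygt ?lerDr// addrK.
- by move=> t /andP[t0 ts]; rewrite ylt// pos_id.
- by move=> t ts; rewrite /u ts.
Qed.

Section value.
Variables (k : state * U -> R) (M : R).
Hypotheses (k_cont : continuous k) (k_bound : forall z, K z.1 -> `|k z| <= M).
Variable nu : probability (measurableTypeR R) R.

Definition value (x : state) : \bar R :=
  ereal_inf [set (\int[nu]_t k (p.2 t, p.1 t))%:E | p in [set p | traj x p.1 p.2]].

Lemma measurable_cost x u y : traj x u y -> measurable_fun setT (fun t => k (y t, u t)).
Proof. by move=> [mu_ cy _ _]; exact: (measurable_along k_cont). Qed.

Lemma cost_bound x u y : traj x u y -> forall t, `|k (y t, u t)| <= M.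
Proof. by move=> [_ _ yK _] t; apply: k_bound; exact: yK. Qed.

Lemma value_le x u y : traj x u y -> (value x <= (\int[nu]_t k (y t, u t))%:E)%E.
Proof. by move=> T; apply: ereal_inf_lbound; exists (u, y). Qed.

Lemma value_ge x : (- M%:E <= value x)%E.
Proof.
apply: le_ereal_inf_tmp => _ [p /= T <-]; rewrite lee_fin.
have := prob_Rintegral_abs_le nu (measurable_cost T) (cost_bound T).
by rewrite ler_norml => /andP[].
Qed.

Lemma value_le_bound x u y : traj x u y -> (value x <= M%:E)%E.
Proof.
move=> T; apply: (le_trans (value_le T)); rewrite lee_fin.
have := prob_Rintegral_abs_le nu (measurable_cost T) (cost_bound T).
by rewrite ler_norml => /andP[].
Qed.

(** One half of dynamic programming. The given arc followed by any trajectory from [y s] is a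
    competitor from [x]; its cost read [s] later is the cost of the tail, and slowness prices this
    shift of time. *)
Lemma value_flow (kappa : R) x s u y : slow kappa nu -> 0 <= s ->
  traj_upto s x u y ->
  (value x <= value (y s) + (2 * M * kappa * s)%:E)%E.
Proof.
move=> [nu0 slow_nu] s0 T1; rewrite -leeBlDr//.
apply: le_ereal_inf_tmp => _ [[u2 y2] /= T2 <-].
have [u' [y' [T uE yE _ _]]] := traj_concat s0 T1 T2.
apply: (le_trans (leeD2r _ (value_le T))); rewrite -EFinD lee_fin lerBlDr.
have := slow_nu _ _ _ (measurable_cost T) (cost_bound T) s0.
rewrite (@eq_Rintegral_nonneg_support _ _ nu0 _ (fun t => k (y2 t, u2 t)) M).
- by rewrite ler_norml => /andP[H _]; rewrite -lerBlDl -lerN2 opprB.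
- apply: (measurableT_comp (measurable_cost T)) => //; exact: measurable_funD.
- by move=> t; exact: (cost_bound T).
- exact: measurable_cost T2.
- exact: cost_bound T2.
- by move=> t t0; rewrite uE// yE.
Qed.

End value.

End trajectories.

(** * Local trajectories for a constant control, by Picard iteration *)

Lemma geometric_limit (R : realType) (a : nat -> R) (D : R) :
  (forall n, `|a n.+1 - a n| <= D / 2 ^+ n) ->
  exists l, forall n, `|a n - l| <= 2 * D / 2 ^+ n.
Proof.
move=> aD.
have e2 n : 2 * D / 2 ^+ n.+1 = D / 2 ^+ n.
  by rewrite exprS invfM mulrACA divff// mul1r.
(* The correction is the sum of all later increments, which makes [lo] nondecreasing and [hi]
   nonincreasing. The limit is the supremum of [lo], and the rate comes with it. *)
pose lo n := a n - 2 * D / 2 ^+ n; pose hi n := a n + 2 * D / 2 ^+ n.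
have ndlo m n : (m <= n)%N -> lo m <= lo n.
  elim: n => [|n IH]; first by rewrite leqn0 => /eqP ->.
  rewrite leq_eqVlt ltnS => /orP[/eqP -> //|/IH H]; apply: (le_trans H).
  by have := aD n; rewrite /lo e2 ler_norml => /andP[H1 H2]; lra.
have nihi m n : (m <= n)%N -> hi n <= hi m.
  elim: n => [|n IH]; first by rewrite leqn0 => /eqP ->.
  rewrite leq_eqVlt ltnS => /orP[/eqP -> //|/IH H]; apply: le_trans H.
  by have := aD n; rewrite /hi e2 ler_norml => /andP[H1 H2]; lra.
have D0 : 0 <= D by have := aD 0%N; rewrite expr0 divr1; exact: le_trans.
have lohi m n : lo m <= hi n.
  have p0 : 0 <= 2 * D / 2 ^+ (maxn m n) by rewrite divr_ge0// ?mulr_ge0// exprn_ge0.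
  apply: (le_trans (ndlo _ _ (leq_maxl m n))); apply: le_trans (nihi _ _ (leq_maxr m n)).
  by rewrite /lo /hi; lra.
exists (sup (range lo)) => n.
have lo_le : lo n <= sup (range lo).
  apply: ub_le_sup; last by exists n.
  by exists (hi 0%N) => _ [m _ <-]; exact: lohi.
have le_hi : sup (range lo) <= hi n.
  by apply: ge_sup; [exists (lo 0%N), 0%N|move=> _ [m _ <-]; exact: lohi].
by rewrite ler_norml; move: lo_le le_hi; rewrite /lo /hi => ? ?; apply/andP; split; lra.
Qed.

Lemma le_geometric (R : realType) (a b C : R) :
  (forall n, a <= b + C / 2 ^+ n) -> a <= b.
Proof.
move=> H; apply/ler_addgt0Pr => e e0.
pose n := (Num.truncn (`|C| / e)).+1.
apply: (le_trans (H n)); rewrite lerD2l ler_pdivrMr ?exprn_gt0//.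
have /ltW : `|C| / e < n%:R by exact: truncnS_gt.
rewrite ler_pdivrMr// => Cn; apply: (le_trans (ler_norm C)); apply: (le_trans Cn).
rewrite mulrC; apply: ler_wpM2l; first exact: ltW.
by rewrite -natrX ler_nat ltnW// ltn_expl.
Qed.

Lemma Rintegral_itv_bound (R : realType) (g : R -> R) (a b C : R) : a <= b ->
  lebesgue_measure.-integrable `[a, b] (EFin \o g) ->
  (forall t, a <= t <= b -> `|g t| <= C) ->
  `|\int[lebesgue_measure]_(s in `[a, b]) g s| <= C * (b - a).
Proof.
move=> ab ig gC.
have -> : C * (b - a) = \int[lebesgue_measure]_(s in `[a, b]) C.
  rewrite Rintegral_cst//= lebesgue_measure_itv /= lte_fin.
  by case: ltgtP ab => //= -> _; rewrite subrr mulr0.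
apply: Rintegral_le_abs => //.
apply: (bounded_integrable (M := `|C|)) => //.
by rewrite /= lebesgue_measure_itv /=; case: ifP => _; rewrite ?ltry// -EFinB ltry.
Qed.

Lemma continuous_itv_integrable (R : realType) (g : R -> R) (a b : R) :
  continuous g -> lebesgue_measure.-integrable `[a, b] (EFin \o g).
Proof.
move=> cg; apply: continuous_compact_integrable; first exact: segment_compact.
exact: continuous_subspaceT.
Qed.

Section picard.
Context (R : realType) (m : nat).
Local Notation state := 'rV[R]_m.
Local Notation mu := (@lebesgue_measure R).
Variables (F : state -> state) (L : R) (x : state) (s : R).
Hypotheses (F_lip : forall x x', `|F x - F x'| <= L * `|x - x'|).
Hypotheses (L0 : 0 <= L) (s0 : 0 <= s) (sL : s * L <= 2^-1).

Let A : R := `|F x|.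
Let A0 : 0 <= 2 * A. Proof. by rewrite /A mulr_ge0. Qed.
Let clamp (t : R) : R := Num.min (pos t) s.

Let clamp_itv t : 0 <= clamp t <= s.
Proof. by rewrite /clamp le_min pos_ge0 s0 ge_min lexx orbT. Qed.

Let clamp_lip t t' : `|clamp t - clamp t'| <= `|t - t'|.
Proof.
apply: le_trans (le_trans (pos_lip t t') _); last by rewrite mul1r.
rewrite /clamp /Num.min; case: ltP => [as_|as_]; case: ltP => [bs|bs] //.
- by rewrite distrC [leRHS]distrC !ger0_norm; lra.
- by rewrite !ger0_norm; lra.
- by rewrite subrr normr0.
Qed.

Let step (y : R -> state) (t : R) : state :=
  \row_i (x ord0 i + \int[mu]_(r in `[0, clamp t]) F (y r) ord0 i).

Let good (y : R -> state) :=
  continuous y /\ forall t, `|y t - x| <= 2 * A * clamp t.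

Let cF : continuous F.
Proof. exact: lipschitz_continuous F_lip. Qed.

Let cFi y i : continuous y -> continuous (fun t : R => F (y t) ord0 i).
Proof.
move=> cy t; apply: (@continuous_comp _ _ _ (fun t => F (y t)) (fun v : state => v ord0 i)).
  exact: (@continuous_comp _ _ _ y F t (@cy t) (@cF _)).
exact: coord_continuous.
Qed.

(** As [s * L <= 1/2], a path within [2 * A * s] of [x] changes [F] by at most [A]. So the speed
    bound [2 * A] reproduces itself under [step]. *)
Let F_bound y : good y -> forall t, `|F (y t)| <= 2 * A.
Proof.
move=> [_ yx] t; rewrite -[F (y t)](subrK (F x)) (le_trans (ler_normD _ _))//.
rewrite mulr_natl mulr2n lerD2r (le_trans (F_lip _ _))//.
have A1 : 0 <= A by exact: normr_ge0.
have /andP[c0 cs] := clamp_itv t.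
apply: (@le_trans _ _ (L * (2 * A * s))); last first.
  rewrite (_ : L * _ = (2 * (s * L)) * A); last by ring.
  by rewrite ler_piMl// -ler_pdivlMl// mulr1.
by rewrite ler_wpM2l// (le_trans (yx t))// ler_wpM2l.
Qed.

Let step_lip y : good y -> forall t t', `|step y t - step y t'| <= 2 * A * `|t - t'|.
Proof.
move=> gy t t'; have [cy _] := gy.
wlog tt' : t t' / clamp t' <= clamp t.
  move=> H; have [ct|/ltW ct] := leP (clamp t') (clamp t); first exact: H.
  by rewrite distrC [leRHS](_ : _ = 2 * A * `|t' - t|); [exact: H|rewrite distrC].
apply: row_norm_le; first exact: mulr_ge0.
move=> i; rewrite !mxE opprD addrACA subrr add0r.
have /andP[c0 cs] := clamp_itv t'.
rewrite (Rintegral_split c0 tt'); last exact: continuous_itv_integrable _ _ (@cFi _ i cy).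
rewrite addrAC subrr add0r.
apply: le_trans (_ : 2 * A * (clamp t - clamp t') <= _).
  apply: Rintegral_itv_bound => //; first exact: continuous_itv_integrable _ _ (@cFi _ i cy).
  by move=> r _; apply: (le_trans (row_coord_le _ _)); exact: F_bound.
by rewrite ler_wpM2l// (le_trans (ler_norm _)).
Qed.

Let step_good y : good y -> good (step y).
Proof.
move=> gy; split; first by apply: (@lipschitz_continuous R R^o state _ (2 * A)); exact: step_lip.
move=> t; have [cy _] := gy; have /andP[c0 cs] := clamp_itv t.
apply: row_norm_le; first exact: mulr_ge0.
move=> i; rewrite !mxE addrAC subrr add0r -[X in _ * X]subr0.
apply: Rintegral_itv_bound => //; first exact: continuous_itv_integrable _ _ (@cFi _ i cy).
by move=> r _; apply: (le_trans (row_coord_le _ _)); exact: F_bound.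
Qed.

Let step_contract y z (D : R) : good y -> good z ->
  (forall t, `|y t - z t| <= D) -> forall t, `|step y t - step z t| <= D / 2.
Proof.
move=> [cy _] [cz _] yz t; have /andP[c0 cs] := clamp_itv t.
have D0 : 0 <= D by exact: le_trans (yz 0).
apply: row_norm_le; first by rewrite divr_ge0.
move=> i; rewrite !mxE opprD addrACA subrr add0r.
have iy := continuous_itv_integrable 0 (clamp t) (@cFi _ i cy).
have iz := continuous_itv_integrable 0 (clamp t) (@cFi _ i cz).
rewrite -RintegralB//; apply: le_trans (_ : L * D * (clamp t - 0) <= _).
  apply: Rintegral_itv_bound => //; first exact: integrable_subr.
  move=> r _; have := row_coord_le (F (y r) - F (z r)) i; rewrite !mxE => /le_trans; apply.
  by rewrite (le_trans (F_lip _ _))// ler_wpM2l.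
rewrite subr0 -mulrA mulrC -mulrA ler_wpM2l//.
by rewrite (le_trans _ sL)// ler_wpM2r.
Qed.

(** The iterates contract by [1/2] uniformly in time because [clamp] confines time to [[0, s]]. The
    last clause is what later keeps the path inside the constraint set. *)
Lemma picard_local : exists y : R -> state, [/\ continuous y,
  (forall t, 0 <= t <= s -> forall i,
     y t ord0 i = x ord0 i + \int[mu]_(r in `[0, t]) F (y r) ord0 i) &
  (forall t, 0 <= t <= s -> `|y t - x| <= 2 * `|F x| * t)].
Proof.
pose y_ n := iter n step (fun=> x).
have gy n : good (y_ n).
  elim: n => [|n IH]; last exact: step_good.
  split; first by move=> t; exact: cvg_cst.
  by move=> t; rewrite subrr normr0 mulr_ge0// ?mulr_ge0//; have /andP[] := clamp_itv t.
have yD n t : `|y_ n.+1 t - y_ n t| <= (2 * A * s) / 2 ^+ n.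
  elim: n t => [|n IH] t.
    rewrite expr0 divr1; have [_ /(_ t) H] := gy 1%N; apply: (le_trans H).
    by apply: ler_wpM2l => //; have /andP[] := clamp_itv t.
  rewrite exprSr invfM mulrA.
  exact: (@step_contract (y_ n.+1) (y_ n) _ (gy _) (gy _) IH).
set D := 2 * A * s in yD.
have /choice[y yl] : forall t : R, exists v : state, forall n, `|y_ n t - v| <= 2 * D / 2 ^+ n.
  move=> t.
  have /choice[v vl] : forall i, exists l, forall n, `|y_ n t ord0 i - l| <= 2 * D / 2 ^+ n.
    move=> i; apply: geometric_limit => n.
    by have := row_coord_le (y_ n.+1 t - y_ n t) i; rewrite !mxE => /le_trans; apply.
  exists (\row_i v i) => n; apply: row_norm_le; last by move=> i; rewrite !mxE.
  by rewrite divr_ge0// ?exprn_ge0// mulr_ge0// mulr_ge0.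
have D0 : 0 <= D by exact: mulr_ge0.
have e2 n : 2 * D / 2 ^+ n.+1 = D / 2 ^+ n.
  by rewrite exprS invfM mulrACA divff// mul1r.
have e3 n : 2 * D / 2 ^+ n = D / 2 ^+ n + D / 2 ^+ n by rewrite mulr_natl mulr2n mulrDl.
have y_good : good y.
  split.
    apply: (@lipschitz_continuous R R^o state _ (2 * A)) => t t'.
    apply: (@le_geometric _ _ _ (2 * D)) => n; rewrite e3.
    rewrite (_ : y t - y t' = (y_ n.+1 t - y_ n.+1 t') + ((y t - y_ n.+1 t) + (y_ n.+1 t' - y t'))); last first.
      by apply/rowP => j; rewrite !mxE; ring.
    rewrite (le_trans (ler_normD _ _))// lerD//; first exact: step_lip.
    by rewrite (le_trans (ler_normD _ _))// lerD// -?e2// distrC.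
  move=> t; apply: (@le_geometric _ _ _ (2 * D)) => n.
  rewrite (_ : y t - x = (y_ n t - x) + (y t - y_ n t)); last by apply/rowP => j; rewrite !mxE; ring.
  rewrite (le_trans (ler_normD _ _))// lerD//.
    by have [_] := gy n.
  by rewrite distrC.
have clampE t : 0 <= t <= s -> clamp t = t.
  by move=> /andP[t0 ts]; rewrite /clamp pos_id// min_l.
exists y; split.
- by have [] := y_good.
- move=> t ts i.
  (* The limit is a fixed point: [y] and [step y] are both compared with [y_ n.+1], which is
     [step (y_ n)]. *)
  suff : `|y t ord0 i - step y t ord0 i| <= 0.
    by rewrite normr_le0 subr_eq0 => /eqP ->; rewrite mxE clampE.
  apply: (@le_geometric _ _ _ (2 * D)) => n; rewrite add0r e3.
  rewrite (_ : _ - _ = (y t ord0 i - y_ n.+1 t ord0 i) + (y_ n.+1 t ord0 i - step y t ord0 i)); last by rewrite addrA subrK.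
  rewrite (le_trans (ler_normD _ _))//.
  rewrite lerD//.
    rewrite -e2 distrC; have := row_coord_le (y_ n.+1 t - y t) i; rewrite !mxE => /le_trans; apply.
    exact: yl.
  have := row_coord_le (step (y_ n) t - step y t) i; rewrite !mxE => /le_trans; apply.
  rewrite (_ : D / 2 ^+ n = (2 * D / 2 ^+ n) / 2); last by field; rewrite expf_neq0.
  exact: (@step_contract _ _ (2 * D / 2 ^+ n) (gy n) y_good).
- by move=> t ts; have [_ /(_ t)] := y_good; rewrite clampE.
Qed.

End picard.

(** * Smoothing Lipschitz functions by averages over boxes *)

Section averaging.
Context (R : realType) (m : nat) (eps : R).
Local Notation state := 'rV[R]_m.
Local Notation mu := (@lebesgue_measure R).
Hypothesis eps0 : 0 < eps.

Definition is_lip (L : R) (v : state -> R) := forall x y, `|v x - v y| <= L * `|x - y|.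

Let e (j : 'I_m) : state := delta_mx 0 j.

Lemma norm_delta j : `|e j| <= 1.
Proof.
apply: row_norm_le => // i; rewrite /e mxE eqxx /=.
by case: eqP; rewrite /= ?normr1 ?normr0.
Qed.

Lemma norm_step j (h : R) : `|h *: e j| <= `|h|.
Proof. by rewrite normrZ ler_piMr// norm_delta. Qed.

(** The one-sided Steklov average. Done once in every coordinate, it turns a Lipschitz function into
    a C^1 one with Lipschitz partial derivatives. *)
Definition avg (j : 'I_m) (v : state -> R) (x : state) : R :=
  eps^-1 * \int[mu]_(s in `[0, eps]) v (x + s *: e j).

Lemma is_lip_ge0 (v : state -> R) L : is_lip L v -> is_lip `|L| v.
Proof. by move=> vL x y; rewrite (le_trans (vL x y))// ler_wpM2r// ler_norm. Qed.

Lemma line_lip v L j x : is_lip L v -> forall s t : R,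
  `|v (x + s *: e j) - v (x + t *: e j)| <= `|L| * `|s - t|.
Proof.
move=> vL s t; rewrite (le_trans (is_lip_ge0 vL _ _))// ler_wpM2l//.
rewrite (_ : _ - _ = (s - t) *: e j) ?norm_step//.
by rewrite opprD addrACA subrr add0r scalerBl.
Qed.

Lemma line_continuous v L j x : is_lip L v -> continuous (fun s : R => v (x + s *: e j)).
Proof.
by move=> vL; apply: (@lipschitz_continuous R R^o R^o _ `|L|); exact: line_lip.
Qed.

Let Rintegral_cst_itv (a b c : R) : a <= b -> \int[mu]_(s in `[a, b]) c = c * (b - a).
Proof.
move=> ab; rewrite Rintegral_cst//= lebesgue_measure_itv /= lte_fin.
by case: ltgtP ab => //= -> _; rewrite subrr mulr0.
Qed.

Let cst_integrable (a b c : R) : mu.-integrable `[a, b] (EFin \o (fun=> c)).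
Proof. by apply: continuous_itv_integrable => t; exact: cvg_cst. Qed.

(** Averaging is linear and monotone and commutes with the translation by [d], so it preserves
    affine inequalities between values. *)
Lemma avg_comb v1 v2 v3 L1 L2 L3 j x d a b h c :
  is_lip L1 v1 -> is_lip L2 v2 -> is_lip L3 v3 ->
  (forall s, 0 <= s <= eps -> c <= a * v1 (x + s *: e j + d) + b * v2 (x + s *: e j) + h * v3 (x + s *: e j)) ->
  c <= a * avg j v1 (x + d) + b * avg j v2 x + h * avg j v3 x.
Proof.
move=> lip1 lip2 lip3 H.
have i1 := continuous_itv_integrable 0 eps (@line_continuous _ _ j (x + d) lip1).
have i2 := continuous_itv_integrable 0 eps (@line_continuous _ _ j x lip2).
have i3 := continuous_itv_integrable 0 eps (@line_continuous _ _ j x lip3).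
have E : a * avg j v1 (x + d) + b * avg j v2 x + h * avg j v3 x =
   eps^-1 * \int[mu]_(s in `[0, eps]) (a * v1 (x + d + s *: e j) + b * v2 (x + s *: e j) + h * v3 (x + s *: e j)).
  rewrite RintegralD//; first last.
  - exact: integrable_mull.
  - by apply: integrable_addr; rewrite //; exact: integrable_mull.
  rewrite RintegralD//; first last.
  - exact: integrable_mull.
  - exact: integrable_mull.
  rewrite !RintegralZl// /avg; ring.
rewrite E -ler_pdivrMl ?invr_gt0// invrK.
have <- : \int[mu]_(s in `[0, eps]) c = eps * c by rewrite Rintegral_cst_itv ?ltW// subr0 mulrC.
apply: le_Rintegral => //.
  apply: integrable_addr; rewrite //; last exact: integrable_mull.
  by apply: integrable_addr; rewrite //; exact: integrable_mull.
by move=> s /=; rewrite in_itv => /H; rewrite [x + d + _]addrAC.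
Qed.

Definition avgs (l : seq 'I_m) (v : state -> R) := foldr avg v l.

Lemma lip_cst (c : R) : is_lip 0 (fun=> c).
Proof. by move=> x y; rewrite subrr normr0 mul0r. Qed.

(** Puts the Lipschitz property into the shape of the inequalities that averaging preserves. A
    one-sided bound for all displacements is enough, as the two points can be exchanged. *)
Lemma is_lipP L v :
  (forall x d, - (L * `|d|) <= 1 * v (x + d) + -1 * v x + 0 * v x) <-> is_lip L v.
Proof.
split=> [H x y|H x d].
  have := H y (x - y); have := H x (y - x).
  rewrite !mul1r !mulN1r !mul0r !addr0 ![_ + (_ - _)]addrC !subrK [`|y - x|]distrC.
  by move=> H1 H2; rewrite ler_norml; apply/andP; split; lra.
rewrite mul1r mulN1r mul0r addr0.
have := H (x + d) x; rewrite addrAC subrr add0r.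
by rewrite ler_norml => /andP[].
Qed.

(* The quantification over three functions lets one statement cover bounds on
   averages, on their increments and on first-order remainders. *)
Lemma avgs_comb_lip l :
  (forall v1 v2 v3 L1 L2 L3 x d a b h c,
  is_lip L1 v1 -> is_lip L2 v2 -> is_lip L3 v3 ->
  (forall z, `|z - x| <= (size l)%:R * eps -> c <= a * v1 (z + d) + b * v2 z + h * v3 z) ->
  c <= a * avgs l v1 (x + d) + b * avgs l v2 x + h * avgs l v3 x) /\
  (forall L v, is_lip L v -> is_lip L (avgs l v)).
Proof.
elim: l => [|j l [IHc IHl]].
  by split => // v1 v2 v3 L1 L2 L3 x d a b h c _ _ _; apply; rewrite subrr normr0 mul0r.
have comb v1 v2 v3 L1 L2 L3 x d a b h c :
  is_lip L1 v1 -> is_lip L2 v2 -> is_lip L3 v3 ->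
  (forall z, `|z - x| <= (size (j :: l))%:R * eps -> c <= a * v1 (z + d) + b * v2 z + h * v3 z) ->
  c <= a * avgs (j :: l) v1 (x + d) + b * avgs (j :: l) v2 x + h * avgs (j :: l) v3 x.
  move=> l1 l2 l3 H /=.
  apply: (avg_comb (IHl _ _ l1) (IHl _ _ l2) (IHl _ _ l3)) => s /andP[s0 se].
  apply: (IHc _ _ _ _ _ _ _ _ _ _ _ _ l1 l2 l3) => z zx; apply: H.
  rewrite (_ : z - x = (z - (x + s *: e j)) + s *: e j); last by rewrite opprD addrA subrK.
  rewrite (le_trans (ler_normD _ _))//= -natr1 mulrDl mul1r lerD//.
  by rewrite (le_trans (norm_step _ _))// ger0_norm.
split => // L v vL; apply/is_lipP => x d.
by apply: (comb _ _ _ _ _ _ _ _ _ _ _ _ vL vL vL) => z _; have /is_lipP := vL; apply.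
Qed.

(** This makes [g] the partial derivative of [v] in direction [j], with a quadratic remainder
    uniform in [x]. Being a pair of linear inequalities, it survives further averaging. *)
Definition rem2 (j : 'I_m) (v g : state -> R) (C : R) :=
  forall x (h : R), `|v (x + h *: e j) - v x - h * g x| <= C * h ^+ 2.

Lemma rem2_avgs l j v g C L L' : is_lip L v -> is_lip L' g ->
  rem2 j v g C -> rem2 j (avgs l v) (avgs l g) C.
Proof.
move=> vL gL H x h; have [comb _] := avgs_comb_lip l.
have E (a b c d : R) : (- d <= 1 * a + -1 * b + - h * c) /\ (- d <= -1 * a + 1 * b + h * c) ->
    `|a - b - h * c| <= d.
  by move=> [? ?]; rewrite ler_norml; apply/andP; split; lra.
apply: E; split.
  apply: (comb _ _ _ _ _ _ _ _ _ _ _ _ vL vL gL) => z _.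
  by have := H z h; rewrite ler_norml => /andP[? ?]; lra.
apply: (comb _ _ _ _ _ _ _ _ _ _ _ _ vL vL gL) => z _.
by have := H z h; rewrite ler_norml => /andP[? ?]; lra.
Qed.

(** The partial derivative of [avg j v] in direction [j], by the fundamental theorem of calculus. *)
Let diffq j (v : state -> R) x := eps^-1 * (v (x + eps *: e j) - v x).

Lemma diffq_lip j v L : is_lip L v -> is_lip (2 * eps^-1 * L) (diffq j v).
Proof.
move=> vL x y; rewrite /diffq -mulrBr normrM ger0_norm ?invr_ge0 ?(ltW eps0)//.
rewrite (_ : 2 * eps^-1 * L * _ = eps^-1 * (L * `|x - y| + L * `|x - y|)); last by ring.
rewrite ler_wpM2l ?invr_ge0 ?(ltW eps0)//.
rewrite (_ : _ - _ = (v (x + eps *: e j) - v (y + eps *: e j)) - (v x - v y)); last by ring.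
rewrite (le_trans (ler_normB _ _))// lerD//.
have := vL (x + eps *: e j) (y + eps *: e j).
by rewrite opprD addrACA subrr addr0.
Qed.

(** The two averaging intervals overlap, and only their ends of length [h] remain in the difference.
    On each end the integrand is within [|L| * h] of its value at the left endpoint. *)
Lemma rem2_avg_pos j v L x h : is_lip L v -> 0 <= h ->
  `|avg j v (x + h *: e j) - avg j v x - h * diffq j v x| <= 2 * eps^-1 * `|L| * h ^+ 2.
Proof.
move=> vL h0; pose W (s : R) := v (x + s *: e j).
have iW a b : mu.-integrable `[a, b] (EFin \o W) by exact: continuous_itv_integrable (@line_continuous _ _ j x vL).
have WL s t : `|W s - W t| <= `|L| * `|s - t| by exact: line_lip.
have -> : avg j v (x + h *: e j) = eps^-1 * \int[mu]_(s in `[h, eps + h]) W s.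
  rewrite /avg; congr (_ * _).
  rewrite -(Rintegral_shift h (D := `[h, eps + h]))//.
  - rewrite shift_itv subrr addrK; apply: eq_Rintegral => s _.
    by rewrite /W scalerDl addrA addrAC.
  - exact: continuous_measurable_fun (@line_continuous _ _ j x vL).
have e0 := ltW eps0.
have S1 := @Rintegral_split R W 0 h (eps + h) h0 ltac:(by rewrite lerDr) (iW _ _).
have S2 := @Rintegral_split R W 0 eps (eps + h) e0 ltac:(by rewrite lerDl) (iW _ _).
have bnd a : `|\int[mu]_(s in `[a, a + h]) W s - h * W a| <= `|L| * h * h.
  have -> : h * W a = \int[mu]_(s in `[a, a + h]) W a.
    by rewrite Rintegral_cst_itv ?lerDl// addrAC subrr add0r mulrC.
  rewrite -RintegralB//.
  rewrite -[X in _ <= _ * X](_ : a + h - a = h); last by rewrite addrAC subrr add0r.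
  apply: Rintegral_itv_bound; rewrite ?lerDl//; first exact: integrable_subr.
  move=> t /andP[ta tb]; rewrite (le_trans (WL _ _))// ler_wpM2l//.
  by rewrite ger0_norm ?subr_ge0// lerBlDr addrC.
have := bnd 0; have := bnd eps; rewrite add0r /diffq.
have -> : v (x + eps *: e j) = W eps by [].
have -> : v x = W 0 by rewrite /W scale0r addr0.
rewrite /avg -/(W _); have -> : \int[mu]_(s in `[0, eps]) v (x + s *: e j) = \int[mu]_(s in `[0, eps]) W s by [].
move: S1 S2; set I1 := \int[mu]_(s in `[0, eps + h]) _; set I2 := \int[mu]_(s in `[0, h]) _.
set I3 := \int[mu]_(s in `[h, eps + h]) _; set I4 := \int[mu]_(s in `[0, eps]) _.
set I5 := \int[mu]_(s in `[eps, eps + h]) _ => S1 S2 B1 B2.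
have -> : eps^-1 * I3 - eps^-1 * I4 - h * (eps^-1 * (W eps - W 0)) =
  eps^-1 * ((I5 - h * W eps) - (I2 - h * W 0)).
  have -> : I3 = I4 + I5 - I2 by rewrite -S2 S1; ring.
  ring.
rewrite normrM ger0_norm ?invr_ge0//.
rewrite (_ : 2 * eps^-1 * _ * _ = eps^-1 * (`|L| * h * h + `|L| * h * h)); last by ring.
by rewrite ler_wpM2l ?invr_ge0// (le_trans (ler_normB _ _))// lerD.
Qed.

(** A negative [h] is reduced to [- h] based at [x + h *: e j]; bringing the derivative back to [x]
    uses that [diffq] is Lipschitz, and this doubles the constant. *)
Lemma rem2_avg j v L : is_lip L v ->
  rem2 j (avg j v) (diffq j v) (2 * eps^-1 * `|L| + 2 * eps^-1 * `|L|).
Proof.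
move=> vL x h.
have C0 : 0 <= 2 * eps^-1 * `|L| by rewrite mulr_ge0// mulr_ge0// invr_ge0 ltW.
have [h0|/ltW h0] := leP 0 h.
  rewrite (le_trans (rem2_avg_pos _ _ vL h0))// ler_wpM2r ?sqr_ge0//.
  by rewrite lerDl.
have hn0 : 0 <= - h by rewrite oppr_ge0.
have H1 := rem2_avg_pos j (x + h *: e j) vL hn0.
have H2 := diffq_lip j (is_lip_ge0 vL) (x + h *: e j) x.
move: H1; rewrite scaleNr addrK => H1.
rewrite (_ : _ - _ = - (avg j v x - avg j v (x + h *: e j) - - h * diffq j v (x + h *: e j))
  + h * (diffq j v (x + h *: e j) - diffq j v x)); last by ring.
rewrite (le_trans (ler_normD _ _))// normrN [X in _ <= X]mulrDl lerD//.
  by rewrite -[h ^+ 2]sqrrN.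
rewrite normrM; apply: (@le_trans _ _ (`|h| * (2 * eps^-1 * `|L| * `|h|))).
  rewrite ler_wpM2l// (le_trans H2)// ler_wpM2l//.
  by rewrite addrAC subrr add0r norm_step.
by rewrite mulrCA -expr2 real_normK// num_real.
Qed.

(** If [j] is averaged last, the partial derivative is a difference quotient of the inner average;
    otherwise the outer average is applied to the partial derivative already found. *)
Lemma avgs_partial l j v L : is_lip L v -> j \in l ->
  exists g C L', is_lip L' g /\ rem2 j (avgs l v) g C.
Proof.
move=> vL; elim: l => //= i l IH; rewrite inE => /orP[/eqP ->|/IH].
  exists (diffq i (avgs l v)); eexists; eexists; split.
    by apply: diffq_lip; apply: (proj2 (avgs_comb_lip l) _ _ vL).
  by apply: rem2_avg; apply: (proj2 (avgs_comb_lip l) _ _ vL).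
move=> [g [C [L' [gL gC]]]]; exists (avg i g), C, L'; split.
  exact: (proj2 (avgs_comb_lip [:: i]) _ _ gL).
apply: (@rem2_avgs [:: i] _ _ _ _ _ _ _ gL gC).
exact: (proj2 (avgs_comb_lip l) _ _ vL).
Qed.

End averaging.

Section partial_remainders.
Context (R : realType) (m : nat).
Local Notation state := 'rV[R]_m.
Variables (phi : state -> R) (g : 'I_m -> state -> R) (C L : 'I_m -> R).
Hypotheses (gL : forall j, is_lip (L j) (g j)) (gC : forall j, rem2 j phi (g j) (C j)).

Let e (j : 'I_m) : state := delta_mx 0 j.

(** The coordinates of [d] are added one at a time. Moving the base point of [g j] from [x + S] back
    to [x] costs [|d|] times the Lipschitz bound, again of second order. *)
Lemma partial_remainder_seq (l : seq 'I_m) : exists2 D : R, 0 <= D & forall x d : state,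
  `|phi (x + \sum_(j <- l) d ord0 j *: e j) - phi x - \sum_(j <- l) d ord0 j * g j x| <= D * `|d| ^+ 2.
Proof.
elim: l => [|j l [D D0 IH]].
  by exists 0 => // x d; rewrite !big_nil addr0 subrr subrr normr0 mul0r.
exists (`|C j| + `|L j| * (size l)%:R + D); first by rewrite !addr_ge0// mulr_ge0.
move=> x d; rewrite !big_cons.
have dj : `|d ord0 j| <= `|d| by exact: row_coord_le.
set S := \sum_(i <- l) _; set T := \sum_(i <- l) _.
have SB : `|S| <= (size l)%:R * `|d|.
  rewrite /S; elim: (l) => [|i l' IHl]; first by rewrite big_nil normr0 mul0r.
  rewrite big_cons (le_trans (ler_normD _ _))//= -natr1 mulrDl mul1r addrC lerD//.
  by rewrite (le_trans (norm_step _ _))// row_coord_le.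
rewrite (_ : _ - _ = (phi ((x + S) + d ord0 j *: e j) - phi (x + S) - d ord0 j * g j (x + S))
  + d ord0 j * (g j (x + S) - g j x) + (phi (x + S) - phi x - T)); last first.
  by rewrite addrCA addrC; ring.
rewrite (le_trans (ler_normD _ _))// [leRHS]mulrDl lerD//; last exact: IH.
rewrite (le_trans (ler_normD _ _))// [leRHS]mulrDl lerD//.
  rewrite (le_trans (gC _ _ _))//; apply: (@le_trans _ _ (`|C j| * d ord0 j ^+ 2)).
    by rewrite ler_wpM2r ?sqr_ge0// ler_norm.
  by rewrite ler_wpM2l// -(real_normK (num_real (d ord0 j))) lerXn2r ?nnegrE.
rewrite normrM expr2 mulrA mulrC ler_pM//.
rewrite (le_trans (is_lip_ge0 (gL j) _ _))// -mulrA ler_wpM2l//.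
by rewrite addrAC subrr add0r.
Qed.

Lemma partial_remainder : exists2 D : R, 0 <= D & forall x d : state,
  `|phi (x + d) - phi x - \sum_j d ord0 j * g j x| <= D * `|d| ^+ 2.
Proof.
have [D D0 H] := partial_remainder_seq (index_enum 'I_m).
by exists D => // x d; rewrite {1}[d]row_sum_delta; exact: H.
Qed.

(** Besides regularity, the quadratic remainder is kept, as its uniformity in [x] is used when a
    step size tends to 0. *)
Lemma C1_of_partial : C1 phi /\ exists2 D : R, 0 <= D & forall x d : state,
  `|phi (x + d) - phi x - 'd phi x d| <= D * `|d| ^+ 2.
Proof.
have [D D0 H] := partial_remainder.
pose df x (d : state) : R := \sum_j d ord0 j * g j x.
have df_lin x : linear (df x : state -> R^o).
  move=> a u v; rewrite /df /= scaler_sumr -big_split; apply: eq_bigr => j _ /=.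
  by rewrite !mxE mulrDl -mulrA.
have df_cont x : continuous (df x : state -> R^o).
  have df_lip : is_lip (\sum_j `|g j x|) (df x).
    move=> u v; rewrite /df -sumrB mulr_suml (le_trans (ler_norm_sum _ _ _))//.
    apply: ler_sum => j _; rewrite -mulrBl normrM mulrC ler_wpM2l//.
    by have := row_coord_le (u - v) j; rewrite !mxE.
  exact: (@lipschitz_continuous R state R^o _ _ df_lip).
pose lf x : {linear state -> R^o} := HB.pack (df x : state -> R^o) (GRing.isLinear.Build _ _ _ _ _ (df_lin x)).
have little x : (phi : state -> R^o) \o shift x = cst (phi x : R^o) + lf x +o_ (0 : state) id.
  apply/eqaddoP => _/posnumP[eps]; near=> d.
  have -> : ((phi : state -> R^o) \o shift x - (cst (phi x : R^o) + lf x : state -> R^o)) d =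
    phi (x + d) - phi x - \sum_j d ord0 j * g j x.
    by rewrite fctE /= opprD addrA [d + x]addrC.
  apply: (le_trans (H x d)); rewrite expr2 mulrA ler_wpM2r//.
  apply: (@le_trans _ _ ((D + 1) * `|d|)); first by rewrite ler_wpM2r// lerDl.
  rewrite mulrC -ler_pdivlMr ?ltr_pwDr//.
  near: d.
  have e0 : 0 < eps%:num / (D + 1) by rewrite divr_gt0// ltr_pwDr.
  exact: (@cvgr0_norm_le R state _ (nbhs (0 : state)) _ id (@cvg_id _ _) _ e0).
have dE x : 'd (phi : state -> R^o) x = df x :> (state -> R^o).
  exact: (@diff_unique _ _ _ _ (lf x) _ (@df_cont x) (little x)).
have diff_phi x : differentiable (phi : state -> R^o) x.
  by apply/diff_locallyP; rewrite dE; split; [exact: df_cont|exact: little].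
split; first split.
- exact: diff_phi.
- move=> v.
  have -> : (fun x => 'd phi x v) = (fun x => df x v).
    by apply/funext => x; rewrite -dE.
  have df_lip : is_lip (\sum_j `|v ord0 j| * `|L j|) (fun x => df x v).
    move=> x y; rewrite /df -sumrB mulr_suml (le_trans (ler_norm_sum _ _ _))//.
    apply: ler_sum => j _; rewrite -mulrBr normrM -mulrA ler_wpM2l//.
    exact: is_lip_ge0.
  exact: (@lipschitz_continuous R state R^o _ _ df_lip).
- exists D => // x d; have -> : 'd phi x d = df x d by rewrite -dE.
  exact: H.
Unshelve. all: by end_near. Qed.

End partial_remainders.

(** The last clause carries the dynamic programming inequality over to [phi]: a lower bound on the
    increments of [v] along one fixed displacement, at all points near [x], passes to the
    average. *)
Lemma mollify (R : realType) (m : nat) (v : 'rV[R]_m -> R) (L eps : R) :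
  0 < eps -> is_lip L v -> exists phi : 'rV[R]_m -> R,
  [/\ C1 phi,
      (exists2 D : R, 0 <= D & forall x d, `|phi (x + d) - phi x - 'd phi x d| <= D * `|d| ^+ 2),
      (forall x, `|phi x - v x| <= `|L| * eps) &
      (forall x d c, (forall z, `|z - x| <= eps -> c <= v (z + d) - v z) ->
         c <= phi (x + d) - phi x)].
Proof.
move=> eps0 vL; pose ep := eps / m.+1%:R.
have ep0 : 0 < ep by rewrite divr_gt0.
pose l := enum 'I_m; pose phi := avgs ep l v.
have le_ep : (size l)%:R * ep <= eps.
  rewrite /l size_enum_ord /ep mulrCA ger_pMr// ler_pdivrMr// mul1r ler_nat.
  exact: leqnSn.
have [comb _] := avgs_comb_lip ep0 l.
have /choice[g /choice[C /choice[L' gCL]]] : forall j, exists g, exists C, exists L',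
    is_lip L' g /\ rem2 j phi g C.
  by move=> j; apply: (avgs_partial ep0 vL); rewrite mem_enum.
have [phi_C1 phiD] := C1_of_partial (fun j => (gCL j).1) (fun j => (gCL j).2).
exists phi; split => //.
- move=> x.
  have near_v z : `|z - x| <= (size l)%:R * ep -> `|v z - v x| <= `|L| * eps.
    move=> zx; rewrite (le_trans (is_lip_ge0 vL _ _))// ler_wpM2l//.
    exact: le_trans zx le_ep.
  have := comb v v v _ _ _ x 0 1 0 0 (v x - `|L| * eps) vL vL vL.
  have := comb v v v _ _ _ x 0 (-1) 0 0 (- v x - `|L| * eps) vL vL vL.
  rewrite addr0 !mul0r !addr0 -/phi => H1 H2.
  rewrite ler_norml; apply/andP; split.
    rewrite -lerBlDr opprK addrC; apply: le_trans (H2 _) _; last by rewrite mul1r.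
    move=> z /near_v; rewrite addr0 !mul0r !addr0 mul1r ler_norml => /andP[? ?]; lra.
  have {}H1 : - v x - `|L| * eps <= - phi x.
    rewrite -[- phi x]mulN1r; apply: H1 => z /near_v.
    by rewrite addr0 !mul0r !addr0 mulN1r ler_norml => /andP[? ?]; lra.
  by lra.
- move=> x d c H.
  have := comb v v v _ _ _ x d 1 (-1) 0 c vL vL vL.
  rewrite mul1r mulN1r mul0r addr0; apply => z zx.
  rewrite mul1r mulN1r mul0r addr0; apply: H; exact: le_trans zx le_ep.
Qed.

(** * Smooth approximations of the value that nearly increase along the dynamics *)

Lemma lipschitz_extension (R : realType) (V : normedModType R) (K : set V)
    (w : V -> R) (L : R) :
  K !=set0 -> (forall x y, K x -> K y -> `|w x - w y| <= L * `|x - y|) ->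
  exists v : V -> R, (forall x y, `|v x - v y| <= `|L| * `|x - y|) /\
    forall x, K x -> v x = w x.
Proof.
move=> [x0 Kx0] wL0.
have wL x y : K x -> K y -> `|w x - w y| <= `|L| * `|x - y|.
  by move=> Kx Ky; rewrite (le_trans (wL0 _ _ Kx Ky))// ler_wpM2r// ler_norm.
(* McShane's formula. Box averages need a function on the whole space, whereas the value is
   Lipschitz only on the constraint set. *)
pose S x := [set w z + `|L| * `|x - z| | z in K].
have S0 x : S x !=set0 by exists (w x0 + `|L| * `|x - x0|), x0.
have lbS x y : K y -> lbound (S x) (w y - `|L| * `|x - y|).
  move=> Ky _ [z Kz <-]; have := wL _ _ Ky Kz; rewrite ler_norml => /andP[_].
  have : `|L| * `|y - z| <= `|L| * `|x - y| + `|L| * `|x - z|.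
    rewrite -mulrDr ler_wpM2l// [`|x - y|]distrC.
    exact: ler_distD.
  lra.
have hS x : has_inf (S x) by split; [exact: S0|exists (w x0 - `|L| * `|x - x0|); exact: lbS].
exists (fun x => inf (S x)); split; last first.
  move=> x Kx; apply/eqP; rewrite eq_le; apply/andP; split.
    apply: inf_lbound; first by have [] := hS x.
    by exists x => //; rewrite subrr normr0 mulr0 addr0.
  apply: lb_le_inf; first exact: S0.
  by have := lbS x x Kx; rewrite subrr normr0 mulr0 subr0.
have half x y : inf (S x) - `|L| * `|x - y| <= inf (S y).
  apply: lb_le_inf; first exact: S0.
  move=> _ [z Kz <-]; rewrite lerBlDr.
  apply: (@le_trans _ _ (w z + `|L| * `|x - z|)).
    by apply: inf_lbound; [have [] := hS x|exists z].
  rewrite -addrA lerD2l -mulrDr ler_wpM2l//.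
  by rewrite [leRHS]addrC ler_distD.
move=> x y; have := half x y; have := half y x; rewrite [`|y - x|]distrC => H1 H2.
by rewrite ler_norml; apply/andP; split; lra.
Qed.

Section smooth_value.
Context {R : realType} {m : nat} {U : pmetricType R}.
Local Notation state := 'rV[R]_m.
Variables (f : state * U -> state) (K : set state) (k : state * U -> R).
Variables (B M L kappa : R) (nu : probability (measurableTypeR R) R).
Hypotheses (f_cont : continuous f) (k_cont : continuous k).
Hypothesis f_bound : forall z, K z.1 -> `|f z| <= B.
Hypothesis k_bound : forall z, K z.1 -> `|k z| <= M.
Hypothesis f_lip : forall u x x', `|f (x, u) - f (x', u)| <= L * `|x - x'|.
Hypothesis L0 : 0 <= L.
Hypothesis slow_nu : slow kappa nu.
Variables (v : state -> R) (Lv : R).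
Hypotheses (v_lip : is_lip Lv v) (vE : forall x, K x -> value f K k nu x = (v x)%:E).

(** Apply [value_flow] to the Picard path of the constant control [u], which stays within
    [2 * B * s <= rho] of [x]. There [f] varies by at most [2 * L * B * s], so the path ends within
    [2 * L * B * s ^+ 2] of the Euler step. *)
Lemma value_step x u (s rho : R) :
  0 <= rho -> (forall x', `|x' - x| <= rho -> K x') -> 0 <= s -> s * L <= 2^-1 ->
  2 * B * s <= rho ->
  v x <= v (x + s *: f (x, u)) + `|Lv| * (2 * L * B * s ^+ 2) + 2 * M * kappa * s.
Proof.
move=> rho0 xK s0 sL Bs.
have Kx : K x.
  by apply: xK; rewrite subrr normr0.
have fB : `|f (x, u)| <= B by exact: (f_bound (z := (x, u))).
have B0 : 0 <= B by exact: le_trans fB.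
have [y [cy yE yx]] := picard_local x (f_lip u) L0 s0 sL.
have yxB t : 0 <= t <= s -> `|y t - x| <= 2 * B * t.
  move=> /[dup] ts /andP[t0 _]; apply: (le_trans (yx _ ts)).
  by rewrite ler_wpM2r// ler_wpM2l.
have yK t : 0 <= t <= s -> K (y t).
  move=> /[dup] ts /andP[t0 t1]; apply: xK; apply: (le_trans (yxB _ ts)).
  by apply: le_trans Bs; rewrite ler_wpM2l// mulr_ge0.
have T : traj_upto f K s x (fun=> u) y.
  by split => //; exact: measurable_cst.
have ss : 0 <= s <= s by rewrite s0 lexx.
have := value_flow f_cont f_bound k_cont k_bound slow_nu s0 T.
rewrite vE// vE; last exact: yK.
rewrite -EFinD lee_fin => H; apply: (le_trans H); rewrite lerD2r.
have ys : `|y s - (x + s *: f (x, u))| <= 2 * L * B * s ^+ 2.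
  apply: row_norm_le; first by rewrite !mulr_ge0// exprn_ge0.
  have cF : continuous (fun x => f (x, u)) by exact: lipschitz_continuous (f_lip u).
  move=> i; rewrite !mxE yE// opprD addrACA subrr add0r.
  have cFi : continuous (fun t : R => f (y t, u) ord0 i).
    move=> t; apply: (@continuous_comp _ _ _ (fun t => f (y t, u)) (fun v : state => v ord0 i)).
      exact: (@continuous_comp _ _ _ y (fun x => f (x, u)) t (@cy t) (@cF _)).
    exact: coord_continuous.
  have -> : s * f (x, u) ord0 i = \int[lebesgue_measure]_(r in `[0, s]) f (x, u) ord0 i.
    rewrite Rintegral_cst//= lebesgue_measure_itv /= lte_fin mulrC.
    by case: ltgtP s0 => //= [_ _|<- _]; rewrite ?oppr0 ?addr0.
  have icst : lebesgue_measure.-integrable `[0, s] (EFin \o (fun=> f (x, u) ord0 i)).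
    by apply: continuous_itv_integrable => t; exact: cvg_cst.
  have iF := continuous_itv_integrable 0 s cFi.
  rewrite -RintegralB//.
  rewrite (_ : 2 * L * B * s ^+ 2 = 2 * L * B * s * (s - 0)); last by rewrite subr0; ring.
  apply: Rintegral_itv_bound => //; first exact: integrable_subr.
  move=> r rs; have := row_coord_le (f (y r, u) - f (x, u)) i; rewrite !mxE => /le_trans; apply.
  rewrite (le_trans (f_lip _ _ _))// (_ : 2 * L * B * s = L * (2 * B * s)); last by ring.
  rewrite ler_wpM2l// (le_trans (yxB _ rs))//.
  by case/andP: rs => r0 rs; rewrite ler_wpM2l// mulr_ge0.
rewrite -lerBlDl (le_trans (ler_norm _))// (le_trans (is_lip_ge0 v_lip _ _))//.
by rewrite ler_wpM2l.
Qed.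

(** The margin is [2 * rho] because averaging looks at points [z] within [rho] of [y], and
    [value_step] needs a ball of radius [rho] around each [z]. The bound on increments is divided by
    [s], and [s] tends to 0. *)
Lemma smooth_value (Y : set state) (rho eps : R) : 0 < rho -> 0 < eps ->
  (forall y x, Y y -> `|x - y| <= 2 * rho -> K x) ->
  exists phi : state -> R, [/\ C1 phi, (forall x, `|phi x - v x| <= eps) &
    forall y u, Y y -> - (2 * M * kappa + eps) <= 'd phi y (f (y, u))].
Proof.
move=> rho0 eps0 YK.
(* The smoothing scale must keep [phi] within [eps] of [v] and make the variation of [f (_, u)] over
   the box cost at most [eps], hence the factors in [Lv] and [L]. *)
pose eta := Num.min rho (eps / ((`|Lv| + 1) * (L + 1))).
have q0 : 0 < (`|Lv| + 1) * (L + 1) by rewrite mulr_gt0// ltr_wpDl.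
have eta0 : 0 < eta by rewrite lt_min rho0 divr_gt0.
have eta_rho : eta <= rho by rewrite ge_min lexx.
have eta_eps : `|Lv| * (L + 1) * eta <= eps.
  apply: (@le_trans _ _ ((`|Lv| + 1) * (L + 1) * eta)).
    by rewrite ler_wpM2r ?(ltW eta0)// ler_wpM2r ?addr_ge0// lerDl.
  by rewrite mulrC -ler_pdivlMr// ge_min lexx orbT.
have eta1 : `|Lv| * eta <= eps.
  by apply: le_trans eta_eps; rewrite ler_wpM2r ?(ltW eta0)// ler_peMr// lerDr.
have eta2 : `|Lv| * L * eta <= eps.
  by apply: le_trans eta_eps; rewrite ler_wpM2r ?(ltW eta0)// ler_wpM2l// lerDl.
have [phi [phi_C1 [D D0 phiD] phi_v phi_incr]] := mollify eta0 v_lip.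
exists phi; split => //; first by move=> x; exact: le_trans (phi_v x) eta1.
move=> y u Yy.
have Ky : K y by apply: (YK y) => //; rewrite subrr normr0 mulr_ge0// ltW.
have B0 : 0 <= B by exact: (le_trans (normr_ge0 _) (f_bound (z := (y, u)) Ky)).
pose E := `|Lv| * (2 * L * B) + D * B ^+ 2.
have E0 : 0 <= E by rewrite addr_ge0// !mulr_ge0// exprn_ge0.
have key s : 0 < s -> s * L <= 2^-1 -> 2 * B * s <= rho ->
    - (2 * M * kappa + eps) - E * s <= 'd phi y (f (y, u)).
  move=> s0 sL sB; have s0' := ltW s0.
  have H : - (s * (2 * M * kappa + eps)) - `|Lv| * (2 * L * B * s ^+ 2) <= phi (y + s *: f (y, u)) - phi y.
    apply: phi_incr => z zy.
    have zrho : `|z - y| <= rho by exact: le_trans zy eta_rho.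
    have zK x' : `|x' - z| <= rho -> K x'.
      move=> x'z; apply: (YK y) => //.
      rewrite (_ : x' - y = (x' - z) + (z - y)) ?(le_trans (ler_normD _ _))//; last by rewrite addrA subrK.
      by rewrite mulr_natl mulr2n lerD.
    have := value_step u (ltW rho0) zK s0' sL sB.
    (* The step from [z] follows [f (z, u)], while [phi_incr] requires the same displacement for all
       [z]; it is frozen at [f (y, u)]. *)
    have H2 : v (z + s *: f (z, u)) <= v (z + s *: f (y, u)) + s * eps.
      rewrite -lerBlDl (le_trans (ler_norm _))// (le_trans (is_lip_ge0 v_lip _ _))//.
      rewrite opprD addrACA subrr add0r -scalerBr normrZ (ger0_norm s0').
      apply: (@le_trans _ _ (s * (`|Lv| * L * eta))); last by rewrite ler_wpM2l.
      rewrite mulrCA ler_wpM2l// -mulrA ler_wpM2l// (le_trans (f_lip _ _ _))//.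
      by rewrite ler_wpM2l.
    move=> H3.
    have -> : s * (2 * M * kappa + eps) = 2 * M * kappa * s + s * eps by ring.
    lra.
  have dE : 'd phi y (s *: f (y, u)) = s * 'd phi y (f (y, u)) by rewrite linearZ.
  have := phiD y (s *: f (y, u)); rewrite dE normrZ (ger0_norm s0') => H2.
  have {}H2 : phi (y + s *: f (y, u)) - phi y <= s * 'd phi y (f (y, u)) + D * (B ^+ 2 * s ^+ 2).
    have : `|f (y, u)| <= B by exact: (f_bound (z := (y, u))).
    move=> fB; have : D * (s * `|f (y, u)|) ^+ 2 <= D * (B ^+ 2 * s ^+ 2).
      by rewrite ler_wpM2l// exprMn mulrC ler_wpM2r ?sqr_ge0// lerXn2r ?nnegrE.
    by move: H2; rewrite ler_norml => /andP[_]; lra.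
  rewrite -(ler_pM2l s0).
  have -> : s * (- (2 * M * kappa + eps) - E * s) =
    - (s * (2 * M * kappa + eps)) - `|Lv| * (2 * L * B * s ^+ 2) - D * (B ^+ 2 * s ^+ 2) by rewrite /E; ring.
  lra.
apply/ler_addgt0Pr => e e0.
(* Short enough for Picard iteration, for staying within [rho], and for the second-order term
   [E * s] to be at most [e]. *)
pose s := Num.min (2^-1 / (L + 1)) (Num.min (rho / (2 * B + 1)) (e / (E + 1))).
have L1 : 0 < L + 1 by rewrite ltr_wpDl.
have B1 : 0 < 2 * B + 1 by rewrite ltr_wpDl// mulr_ge0.
have E1 : 0 < E + 1 by rewrite ltr_wpDl.
have s0 : 0 < s by rewrite !lt_min !divr_gt0.
have sL : s * L <= 2^-1.
  apply: (@le_trans _ _ (s * (L + 1))); first by rewrite ler_wpM2l ?ltW// ltrDl.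
  by rewrite -ler_pdivlMr// ge_min lexx.
have sB : 2 * B * s <= rho.
  apply: (@le_trans _ _ (s * (2 * B + 1))); first by rewrite mulrC ler_wpM2l ?ltW// ltrDl.
  by rewrite -ler_pdivlMr// !ge_min lexx orbT.
have sE : E * s <= e.
  apply: (@le_trans _ _ (s * (E + 1))); first by rewrite mulrC ler_wpM2l ?ltW// ltrDl.
  by rewrite -ler_pdivlMr// !ge_min lexx !orbT.
have := key s s0 sL sB; lra.
Qed.

End smooth_value.

(** * The chain rule along trajectories *)

Lemma continuous_bigsum (R : realType) (T : topologicalType) (I : Type)
    (r : seq I) (F : I -> T -> R) :
  (forall i, continuous (F i)) -> continuous (fun z => \sum_(i <- r) F i z).
Proof.
move=> cF; elim: r => [|i r IH].
  by under eq_fun do rewrite big_nil; move=> z; exact: cvg_cst.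
under eq_fun do rewrite big_cons.
by move=> z; apply: cvgD; [exact: cF|exact: IH].
Qed.

(* The integrands need not be continuous in time, but the defect of the chain
   rule is differentiable everywhere, with derivative zero. *)
Section chain_rule.
Context {R : realType} {m : nat} {U : pmetricType R}.
Local Notation state := 'rV[R]_m.
Local Notation mu := (@lebesgue_measure R).
Variables (f : state * U -> state) (K : set state) (B : R).
Hypotheses (f_cont : continuous f) (f_bound : forall z, K z.1 -> `|f z| <= B).
Variables (x : state) (u : R -> U) (y : R -> state).
Hypothesis T : traj f K x u y.
Variables (phi : state -> R) (a : 'I_m -> state -> R).
Hypothesis a_cont : forall j, continuous (a j).
Hypothesis phi_incr : forall p (eps : R), 0 < eps ->
  \forall q \near p, `|phi q - phi p - \sum_j (q - p) ord0 j * a j p| <= eps * `|q - p|.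

Let da (p q : state) : R := \sum_j `|a j p - a j q|.

Let g (s : R) : R := \sum_j f (y s, u s) ord0 j * a j (y s).

Let B0 : 0 <= B.
Proof. by have [_ _ /(_ 0) yK _] := T; exact: (le_trans (normr_ge0 _) (f_bound (z := (y 0, u 0)) yK)). Qed.

Let cay j : continuous (fun s => a j (y s)).
Proof. by have [_ cy _ _] := T; move=> s; exact: (@continuous_comp _ _ _ y (a j) s (@cy s) (@a_cont j _)). Qed.

Lemma integrable_comb (c : R -> 'I_m -> R) s0 s1 : (forall j, continuous (c ^~ j)) ->
  mu.-integrable `[s0, s1] (EFin \o (fun s => \sum_j f (y s, u s) ord0 j * c s j)).
Proof.
move=> cc; have [mu_ cy yK yE] := T.
have ca : continuous (fun s => \sum_j `|c s j|).
  by apply: (@continuous_bigsum _ R _ _ (fun j s => `|c s j|)) => j r; apply: cvg_norm; exact: cc.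
have i1 : mu.-integrable `[s0, s1] (EFin \o (fun s => B * \sum_j `|c s j|)).
  by apply: integrable_mull => //; exact: continuous_itv_integrable.
apply: (le_integrable _ _ _ i1) => //.
  apply/measurable_EFinP; apply: measurable_funTS.
  apply: measurable_sum => j; apply: measurable_funM.
    exact: (measurable_field f_cont).
  exact: continuous_measurable_fun (@cc j).
move=> s _; rewrite /= lee_fin; apply: le_trans (ler_norm _).
apply: le_trans (ler_norm_sum _ _ _) _; rewrite mulr_sumr.
apply: ler_sum => j _; rewrite normrM ler_wpM2r//.
exact: (field_le f_bound).
Qed.

Lemma traj_lip s0 s1 : 0 <= s0 -> s0 <= s1 -> `|y s1 - y s0| <= B * (s1 - s0).
Proof.
move=> s00 s01; have [mu_ cy yK yE] := T.
apply: row_norm_le; first by rewrite mulr_ge0// subr_ge0.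
move=> i; rewrite !mxE (traj_increment f_cont f_bound i T s00 s01) addrAC subrr add0r.
apply: Rintegral_itv_bound => //; first exact: (integrable_field f_cont f_bound).
by move=> t _; exact: (field_le f_bound).
Qed.

(** The increment of [y] is the integral of the field, and replacing [a j p] by [a j (y s)] under
    the integral costs at most [B * da p (y s)]. *)
Lemma linear_increment p s0 s1 (eps : R) : 0 <= s0 -> s0 <= s1 ->
  (forall s, s0 <= s <= s1 -> B * da p (y s) <= eps) ->
  `|\sum_j (y s1 - y s0) ord0 j * a j p - \int[mu]_(s in `[s0, s1]) g s| <= eps * (s1 - s0).
Proof.
move=> s00 s01 H; have [mu_ cy yK yE] := T.
have iF j := integrable_field f_cont f_bound mu_ cy yK j s0 s1.
have E : \sum_j (y s1 - y s0) ord0 j * a j p =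
    \int[mu]_(s in `[s0, s1]) \sum_j f (y s, u s) ord0 j * a j p.
  have S : forall r : seq 'I_m, mu.-integrable `[s0, s1] (EFin \o (fun s => \sum_(j <- r) f (y s, u s) ord0 j * a j p)) /\
    \int[mu]_(s in `[s0, s1]) (\sum_(j <- r) f (y s, u s) ord0 j * a j p) =
    \sum_(j <- r) (\int[mu]_(s in `[s0, s1]) f (y s, u s) ord0 j) * a j p.
    elim=> [|j r [IH1 IH2]].
      split; last by under eq_Rintegral do rewrite big_nil; rewrite big_nil Rintegral_cst// mul0r.
      under [X in EFin \o X]eq_fun do rewrite big_nil.
      by apply: continuous_itv_integrable => t; exact: cvg_cst.
    have i1 : mu.-integrable `[s0, s1] (EFin \o (fun s => f (y s, u s) ord0 j * a j p)).
      under [X in EFin \o X]eq_fun do rewrite mulrC.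
      by apply: integrable_mull => //; exact: iF.
    split.
      under [X in EFin \o X]eq_fun do rewrite big_cons.
      exact: integrable_addr.
    under eq_Rintegral do rewrite big_cons.
    by rewrite RintegralD// RintegralZr// IH2 big_cons.
  rewrite (proj2 (S (index_enum 'I_m))).
  apply: eq_bigr => j _; congr (_ * _).
  by rewrite !mxE (traj_increment f_cont f_bound j T s00 s01) addrAC subrr add0r.
have i1 := integrable_comb s0 s1 (c := fun _ j => a j p) ltac:(by move=> j t; exact: cvg_cst).
have i2 := integrable_comb s0 s1 (c := fun s j => a j (y s)) cay.
rewrite E -RintegralB//.
apply: Rintegral_itv_bound => //; first exact: integrable_subr.
move=> s sab; apply: le_trans (H s sab); rewrite -sumrB /da mulr_sumr.
apply: le_trans (ler_norm_sum _ _ _) _; apply: ler_sum => j _.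
rewrite -mulrBr normrM ler_wpM2r//.
exact: (field_le f_bound).
Qed.

Let D (t : R) : R := phi (y (pos t)) - \int[mu]_(s in `[0, pos t]) g s.

Let ig s0 s1 := integrable_comb s0 s1 (c := fun s j => a j (y s)) cay.

(** Half of [eps] pays for the first-order expansion of [phi] at [p], the path moving at speed at
    most [B]; the other half for the variation of the coefficients [a j] along the path. *)
Let D_flat t0 (eps : R) : 0 < eps -> \forall t \near t0, `|D t - D t0| <= eps * `|t - t0|.
Proof.
move=> eps0; have [mu_ cy yK yE] := T.
pose p := y (pos t0); pose eta := eps / 2 / (B + 1).
have B1 : 0 < B + 1 by rewrite ltr_wpDl.
have eta0 : 0 < eta by rewrite !divr_gt0.
have cyp : continuous (y \o pos).
  by move=> t; exact: (@continuous_comp _ _ _ pos y t (@continuous_pos R t) (@cy _)).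
have N1 : \forall t \near t0, `|phi (y (pos t)) - phi p - \sum_j (y (pos t) - p) ord0 j * a j p| <= eta * `|y (pos t) - p|.
  exact: (cyp t0 _ (phi_incr p eta0)).
have cd : continuous (fun t => da p (y (pos t))).
  apply: (@continuous_bigsum _ R _ _ (fun j t => `|a j p - a j (y (pos t))|)) => j r.
  apply: cvg_norm; apply: cvgB; first exact: cvg_cst.
  exact: (@continuous_comp _ _ _ (y \o pos) (a j) r (@cyp r) (@a_cont j _)).
have [r r0 N2] : exists2 r : R, 0 < r & forall s, `|pos t0 - s| < r -> da p (y (pos s)) <= eta.
  have d0 : da p (y (pos (pos t0))) = 0.
    by rewrite (pos_id (pos_ge0 _)) /da big1// => j _; rewrite subrr normr0.
  have /cvgrPdist_lt /(_ _ eta0) /nbhs_ballP[r /= r0 H] := cd (pos t0).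
  exists r => // s sr; have /= := H s sr.
  by rewrite d0 sub0r normrN => /ltW; exact: le_trans (ler_norm _).
have N3 : \forall t \near t0, `|t0 - t| < r.
  exact: (@cvgr_dist_lt _ _ _ (nbhs t0) _ id t0).
apply: filterS2 N1 N3 => t H1 tr.
have pl : `|pos t - pos t0| <= `|t - t0| by rewrite (le_trans (pos_lip _ _))// mul1r.
have yl : `|y (pos t) - p| <= B * `|pos t - pos t0|.
  have [tt|/ltW tt] := leP (pos t0) (pos t).
    by rewrite ger0_norm ?subr_ge0// traj_lip// pos_ge0.
  by rewrite distrC [`|pos t - _|]distrC ger0_norm ?subr_ge0// traj_lip// pos_ge0.
have near_s s : 0 <= s -> `|pos t0 - s| <= `|pos t - pos t0| -> B * da p (y s) <= eps / 2.
  move=> s0 st; have -> : s = pos s by rewrite pos_id.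
  apply: (@le_trans _ _ (B * eta)).
    by rewrite ler_wpM2l// N2// (le_lt_trans st)// (le_lt_trans pl)// distrC.
  rewrite /eta mulrCA ger_pMr ?divr_gt0//.
  by rewrite ler_pdivrMr// mul1r lerDl.
have DE : `|D t - D t0| <= `|phi (y (pos t)) - phi p - \sum_j (y (pos t) - p) ord0 j * a j p| + eps / 2 * `|pos t - pos t0|.
  rewrite /D -/p; have [tt|/ltW tt] := leP (pos t0) (pos t).
    rewrite (Rintegral_split (pos_ge0 t0) tt (ig _ _)).
    set I1 := \int[mu]_(s in `[0, _]) _; set I2 := \int[mu]_(s in _) _.
    set S := \sum_j _.
    rewrite (_ : _ - _ = (phi (y (pos t)) - phi p - S) + (S - I2)); last by ring.
    rewrite (le_trans (ler_normD _ _))// lerD2l (ger0_norm (x := pos t - _)) ?subr_ge0//.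
    apply: linear_increment => //; first exact: pos_ge0.
    move=> s /andP[s1 s2]; apply: near_s; first exact: le_trans (pos_ge0 _) s1.
    by rewrite distrC !ger0_norm ?subr_ge0// lerB.
  rewrite (Rintegral_split (pos_ge0 t) tt (ig _ _)).
  set I1 := \int[mu]_(s in `[0, _]) _; set I2 := \int[mu]_(s in _) _.
  pose S' := \sum_j (p - y (pos t)) ord0 j * a j p.
  set S := \sum_j _.
  have SS : S = - S' by rewrite /S /S' -sumrN; apply: eq_bigr => j _; rewrite -mulNr !mxE opprB.
  rewrite (_ : _ - _ = (phi (y (pos t)) - phi p - S) - (S' - I2)); last by rewrite SS; ring.
  rewrite (le_trans (ler_normB _ _))// lerD2l [`|pos t - _|]distrC (ger0_norm (x := pos t0 - _)) ?subr_ge0//.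
  apply: linear_increment => //; first exact: pos_ge0.
  move=> s /andP[s1 s2]; apply: near_s; first exact: le_trans (pos_ge0 _) s1.
  by rewrite [leRHS]distrC !ger0_norm ?subr_ge0// lerB.
apply: (le_trans DE).
rewrite [X in _ <= X * _](splitr eps) mulrDl lerD//; last first.
  by rewrite ler_wpM2l// divr_ge0// ltW.
apply: (le_trans H1); apply: (@le_trans _ _ (eta * (B * `|t - t0|))).
  by rewrite ler_wpM2l ?(ltW eta0)// (le_trans yl)// ler_wpM2l.
rewrite mulrA ler_wpM2r// /eta -mulrA ger_pMr ?divr_gt0//.
by rewrite mulrC ler_pdivrMr// mul1r lerDl.
Qed.

Lemma chain_rule t : 0 <= t -> phi (y t) - phi (y 0) = \int[mu]_(s in `[0, t]) g s.
Proof.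
move=> t0.
have dD r : is_derive r (1 : R) D 0.
  have cvg0 : (fun h : R => h^-1 *: ((D \o shift r) (h *: (1 : R)) - D r)) @ 0^' --> (0 : R).
    apply/cvgrPdist_le => e e0; rewrite near_withinE.
    have := D_flat r e0; rewrite (near_shift 0) subr0.
    apply: filterS => h /= H h0.
    rewrite sub0r normrN normrM normfV ler_pdivrMl ?normr_gt0//.
    by move: H; rewrite addrK [_%:A]mulr1 mulrC.
  split; first by apply/cvg_ex; exists 0.
  exact: cvg_lim.
have := is_derive_0_is_cst t 0 dD.
rewrite /D pos_id// (pos_id (lexx 0)) set_itv1 Rintegral_set1 subr0 => <-.
by rewrite opprB addrC subrK.
Qed.

End chain_rule.

Section differential_of_C1.
Context {R : realType} {m : nat} {U : pmetricType R}.
Local Notation state := 'rV[R]_m.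
Variable phi : state -> R.
Hypothesis phi_C1 : C1 phi.

Let e (j : 'I_m) : state := delta_mx 0 j.

Definition partial (p : state) (j : 'I_m) : R := 'd phi p (e j).

Lemma diff_coord p (d : state) : 'd phi p d = \sum_j d ord0 j * partial p j.
Proof.
rewrite {1}[d]row_sum_delta linear_sum; apply: eq_bigr => j _.
by rewrite linearZ.
Qed.

Lemma continuous_partial (j : 'I_m) : continuous (partial ^~ j).
Proof. rewrite /partial; by have [_ c] := phi_C1; exact: c. Qed.

(** [C1] asks for continuity of the differential one direction at a time; the expansion in
    coordinates makes it joint in state and control. *)
Lemma continuous_drift (f : state * U -> state) : continuous f -> continuous (drift f phi).
Proof.
move=> cf.
have -> : drift f phi = fun z : state * U => \sum_j f z ord0 j * partial (z.1) j.
  by apply/funext => z; rewrite /drift diff_coord.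
apply: continuous_bigsum => j z; apply: cvgM; first exact: (@continuous_coord _ _ _ f cf j z).
apply: (@continuous_comp _ _ _ fst (partial ^~ j) z); last exact: continuous_partial.
exact: cvg_fst.
Qed.

Lemma C1_increment (p : state) (eps : R) : 0 < eps ->
  \forall q \near p, `|phi q - phi p - 'd phi p (q - p)| <= eps * `|q - p|.
Proof.
move=> eps0; have [/(_ p) dphi _] := phi_C1.
have [_ /eqaddoP /(_ _ eps0)] := proj1 (diff_locallyP p phi) dphi.
rewrite [X in _ -> X](near_shift 0) subr0.
apply: filterS => d /=; rewrite addrK.
have -> : (phi \o shift p - (cst (phi p) + 'd phi p : state -> R)) d = phi (d + p) - phi p - 'd phi p d.
  by rewrite fctE /= opprD addrA.
by [].
Qed.

Lemma chain_rule_drift (f : state * U -> state) (K : set state) (B : R) x u y t :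
  continuous f -> (forall z, K z.1 -> `|f z| <= B) -> traj f K x u y -> 0 <= t ->
  phi (y t) - phi (y 0) = \int[lebesgue_measure]_(s in `[0, t]) drift f phi (y s, u s).
Proof.
move=> cf fB T t0.
have phi_incr p (eps : R) : 0 < eps ->
    \forall q \near p, `|phi q - phi p - \sum_j (q - p) ord0 j * partial p j| <= eps * `|q - p|.
  move=> eps0; have := C1_increment p eps0; apply: filterS => q.
  by rewrite (diff_coord p (q - p)).
rewrite (chain_rule cf fB T continuous_partial phi_incr t0).
by apply: eq_Rintegral => s _; rewrite /drift (diff_coord (y s) (f (y s, u s))).
Qed.

Lemma integrable_drift (f : state * U -> state) (K : set state) (B : R) x u y a b :
  continuous f -> (forall z, K z.1 -> `|f z| <= B) -> traj f K x u y ->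
  lebesgue_measure.-integrable `[a, b] (EFin \o (fun s => drift f phi (y s, u s))).
Proof.
move=> cf fB T; have [_ cy _ _] := T.
have cc j : continuous (fun s => partial (y s) j).
  by move=> s; exact: (@continuous_comp _ _ _ y (partial ^~ j) s (@cy s) (@continuous_partial j _)).
have := integrable_comb cf fB T a b (c := fun s j => partial (y s) j) cc.
apply: eq_integrable => // s _ /=; congr EFin.
by rewrite /drift (diff_coord (y s) (f (y s, u s))).
Qed.

End differential_of_C1.

(** * The uniform and exponential laws, and the two optimal values as instances of [value] *)

Section weights.
Context {R : realType}.
Local Notation mu := (@lebesgue_measure R).

Definition unif (T : R) (T0 : 0 < T) : probability (measurableTypeR R) R := uniform_prob T0.

Definition expo (l : R) (l0 : 0 < l) : probability (measurableTypeR R) R :=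
  exponential_distribution_exponential_prob__canonical__probability_measure_Probability l0.

Lemma slow_unif T (T0 : 0 < T) : slow T^-1 (unif T0).
Proof.
apply: (@slow_density R (unif T0) (uniform_pdf 0 T) T^-1).
- exact: measurable_uniform_pdf.
- by move=> t; exact: uniform_pdf_ge0.
- by [].
- by move=> t t0; rewrite /uniform_pdf leNgt t0.
- by move=> t; rewrite /uniform_pdf subr0; case: ifP => // _; rewrite invr_ge0 ltW.
- move=> t s t0 s0; rewrite /uniform_pdf subr0 t0 addr_ge0//=.
  case: ifP => [ts|_]; last by case: ifP => // _; rewrite invr_ge0 ltW.
  by rewrite (le_trans _ ts)// lerDl.
Qed.

Lemma slow_expo l (l0 : 0 < l) : slow l (expo l0).
Proof.
have pE t : 0 <= t -> exponential_pdf l t = l * expR (- l * t) by exact: exponential_pdfE.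
have pN t : t < 0 -> exponential_pdf l t = 0.
  by move=> t0; rewrite /exponential_pdf patchE ifF// memNset//= in_itv/= leNgt t0.
apply: (@slow_density R (expo l0) (exponential_pdf l) l).
- exact: measurable_exponential_pdf.
- by move=> t; exact: exponential_pdf_ge0 (ltW l0) _.
- by [].
- exact: pN.
- move=> t; have [t0|t0] := leP 0 t; last by rewrite pN// ltW.
  by rewrite pE// ger_pMr// -expR0 ler_expR mulNr oppr_le0 mulr_ge0// ltW.
- move=> t s t0 s0; rewrite !pE ?addr_ge0// ler_pM2l// ler_expR !mulNr lerN2.
  by rewrite ler_pM2l// lerDl.
Qed.

Lemma Rintegral_unif T (T0 : 0 < T) (F : R -> R) (M : R) :
  measurable_fun setT F -> (forall t, `|F t| <= M) ->
  \int[unif T0]_t F t = T^-1 * \int[mu]_(t in `[0, T]) F t.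
Proof.
move=> mF FM.
rewrite (@Rintegral_density _ _ _ mu (unif T0) (uniform_pdf 0 T))//.
- rewrite -RintegralZl//; last first.
    apply: (bounded_integrable (M := M)) => //; last exact: measurable_funTS.
    by rewrite /= lebesgue_measure_itv /= lte_fin T0 -EFinB ltry.
  rewrite [RHS]Rintegral_mkcond; apply: eq_Rintegral => t _.
  rewrite patchE mem_setE /uniform_pdf in_itv /= subr0 mulrC.
  by case: ifP => // _; rewrite mul0r.
- exact: measurable_uniform_pdf.
- by move=> t; exact: uniform_pdf_ge0.
- exact: (@bounded_prob_integrable _ _ _ (unif T0) F M mF FM).
Qed.

Lemma Rintegral_expo l (l0 : 0 < l) (F : R -> R) (M : R) :
  measurable_fun setT F -> (forall t, `|F t| <= M) ->
  mu.-integrable `[0, +oo[ (EFin \o (fun t => expR (- (l * t)) * F t)) /\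
  \int[expo l0]_t F t = l * \int[mu]_(t in `[0, +oo[) (expR (- (l * t)) * F t).
Proof.
move=> mF FM.
have mp : measurable_fun setT (exponential_pdf l) by exact: measurable_exponential_pdf.
have ip : mu.-integrable setT (EFin \o (fun t => M * exponential_pdf l t)).
  by apply: integrable_mull => //; exact: integrable_exponential_pdf.
have pE t : 0 <= t -> exponential_pdf l t = l * expR (- (l * t)).
  by move=> t0; rewrite exponential_pdfE// mulNr.
have iF : mu.-integrable setT (EFin \o (fun t => F t * exponential_pdf l t)).
  apply: (le_integrable _ _ _ ip) => //.
    by apply/measurable_EFinP; exact: measurable_funM.
  move=> t _; rewrite /= lee_fin !normrM ler_wpM2r//.
  by rewrite (le_trans (FM t))// ler_norm.
have H : mu.-integrable `[0, +oo[ (EFin \o (fun t => expR (- (l * t)) * F t)).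
  have : mu.-integrable `[0, +oo[ (EFin \o (fun t => l^-1 * (F t * exponential_pdf l t))).
    by apply: integrable_mull => //; apply: integrableS iF.
  apply: eq_integrable => // t; rewrite inE /= in_itv /= andbT => t0.
  by rewrite pE// mulrCA [_ * (l * _)]mulrCA mulVKf ?gt_eqF// mulrC.
split => //.
rewrite (@Rintegral_density _ _ _ mu (expo l0) (exponential_pdf l))//.
- rewrite -RintegralZl//.
  rewrite [RHS]Rintegral_mkcond; apply: eq_Rintegral => t _.
  rewrite patchE mem_setE in_itv /= andbT; case: leP => t0.
    by rewrite pE// mulrC mulrA.
  by rewrite /exponential_pdf patchE ifF ?mulr0// memNset//= in_itv/= leNgt t0.
- by move=> t; exact: exponential_pdf_ge0 (ltW l0) _.
- exact: (@bounded_prob_integrable _ _ _ (expo l0) F M mF FM).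
Qed.

End weights.

Section optimal_values.
Context {R : realType} {m : nat} {U : pmetricType R}.
Local Notation state := 'rV[R]_m.
Local Notation mu := (@lebesgue_measure R).
Variables (f : state * U -> state) (K : set state) (k : state * U -> R) (B M : R).
Hypotheses (f_cont : continuous f) (k_cont : continuous k).
Hypothesis f_bound : forall z, K z.1 -> `|f z| <= B.
Hypothesis k_bound : forall z, K z.1 -> `|k z| <= M.

Lemma integral_cost_itv x u y T : traj f K x u y ->
  (\int[mu]_(t in `[0%R, T]) (k (y t, u t))%:E =
   (\int[mu]_(t in `[0%R, T]) k (y t, u t))%R%:E)%E.
Proof.
move=> Tr; rewrite /Rintegral fineK//; apply: integrable_fin_num => //.
apply: (bounded_integrable (M := M)) => //.
- by rewrite /= lebesgue_measure_itv /=; case: ifP => _; rewrite ?ltry// -EFinB ltry.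
- exact: measurable_funTS (measurable_cost k_cont Tr).
- by move=> t _; exact: (cost_bound k_bound Tr).
Qed.

(** The finite horizon problem constrains the state only up to [T], whereas [traj] does so forever;
    viability at the endpoint supplies a continuation. The control may switch at [T], so agreement
    stops before it. *)
Lemma traj_of_adm_upto T x p : 0 <= T ->
  (forall x, K x -> adm_inf f K x !=set0) -> adm_upto f K T x p ->
  exists u y, traj f K x u y /\
    forall t, 0 <= t < T -> u t = p.1 t /\ y t = p.2 t.
Proof.
move=> T0 viable [mp [cy yE] yK].
have T_itv : `[0, T]%classic T by rewrite /= in_itv /= T0 lexx.
have [q /traj_of_adm Tq] := viable _ (yK _ T_itv).
have T1 : traj_upto f K T x (p.1 \o pos) (p.2 \o pos).
  split.
  - apply: (@measurable_comp _ _ _ R R (borel U) `[0, +oo[%classic (p.1 : R -> borel U) setT (@pos R)) => //.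
    + by move=> _ [t _ <-]; rewrite /= in_itv /= pos_ge0.
    + exact: measurable_pos.
  - exact: continuous_comp_pos.
  - by move=> t /andP[t0 tT]; rewrite /= pos_id//; apply: yK; rewrite /= in_itv /= t0.
  - move=> t /andP[t0 tT] i; rewrite /= pos_id// yE//; congr (_ + _).
    apply: eq_Rintegral => s; rewrite inE /= in_itv /= => /andP[s0 _].
    by rewrite pos_id.
have Tq' : traj f K ((p.2 \o pos) T) (q.1 \o pos) (q.2 \o pos) by rewrite /= pos_id.
have [u [y [Tr _ _ yE' uE']]] := traj_concat f_cont f_bound T0 T1 Tq'.
exists u, y; split => // t /andP[t0 tT]; split; first by rewrite uE'//= pos_id.
by rewrite yE' ?t0 ?ltW//= pos_id.
Qed.

Lemma V_value T (T0 : 0 < T) x : (forall x, K x -> adm_inf f K x !=set0) ->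
  V f k K T x = value f K k (unif T0) x.
Proof.
move=> viable; rewrite /V -ereal_inf_pZl ?invr_gt0// /value.
have costE u y : traj f K x u y ->
    (T^-1%:E * \int[mu]_(t in `[0%R, T]) (k (y t, u t))%:E =
     (\int[unif T0]_t k (y t, u t))%R%:E)%E.
  move=> Tr; rewrite (integral_cost_itv T Tr) -EFinM.
  by rewrite (Rintegral_unif T0 (measurable_cost k_cont Tr) (cost_bound k_bound Tr)).
congr ereal_inf; apply/seteqP; split.
- move=> _ [_ [p pA <-] <-].
  have [u [y [Tr E]]] := traj_of_adm_upto (ltW T0) viable pA.
  exists (u, y) => //=; rewrite -(costE _ _ Tr); congr (_ * _)%E.
  (* The two pairs are known to agree only before [T], so the endpoint is removed from both
     integrals. *)
  have mk : measurable_fun `[0, T[%classic (fun t => (k (y t, u t))%:E).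
    by apply/measurable_EFinP; exact: measurable_funTS (measurable_cost k_cont Tr).
  have eqk : {in `[0, T[%classic, (fun t => (k (y t, u t))%:E) =1 (fun t => (k (p.2 t, p.1 t))%:E)}.
    by move=> t; rewrite inE /= in_itv /= => /E[-> ->].
  have mp : measurable_fun `[0, T[%classic (fun t => (k (p.2 t, p.1 t))%:E) by exact: (eq_measurable_fun _ eqk mk).
  rewrite -integral_itv_bndo_bndc// -[RHS]integral_itv_bndo_bndc//.
  exact: eq_integral.
- move=> _ [[u y] /= Tr <-]; rewrite -(costE _ _ Tr).
  exists (\int[mu]_(t in `[0%R, T]) (k (y t, u t))%:E)%E => //.
  exists (u, y) => //; have [mp sol yK] := adm_of_traj Tr.
  by split => // t /=; rewrite in_itv /= => /andP[t0 _]; apply: yK; rewrite /= in_itv /= t0.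
Qed.

Lemma h_value l (l0 : 0 < l) x : h f k K l x = value f K k (expo l0) x.
Proof.
rewrite /h -ereal_inf_pZl// /value.
have costE u y : traj f K x u y ->
    (l%:E * \int[mu]_(t in `[0%R, +oo[) (expR (- (l * t)) * k (y t, u t))%:E =
     (\int[expo l0]_t k (y t, u t))%R%:E)%E.
  move=> Tr; have [iF ->] := Rintegral_expo l0 (measurable_cost k_cont Tr) (cost_bound k_bound Tr).
  by rewrite EFinM /Rintegral fineK//; exact: integrable_fin_num.
congr ereal_inf; apply/seteqP; split.
- move=> _ [_ [p pA <-] <-]; have Tr := traj_of_adm pA.
  exists (p.1 \o pos, p.2 \o pos) => //=; rewrite -(costE _ _ Tr); congr (_ * _)%E.
  by apply: eq_integral => t; rewrite inE /= in_itv /= andbT => t0; rewrite pos_id.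
- move=> _ [[u y] /= Tr <-]; rewrite -(costE _ _ Tr).
  exists (\int[mu]_(t in `[0%R, +oo[) (expR (- (l * t)) * k (y t, u t))%:E)%E => //.
  by exists (u, y) => //; exact: adm_of_traj.
Qed.

End optimal_values.

(** * The lower bound by the dual problem *)

Section dual_bound.
Context {R : realType} {m : nat} {U : pmetricType R}.
Local Notation state := 'rV[R]_m.
Local Notation mu := (@lebesgue_measure R).
Variables (f : state * U -> state) (Y : set state) (k : state * U -> R) (B M : R).
Hypotheses (f_cont : continuous f) (k_cont : continuous k).
Hypothesis f_bound : forall z, Y z.1 -> `|f z| <= B.
Hypothesis k_bound : forall z, Y z.1 -> `|k z| <= M.

Lemma traj0 x u y : traj f Y x u y -> y 0 = x.
Proof.
move=> [_ _ _ yE]; apply/rowP => i.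
by rewrite yE// set_itv1 Rintegral_set1 addr0.
Qed.

Lemma unif_tail (T : R) (T0 : 0 < T) : unif T0 `]T, +oo[%classic = 0%E.
Proof.
rewrite /unif /= /uniform_prob; apply: integral0_eq => t /=.
by rewrite in_itv /= andbT /uniform_pdf => Tt; rewrite [t <= T]leNgt Tt andbF.
Qed.

(** The loss has two sources: [2 * M * kappa] for replacing the running cost by its mean over a unit
    window, and [2 * E * kappa] for the increment of [eta] over that window, which is an expectation
    minus its shift by 1. *)
Lemma dual_value_bound (nu : probability (measurableTypeR R) R) (kappa E c : R)
    (psi eta : state -> R) x :
  slow kappa nu -> dual_feasible f k Y x c psi eta ->
  (forall z, Y z -> `|eta z| <= E) ->
  ((c - 2 * (E + M) * kappa)%:E <= value f Y k nu x)%E.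
Proof.
move=> slow_nu [psi_C1 eta_C1 feas] eta_E.
have [nu0 nu_shift] := slow_nu.
apply: le_ereal_inf_tmp => _ [[u y] /= T <-]; rewrite lee_fin.
have [mu_ cy yK yE] := T.
have mc := measurable_cost k_cont T.
have cM := cost_bound k_bound T.
have ms (s : R) : measurable_fun setT (fun t : R => t + s) by exact: measurable_funD.
have psi_incr t : 0 <= t -> psi x - psi (y t) <= 0.
  move=> t0; rewrite -(traj0 T) -opprB oppr_le0.
  rewrite (chain_rule_drift psi_C1 f_cont f_bound T t0); apply: Rintegral_ge0 => s _.
  by have [] := feas (y s, u s) (conj (yK s) I).
(* Feasibility integrated over the window. The term in [psi] has a favourable sign because [psi] has
   grown since time 0, and the drift of [eta] integrates to its increment. *)
have step t : 0 <= t -> c - (eta (y (t + 1)) - eta (y t)) <= \int[unif ltr01]_s k (y (t + s), u (t + s)).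
  move=> t0; have Ts := traj_shift f_cont f_bound T t0.
  have mct := measurable_cost k_cont Ts.
  have cMt := cost_bound k_bound Ts.
  under eq_Rintegral do rewrite addrC.
  rewrite (Rintegral_unif ltr01 mct cMt) invr1 mul1r.
  have := chain_rule_drift eta_C1 f_cont f_bound Ts ler01; rewrite add0r [1 + t]addrC => ->.
  have i1 := integrable_drift eta_C1 0 1 f_cont f_bound Ts.
  have i2 : mu.-integrable `[0, 1] (EFin \o (fun=> c)).
    by apply: continuous_itv_integrable => r; exact: cvg_cst.
  have {1}<- : \int[mu]_(s in `[0, 1]) c = c.
    by rewrite Rintegral_cst//= lebesgue_measure_itv /= lte_fin ltr01 oppr0 addr0 mulr1.
  rewrite -RintegralB//; apply: le_Rintegral => //.
  - exact: integrable_subr.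
  - apply: (bounded_integrable (M := M)) => //; last exact: measurable_funTS.
    by rewrite /= lebesgue_measure_itv /= lte_fin ltr01 -EFinB ltry.
  move=> s /=; rewrite in_itv /= => /andP[s0 s1].
  have [+ _] := feas (y (s + t), u (s + t)) (conj (yK _) I).
  have := psi_incr (s + t) (addr_ge0 s0 t0).
  by rewrite /=; lra.
(* The inner law is uniform on [[0, 1]]; with [N = 1] it has no tail. *)
have := @slow_average_le R (unif ltr01) nu kappa _ M slow_nu (proj1 (slow_unif ltr01)) mc cM 1 ler01.
rewrite unif_tail /= !mulr0 addr0 mulr1 => Avg.
pose G t := eta (y t).
have mG : measurable_fun setT G.
  apply: continuous_measurable_fun => t; have [d _] := eta_C1.
  apply: (@continuous_comp _ _ _ y eta t (@cy t)).
  exact: differentiable_continuous (d (y t)).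
have GE t : `|G t| <= E by apply: eta_E; exact: yK.
have E0 : 0 <= E by exact: le_trans (GE 0).
have M0 : 0 <= M by exact: le_trans (cM 0).
have mG1 : measurable_fun setT (fun t : R => G (t + 1)) by exact: measurableT_comp.
have iG : nu.-integrable setT (EFin \o G) by exact: (@bounded_prob_integrable _ _ _ nu G E).
have iG1 : nu.-integrable setT (EFin \o (fun t : R => G (t + 1))) by exact: (@bounded_prob_integrable _ _ _ nu _ E).
have ic : nu.-integrable setT (EFin \o (fun=> c)) by exact: (@bounded_prob_integrable _ _ _ nu _ `|c|).
have low : c - (\int[nu]_t G (t + 1) - \int[nu]_t G t) <= \int[nu]_(t in [set: R]) \int[unif ltr01]_s k (y (t + s), u (t + s)).
  rewrite -RintegralB// -{1}(prob_Rintegral_cst nu c) -RintegralB//; last exact: integrable_subr.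
  apply: (@le_Rintegral_nonneg_support _ _ nu0 _ _ (`|c| + (E + E) + M)).
  - apply: measurable_funB => //; exact: measurable_funB.
  - move=> t; rewrite (le_trans (ler_normB _ _))// -addrA lerD2l ler_wpDr//.
    by rewrite (le_trans (ler_normB _ _))// lerD.
  - exact: (measurable_average (unif ltr01) mc cM).
  - move=> t; rewrite (le_trans (average_bound (unif ltr01) mc cM t))//.
    by rewrite ler_wpDl// !addr_ge0.
  - exact: step.
have := nu_shift _ _ _ mG GE ler01; rewrite mulr1.
move: Avg; rewrite !ler_norml => /andP[_ A2] /andP[_ A4].
have -> : 2 * (E + M) * kappa = 2 * E * kappa + 2 * M * kappa by ring.
move: A2 A4 low => /=.
set I1 := \int[nu]_(t in _) _; set I2 := \int[nu]_t _; set I3 := \int[nu]_t _; set I4 := \int[nu]_t _.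
lra.
Qed.

End dual_bound.

(** * Mixtures, weak convergence and occupational measures *)

Section mixture.
Context d (T : measurableType d) (R : realType) (n : nat).
Variables (a : 'I_n -> R) (gs : 'I_n -> {measure set T -> \bar R}).
Variables (g : {measure set T -> \bar R}).
Hypothesis a0 : forall i, 0 <= a i.
Hypothesis gE : forall Q, measurable Q -> g Q = (\sum_i (a i)%:E * gs i Q)%E.

(** [msum] sums a sequence of measures indexed by [nat], hence the default zero measure beyond
    [n]. *)
Let scaled (j : nat) : {measure set T -> \bar R} :=
  match insub j with
  | Some i => [the measure _ _ of mscale (NngNum (a0 i)) (gs i)]
  | None => [the measure _ _ of mzero]
  end.

Lemma ge0_integral_mixture (D : set T) (F : T -> \bar R) :
  measurable D -> measurable_fun D F -> (forall x, D x -> 0 <= F x)%E ->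
  (\int[g]_(x in D) F x = \sum_i (a i)%:E * \int[gs i]_(x in D) F x)%E.
Proof.
move=> mD mF F0.
rewrite (@eq_measure_integral _ _ _ _ (msum scaled n)); last first.
  move=> A mA _; rewrite gE// /msum; apply: eq_bigr => i _.
  by rewrite /scaled valK.
rewrite ge0_integral_measure_sum//; apply: eq_bigr => i _.
by rewrite /scaled valK /= ge0_integral_mscale.
Qed.

Lemma Rintegral_mixture (D : set T) (F : T -> R) (C : R) :
  measurable D -> measurable_fun D F -> (forall x, D x -> `|F x| <= C) ->
  (g D < +oo)%E -> (forall i, gs i D < +oo)%E ->
  \int[g]_(x in D) F x = \sum_i a i * \int[gs i]_(x in D) F x.
Proof.
move=> mD mF FC gD gsD.
have iF (P : {measure set T -> \bar R}) : (P D < +oo)%E -> P.-integrable D (EFin \o F).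
  by move=> PD; exact: bounded_integrable FC.
have iC (P : {measure set T -> \bar R}) : (P D < +oo)%E -> P.-integrable D (EFin \o (fun=> C)).
  by move=> PD; exact: (bounded_integrable (M := `|C|)).
(* Adding [C] makes the integrand nonnegative on [D]; the correction is proportional to the mass of
   [D], which is itself mixed linearly. *)
have E (P : {measure set T -> \bar R}) : (P D < +oo)%E ->
    \int[P]_(x in D) F x = \int[P]_(x in D) (F x + C) - C * fine (P D).
  by move=> PD; rewrite RintegralD ?Rintegral_cst ?addrK//; [exact: iF|exact: iC].
have FC0 x : D x -> (0 <= (F x + C)%:E)%E.
  by move=> Dx; rewrite lee_fin; have := FC x Dx; rewrite ler_norml => /andP[? _]; lra.
have mFC : measurable_fun D (fun x => (F x + C)%:E).
  by apply/measurable_EFinP; exact: measurable_funD.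
have fin (P : {measure set T -> \bar R}) : (P D < +oo)%E -> (\int[P]_(x in D) (F x + C)%:E)%E \is a fin_num.
  by move=> PD; apply: integrable_fin_num => //; apply: integrable_addr; [|exact: iF|exact: iC].
have G : \int[g]_(x in D) (F x + C) = \sum_i a i * \int[gs i]_(x in D) (F x + C).
  rewrite /Rintegral ge0_integral_mixture// -sum_fine; last first.
    by move=> i _; rewrite fin_numM// fin.
  by apply: eq_bigr => i _; rewrite fineM// fin.
have gDE : fine (g D) = \sum_i a i * fine (gs i D).
  rewrite gE// -sum_fine; last by move=> i _; rewrite fin_numM// ge0_fin_numE.
  by apply: eq_bigr => i _; rewrite fineM// ge0_fin_numE.
rewrite E// G gDE mulr_sumr -sumrB; apply: eq_bigr => i _.
by rewrite (E _ (gsD i)) mulrBr; congr (_ - _); rewrite mulrCA.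
Qed.

End mixture.

Section test_functions.
Context {R : realType} {m : nat} {U : pmetricType R}.
Local Notation state := 'rV[R]_m.
Variables (Y : set state) (q : nat -> state * U -> R).
Hypotheses (Y_closed : closed Y) (q_test : test_sequence Y q).

Lemma closed_cyl : closed (cyl Y : set (state * U)).
Proof.
have -> : cyl Y = fst @^-1` Y :> set (state * U).
  by apply/seteqP; split => z; [case|].
by apply: closed_comp => // z _; exact: cvg_fst.
Qed.

Lemma measurable_cyl : measurable (cyl Y : set (borel (state * U)%type)).
Proof. exact: closed_borel_measurable closed_cyl. Qed.

Lemma test_continuous j : {within cyl Y, continuous (q j)}.
Proof.
have [/(_ j) [L qL] _ _] := q_test.
apply/subspace_continuousP => z Yz; apply/cvgrPdist_le => e e0.
rewrite near_withinE /=.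
have d0 : 0 < e / (2 * (`|L| + 1)) by rewrite divr_gt0// mulr_gt0// ltr_pwDr.
have N1 : \forall w \near z, `|z.1 - w.1| <= e / (2 * (`|L| + 1)).
  exact: (@cvgr_dist_le _ _ _ (nbhs z) _ fst z.1 (@cvg_fst _ _ _ _ _) _ d0).
have N2 : \forall w \near z, mdist z.2 w.2 <= e / (2 * (`|L| + 1)).
  exact: (@metricType_numDomainType.cvgr_dist_le R U _ (nbhs z) _ snd z.2 (@cvg_snd _ _ _ _ _) _ d0).
apply: filterS2 N1 N2 => w w1 w2 Yw.
rewrite (le_trans (qL _ _ Yz Yw))//.
apply: (@le_trans _ _ ((`|L| + 1) * (e / (2 * (`|L| + 1)) + e / (2 * (`|L| + 1))))).
  apply: (@le_trans _ _ ((`|L| + 1) * (`|z.1 - w.1| + mdist z.2 w.2))).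
    rewrite ler_wpM2r ?addr_ge0// ?mdist_ge0//.
    by rewrite (le_trans (ler_norm _))// lerDl.
  by rewrite ler_wpM2l ?addr_ge0// lerD.
rewrite le_eqVlt; apply/orP; left; apply/eqP; field.
by rewrite gt_eqF// ltr_pwDr.
Qed.

Lemma rho_ge_term (g g' : @prob R m U) j :
  ((2 ^- j.+1 * `|\int[g]_(z in cyl Y) q j z - \int[g']_(z in cyl Y) q j z|)%R%:E <= rho Y q g g')%E.
Proof.
rewrite /rho; apply: le_trans (nneseries_lim_ge j.+1 _); last first.
  by move=> n _ _; rewrite lee_fin mulr_ge0// invr_ge0 exprn_ge0.
rewrite big_nat_recr//= leeDr//; apply: sume_ge0 => i _.
by rewrite lee_fin mulr_ge0// invr_ge0 exprn_ge0.
Qed.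

(** One test function close to a rescaled [F] suffices, and its term in [rho] controls the
    difference. The threshold [e'] is thus uniform in the two measures. *)
Lemma rho_approx (F : state * U -> R) (C e : R) :
  {within cyl Y, continuous F} -> (forall z, cyl Y z -> `|F z| <= C) -> 0 < e ->
  exists2 e' : R, 0 < e' & forall g g' : @prob R m U,
    (rho Y q g g' < e'%:E)%E ->
    `|\int[g]_(z in cyl Y) F z - \int[g']_(z in cyl Y) F z| <= e.
Proof.
move=> cF FC e0; have [_ q1 qdense] := q_test.
pose C' := `|C| + 1; have C'0 : 0 < C' by rewrite ltr_pwDr.
(* Three errors of size [C' * eta]: replacing [F] by the test function under each measure, and
   comparing the two measures on it. *)
pose eta := e / (3 * C'); have eta0 : 0 < eta by rewrite divr_gt0// mulr_gt0.
have [j qj] : exists j, forall z, cyl Y z -> `|C'^-1 * F z - q j z| <= eta.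
  apply: qdense => //.
    by move=> z; apply: cvgM; [exact: cvg_cst|exact: cF].
  move=> z Yz; rewrite normrM gtr0_norm ?invr_gt0// ler_pdivrMl// mulr1.
  by rewrite (le_trans (FC z Yz))// (le_trans (ler_norm _))// lerDl.
exists (2 ^- j.+1 * eta) => [|g g' gg']; first by rewrite mulr_gt0// invr_gt0 exprn_gt0.
have qgg : `|\int[g]_(z in cyl Y) q j z - \int[g']_(z in cyl Y) q j z| <= eta.
  have := le_lt_trans (rho_ge_term g g' j) gg'; rewrite lte_fin.
  by rewrite ltr_pM2l ?invr_gt0 ?exprn_gt0// => /ltW.
have mF : measurable_fun (cyl Y : set (borel (state * U)%type)) (F : borel (state * U)%type -> R).
  exact: (continuous_within_borel_measurable closed_cyl cF).
have mq : measurable_fun (cyl Y : set (borel (state * U)%type)) (q j : borel (state * U)%type -> R).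
  exact: (continuous_within_borel_measurable closed_cyl (@test_continuous j)).
have fin (P : @prob R m U) : (P (cyl Y) < +oo)%E.
  by rewrite (le_lt_trans (probability_le1 _ measurable_cyl))// ltry.
have iF (P : @prob R m U) : P.-integrable (cyl Y) (EFin \o F).
  exact: (bounded_integrable (fin P) measurable_cyl mF FC).
have iq (P : @prob R m U) : P.-integrable (cyl Y) (EFin \o q j).
  exact: (bounded_integrable (fin P) measurable_cyl mq (q1 j)).
have diff (P : @prob R m U) : `|\int[P]_(z in cyl Y) F z - C' * \int[P]_(z in cyl Y) q j z| <= C' * eta.
  have -> : C' * \int[P]_(z in cyl Y) q j z = \int[P]_(z in cyl Y) (C' * q j z).
    by rewrite (RintegralZl C' measurable_cyl (iq P)).
  have iCq := integrable_mull measurable_cyl (iq P) C'.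
  rewrite -(RintegralB measurable_cyl (iF P) iCq).
  apply: (@le_trans _ _ (\int[P]_(z in cyl Y) (C' * eta))).
    apply: Rintegral_le_abs; first exact: measurable_cyl.
    - exact: (integrable_subr measurable_cyl (iF P) iCq).
    - exact: (bounded_integrable (M := `|C' * eta|) (fin P) measurable_cyl).
    move=> z Yz; have := qj z Yz; rewrite -(ler_pM2l C'0); apply: le_trans.
    by rewrite -[X in X * `|_|](gtr0_norm C'0) -normrM mulrBr mulrA divff ?gt_eqF// mul1r.
  rewrite Rintegral_cst; last exact: measurable_cyl.
  have Ce0 : 0 <= C' * eta by exact: ltW (mulr_gt0 C'0 eta0).
  rewrite ler_piMr//.
  have := probability_le1 P measurable_cyl; rewrite -lee_fin fineK//.
  by rewrite ge0_fin_numE//; exact: fin.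
rewrite (_ : e = C' * eta + C' * eta + C' * eta); last first.
  rewrite /eta; field; rewrite gt_eqF//.
have := diff g; have := diff g'; move: qgg.
set I1 := \int[g]_(z in _) q j z; set I2 := \int[g']_(z in _) q j z.
set I3 := \int[g]_(z in _) F z; set I4 := \int[g']_(z in _) F z => q12 d2 d1.
rewrite (_ : I3 - I4 = (I3 - C' * I1) - (I4 - C' * I2) + C' * (I1 - I2)); last by ring.
rewrite (le_trans (ler_normD _ _))// lerD//; last by rewrite normrM gtr0_norm// ler_wpM2l// ltW.
by rewrite (le_trans (ler_normB _ _))// lerD.
Qed.

End test_functions.

Section occupation.
Context {R : realType} {m : nat} {U : pmetricType R}.
Local Notation state := 'rV[R]_m.
Local Notation mu := (@lebesgue_measure R).
Variables (f : state * U -> state) (Y : set state) (B : R).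
Hypotheses (f_cont : continuous f) (f_bound : forall z, Y z.1 -> `|f z| <= B).
Hypothesis Y_closed : closed Y.

(** The laws of [(y t, u t)] at a random time [t] of law [nu], for which time averages along
    trajectories become integrals. *)
Definition occupation (nu : probability (measurableTypeR R) R) : set (@prob R m U) :=
  [set g | exists x u y, traj f Y x u y /\
    forall Q : set (borel (state * U)%type), measurable Q ->
      g Q = nu ((fun t : R => (y t, u t)) @^-1` Q)].

Lemma measurable_traj x u y : traj f Y x u y ->
  measurable_fun setT ((fun t => (y t, u t)) : R -> borel (state * U)%type).
Proof. by move=> [mu_ cy _ _]; exact: (@measurable_pair_borel R state U y u cy mu_). Qed.

Lemma measurable_traj_indic x u y (Q : set (borel (state * U)%type)) : traj f Y x u y ->
  measurable Q -> measurable_fun setT (fun t : R => \1_Q (y t, u t) : R).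
Proof.
move=> T mQ; apply: (@measurableT_comp _ _ _ _ _ _ (\1_Q : borel (state * U)%type -> R) _ _ _ (measurable_traj T)).
exact: measurable_indic.
Qed.

Lemma indic_bound (Q : set (borel (state * U)%type)) z : `|\1_Q z : R| <= 1.
Proof. by rewrite indicE; case: (_ \in _); rewrite /= ?normr1 ?normr0. Qed.

Lemma nu_preimage (nu : probability (measurableTypeR R) R) x u y (Q : set (borel (state * U)%type)) :
  traj f Y x u y -> measurable Q ->
  nu ((fun t : R => (y t, u t)) @^-1` Q) = (\int[nu]_t (\1_Q (y t, u t) : R))%:E.
Proof.
move=> T mQ; have mT := measurable_traj T measurableT mQ; rewrite setTI in mT.
rewrite /Rintegral fineK; last first.
  apply: integrable_fin_num => //.
  exact: (@bounded_prob_integrable _ _ _ nu _ 1 (measurable_traj_indic T mQ) (fun t => indic_bound Q (y t, u t))).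
have := @integral_indic _ _ _ nu setT measurableT _ mT.
by rewrite setIT => <-.
Qed.

Lemma Gamma_occupation T (T0 : 0 < T) :
  (forall x, Y x -> adm_inf f Y x !=set0) -> Gamma f Y T `<=` occupation (unif T0).
Proof.
move=> viable g [x [p [Yx pA gE]]].
have [u [y [Tr E]]] := traj_of_adm_upto f_cont f_bound (ltW T0) viable pA.
exists x, u, y; split => // Q mQ; rewrite gE// (nu_preimage _ Tr mQ).
have mI := measurable_traj_indic Tr mQ.
rewrite (Rintegral_unif T0 mI (fun t => indic_bound Q (y t, u t))) EFinM; congr (_ * _)%E.
have mI' : measurable_fun `[0, T[%classic (fun t => (\1_Q (y t, u t))%:E : \bar R).
  by apply/measurable_EFinP; exact: measurable_funTS.
have eqI : {in `[0, T[%classic, (fun t => (\1_Q (y t, u t))%:E : \bar R) =1 (fun t => (\1_Q (p.2 t, p.1 t))%:E)}.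
  by move=> t; rewrite inE /= in_itv /= => /E[-> ->].
have mp : measurable_fun `[0, T[%classic (fun t => (\1_Q (p.2 t, p.1 t))%:E : \bar R) by exact: (eq_measurable_fun _ eqI mI').
rewrite -integral_itv_bndo_bndc// /Rintegral fineK; last first.
  apply: integrable_fin_num => //.
  apply: (bounded_integrable (M := 1)) => //.
  - by rewrite /= lebesgue_measure_itv /= lte_fin T0 -EFinB ltry.
  - exact: measurable_funTS.
  - by move=> t _; exact: indic_bound.
rewrite -[RHS]integral_itv_bndo_bndc//.
by apply/esym; exact: eq_integral.
Qed.

Lemma Theta_occupation l (l0 : 0 < l) : Theta f Y l `<=` occupation (expo l0).
Proof.
move=> g [x [p [Yx pA gE]]].
have Tr := traj_of_adm pA.
exists x, (p.1 \o pos), (p.2 \o pos); split => // Q mQ; rewrite gE// (nu_preimage _ Tr mQ).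
have mI := measurable_traj_indic Tr mQ.
have [iI ->] := Rintegral_expo l0 mI (fun t => indic_bound Q ((p.2 \o pos) t, (p.1 \o pos) t)).
rewrite EFinM; congr (_ * _)%E.
rewrite /Rintegral fineK; last exact: integrable_fin_num.
by apply: eq_integral => t; rewrite inE /= in_itv /= andbT => t0; rewrite !pos_id.
Qed.

Lemma occupation_integral (nu : probability (measurableTypeR R) R) (g : @prob R m U) x u y (F : state * U -> R) (C : R) :
  traj f Y x u y ->
  (forall Q : set (borel (state * U)%type), measurable Q ->
      g Q = nu ((fun t : R => (y t, u t)) @^-1` Q)) ->
  continuous F -> (forall z, cyl Y z -> `|F z| <= C) ->
  \int[g]_(z in cyl Y) F z =
  \int[nu]_t F (y t, u t).
Proof.
move=> Tr gE cF FC; have mT := measurable_traj Tr; have [_ _ yK _] := Tr.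
have preT : (fun t : R => (y t, u t)) @^-1` cyl Y = setT.
  by apply/seteqP; split => // t _; split => //; exact: yK.
have mF : measurable_fun setT (F : borel (state * U)%type -> R).
  exact: (@continuous_borel_measurable (state * U)%type R F cF).
have mc : measurable_fun setT (fun t => F (y t, u t)) by exact: (measurableT_comp mF mT).
congr fine.
rewrite (@eq_measure_integral _ _ _ _ (pushforward nu (fun t : measurableTypeR R => ((y t, u t) : borel (state * U)%type)))); last first.
  by move=> A mA _; exact: gE.
have := @integral_pushforward _ _ _ _ R (fun t : measurableTypeR R => ((y t, u t) : borel (state * U)%type)) mT nu (cyl Y) (EFin \o F).
rewrite preT => ->//.
- exact/measurable_EFinP.
- apply: (@bounded_prob_integrable _ _ _ nu _ C) => // t; apply: FC.
  by split => //; exact: yK.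
- exact: measurable_cyl.
Qed.

(** Integrals are affine in the mixture, and the error is not amplified because the weights sum to
    1. *)
Lemma co_occupation_le (nu : probability (measurableTypeR R) R) (F1 F2 : state * U -> R) (C e : R) :
  continuous F1 -> continuous F2 ->
  (forall z, cyl Y z -> `|F1 z| <= C) -> (forall z, cyl Y z -> `|F2 z| <= C) ->
  (forall x u y, traj f Y x u y ->
     \int[nu]_t F1 (y t, u t) <= \int[nu]_t F2 (y t, u t) + e) ->
  forall g, co (occupation nu) g ->
  \int[g]_(z in cyl Y) F1 z <= \int[g]_(z in cyl Y) F2 z + e.
Proof.
move=> c1 c2 F1C F2C H g [n [a [gs [a0 a1 occ gE]]]].
have fin (P : @prob R m U) : (P (cyl Y) < +oo)%E.
  by rewrite (le_lt_trans (probability_le1 _ (measurable_cyl Y_closed)))// ltry.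
have mF (F : state * U -> R) : continuous F -> measurable_fun (cyl Y : set (borel (state * U)%type)) (F : borel (state * U)%type -> R).
  by move=> cF; apply: measurable_funTS; exact: (@continuous_borel_measurable (state * U)%type R F cF).
rewrite (Rintegral_mixture a0 gE (measurable_cyl Y_closed) (mF _ c1) F1C (fin g) (fun i => fin (gs i))).
rewrite (Rintegral_mixture a0 gE (measurable_cyl Y_closed) (mF _ c2) F2C (fin g) (fun i => fin (gs i))).
rewrite -[e]mul1r -a1 mulr_suml -big_split; apply: ler_sum => i _.
rewrite /= -mulrDr ler_wpM2l//.
have [x [u [y [Tr gsE]]]] := occ i.
rewrite (occupation_integral Tr gsE c1 F1C) (occupation_integral Tr gsE c2 F2C).
exact: H Tr.
Qed.

End occupation.

Lemma compact_continuous_bound (R : realType) (T : topologicalType) (A : set T) (F : T -> R) :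
  compact A -> {within A, continuous F} -> exists C : R, forall z, A z -> `|F z| <= C.
Proof.
move=> cA cF; have := compact_bounded (continuous_compact cF cA).
move=> [C [_ H]]; exists (C + 1) => z Az; apply: (H (C + 1)); first by rewrite ltrDl.
by exists z.
Qed.

(** * The upper bound by the primal problem *)

Section upper_bound.
Context {R : realType} {m : nat} {U : pmetricType R}.
Local Notation state := 'rV[R]_m.
Variables (f : state * U -> state) (Y K : set state) (k : state * U -> R).
Variables (q : nat -> state * U -> R) (B M L kappa rad : R).
Variable nu : probability (measurableTypeR R) R.
Hypotheses (U_compact : compact [set: U]) (Y_compact : compact Y).
Hypotheses (f_cont : continuous f) (k_cont : continuous k).
Hypothesis f_bound : forall z, K z.1 -> `|f z| <= B.
Hypothesis k_bound : forall z, K z.1 -> `|k z| <= M.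
Hypothesis f_lip : forall u x x', `|f (x, u) - f (x', u)| <= L * `|x - x'|.
Hypotheses (L0 : 0 <= L) (slow_nu : slow kappa nu) (q_test : test_sequence Y q).
Hypotheses (rad0 : 0 < rad) (YK : forall y x, Y y -> `|x - y| <= 2 * rad -> K x).
Hypothesis value_lip : lipschitz_ext K (value f K k nu).
Hypothesis approx : forall g, W f Y g -> forall e : R, 0 < e ->
  exists kappa' nu' g', [/\ kappa' <= e, slow kappa' nu',
    co (occupation f Y nu') g' & (rho Y q g g' < e%:E)%E].

Let YsubK x : Y x -> K x.
Proof. by move=> Yx; apply: (YK Yx); rewrite subrr normr0 mulr_ge0// ltW. Qed.

Let Y_closed : closed Y.
Proof. by apply: compact_closed => //; exact: norm_hausdorff. Qed.

Let cyl_compact : compact (cyl Y : set (state * U)).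
Proof. exact: compact_setX. Qed.

Lemma real_value : exists v Lv, is_lip Lv v /\ forall x, K x -> value f K k nu x = (v x)%:E.
Proof.
have [Lv vL] := value_lip.
(* Already at [x = x'] the Lipschitz bound reads [|v x - v x| <= 0], which fails for an infinite
   value. *)
have vfin x : K x -> value f K k nu x \is a fin_num.
  move=> Kx; have := vL x x Kx Kx; rewrite subrr normr0 mulr0.
  by case: (value f K k nu x).
have [K0|/set0P K0] := eqVneq K set0.
  exists (fun=> 0), 0; split; first exact: lip_cst.
  by move=> x; rewrite K0.
have [|v [v_lip vE]] := @lipschitz_extension R state K (fun x => fine (value f K k nu x)) Lv K0.
  move=> x x' Kx Kx'; rewrite -lee_fin; apply: le_trans (vL x x' Kx Kx').
  by rewrite -{2}(fineK (vfin _ Kx)) -{2}(fineK (vfin _ Kx')).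
exists v, `|Lv|; split => // x Kx.
by rewrite vE// fineK// vfin.
Qed.

(** Of the coefficient [3 + 4 * M], two units come from the weak approximation of [g] on [phi] and
    on [k], one from [phi] against [v], [2 * M] from the shifts up to [N] and [2 * M] from the tail
    beyond. *)
Lemma value_integral_le (v phi : state -> R) (eps : R) g :
  (forall x, K x -> value f K k nu x = (v x)%:E) -> continuous phi ->
  (forall x, `|phi x - v x| <= eps) -> 0 < eps -> 0 <= M -> W f Y g ->
  \int[g]_(z in cyl Y) phi z.1 <= \int[g]_(z in cyl Y) k z + eps * (3 + 4 * M).
Proof.
move=> vE phi_cont phi_v eps0 M0 Wg.
have cphi : continuous (fun z : state * U => phi z.1).
  by move=> z; apply: (@continuous_comp _ _ _ fst phi z); [exact: cvg_fst|exact: phi_cont].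
have [C1_ C1b] := compact_continuous_bound cyl_compact (continuous_subspaceT cphi).
pose C := Num.max C1_ M.
have phiC (z : state * U) : cyl Y z -> `|phi z.1| <= C by move=> Yz; rewrite le_max; apply/orP; left; exact: (@C1b z Yz).
have kC (z : state * U) : cyl Y z -> `|k z| <= C.
  by move=> [Yz _]; rewrite le_max k_bound ?orbT//; exact: YsubK.
have [N N0 tailN] := prob_tail_small nu eps0.
have [e1 e10 H1] := rho_approx Y_closed q_test (continuous_subspaceT cphi) phiC eps0.
have [e2 e20 H2] := rho_approx Y_closed q_test (continuous_subspaceT k_cont) kC eps0.
(* The truncation [N] is dictated by [nu] alone; only then is [nu'] requested, so slow that
   [kappa' * N <= eps]. *)
pose e := Num.min e1 (Num.min e2 (eps / (N + 1))).
have N1 : 0 < N + 1 by rewrite ltr_wpDl.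
have e0 : 0 < e by rewrite !lt_min e10 e20 divr_gt0.
have [kappa' [nu' [g' [ke slow_nu' cog' rg]]]] := approx Wg e0.
have {}H1 := H1 _ _ (lt_le_trans rg (_ : (e%:E <= e1%:E)%E)).
have {}H1 : `|\int[g]_(z in cyl Y) phi z.1 - \int[g']_(z in cyl Y) phi z.1| <= eps.
  by apply: H1; rewrite lee_fin ge_min lexx.
have {}H2 : `|\int[g]_(z in cyl Y) k z - \int[g']_(z in cyl Y) k z| <= eps.
  by apply: H2; apply: (lt_le_trans rg); rewrite lee_fin !ge_min lexx orbT.
have kN : kappa' * N <= eps.
  apply: (@le_trans _ _ (eps / (N + 1) * N)).
    by rewrite ler_wpM2r// (le_trans ke)// !ge_min lexx !orbT.
  by rewrite -mulrA ger_pMr// mulrC ler_pdivrMr// mul1r lerDl.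
have [nu0 _] := slow_nu; have [nu'0 _] := slow_nu'.
suff H3 : \int[g']_(z in cyl Y) phi z.1 <= \int[g']_(z in cyl Y) k z + (eps + (2 * M * eps + 2 * M * eps)).
  by move: H1 H2 H3; rewrite !ler_norml => /andP[_ h1] /andP[h2 _]; lra.
apply: (co_occupation_le Y_closed cphi k_cont phiC kC _ cog') => x u y Tr.
have TrK : traj f K x u y.
  by have [mu_ cy yK yE] := Tr; split => // t; exact: YsubK.
have mc := measurable_cost k_cont TrK.
have cM := cost_bound k_bound TrK.
have [mu_ cy yY yE] := Tr.
have := slow_average_le slow_nu' nu0 mc cM N0.
set I2 := \int[nu']_t k (y t, u t) => Avg.
have mphi : measurable_fun setT (fun t => phi (y t)).
  apply: continuous_measurable_fun => t.
  exact: (@continuous_comp _ _ _ y phi t (@cy t) (@phi_cont _)).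
have mav := measurable_average nu mc cM.
have iav : nu'.-integrable setT (EFin \o (fun t : R => \int[nu]_s k (y (t + s), u (t + s)))).
  exact: (@bounded_prob_integrable _ _ _ nu' _ M mav (average_bound nu mc cM)).
have ieps : nu'.-integrable setT (EFin \o (fun=> eps)).
  exact: (@bounded_prob_integrable _ _ _ nu' _ `|eps|).
have step : \int[nu']_t phi (y t) <= \int[nu']_(t in [set: R]) (\int[nu]_s k (y (t + s), u (t + s)) + eps).
  apply: (@le_Rintegral_nonneg_support _ _ nu'0 _ _ (C + M + eps)) => //.
  - move=> t; rewrite (le_trans (phiC (y t, u t) (conj (yY t) I)))//.
    by rewrite -addrA lerDl addr_ge0// ltW.
  - exact: measurable_funD.
  - move=> t; rewrite (le_trans (ler_normD _ _))//.
    rewrite (gtr0_norm eps0) lerD2r (le_trans (average_bound nu mc cM t))// lerDr.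
    exact: (le_trans (normr_ge0 _) (phiC (y t, u t) (conj (yY t) I))).
  - move=> t t0; have Ts := traj_shift f_cont f_bound TrK t0.
    have := value_le k nu Ts; rewrite vE; last by apply: YsubK.
    rewrite lee_fin => h; under eq_Rintegral do rewrite addrC.
    by have := phi_v (y t); rewrite ler_norml => /andP[_ h']; lra.
apply: (le_trans step); rewrite RintegralD// prob_Rintegral_cst.
move: Avg; rewrite ler_norml => /andP[_ Avg].
have h1 : 2 * M * kappa' * N <= 2 * M * eps.
  by rewrite -[2 * M * kappa' * N]mulrA ler_wpM2l// mulr_ge0.
have h2 : 2 * M * fine (nu `]N, +oo[%classic) <= 2 * M * eps.
  by rewrite ler_wpM2l// ?mulr_ge0// ltW.
move: Avg h1 h2; set I1 := \int[nu']_(t in _) _; set tl := fine _ => Avg h1 h2.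
lra.
Qed.

Lemma value_le_Omega y0 (p : @prob R m U * @fmeas R m U) : Y y0 -> Omega f Y y0 p ->
  (value f K k nu y0 <=
    (\int[p.1]_(z in cyl Y) k z + 2 * M * kappa * fine (p.2 (cyl Y)))%R%:E)%E.
Proof.
case: p => g xi /= Yy0 [Wg xiY Om].
have [v [Lv [v_lip vE]]] := real_value.
rewrite vE ?lee_fin; last exact: YsubK.
have M0 : 0 <= M by apply: (le_trans (normr_ge0 _) (k_bound (z := (y0, point)) (YsubK Yy0))).
have mcyl := measurable_cyl Y_closed (U := U).
have xi_fin : (xi (cyl Y) < +oo)%E by rewrite -ge0_fin_numE// fin_num_measure.
have g_fin : (g (cyl Y) < +oo)%E.
  by rewrite (le_lt_trans (probability_le1 _ mcyl))// ltry.
have g1 : fine (g (cyl Y)) = 1.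
  have [gY _] := Wg; have := probability_setC g mcyl; rewrite [X in X = _]gY.
  rewrite -{1}(fineK (_ : g (cyl Y) \is a fin_num)) ?ge0_fin_numE//.
  by rewrite -EFinB => -[] /eqP; rewrite eq_sym subr_eq0 => /eqP <-.
set XI := fine (xi (cyl Y)); have XI0 : 0 <= XI by exact: fine_ge0.
(* The coefficient of [eps] adds 1 for [phi] against [v] at [y0], the [3 + 4 * M] of
   [value_integral_le], and the mass [XI] for the error in the drift. *)
suff main (eps : R) : 0 < eps ->
    v y0 <= \int[g]_(z in cyl Y) k z + 2 * M * kappa * XI + eps * (4 + 4 * M + XI).
  apply/ler_addgt0Pr => e e0.
  have D0 : 0 < 4 + 4 * M + XI by rewrite ltr_wpDr// ltr_wpDr// mulr_ge0.
  have := main (e / (4 + 4 * M + XI)) (divr_gt0 e0 D0).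
  by rewrite divfK// gt_eqF.
move=> eps0.
have [phi [phi_C1 phi_v phi_drift]] := smooth_value f_cont k_cont f_bound k_bound f_lip L0 slow_nu v_lip vE rad0 eps0 YK.
have phi_cont : continuous phi.
  by move=> x; have [d _] := phi_C1; exact: differentiable_continuous (d x).
have H1 := value_integral_le vE phi_cont phi_v eps0 M0 Wg.
have cphi : continuous (fun z : state * U => phi z.1).
  by move=> z; apply: (@continuous_comp _ _ _ fst phi z); [exact: cvg_fst|exact: phi_cont].
have cdrift := continuous_drift phi_C1 f_cont.
have [Cp phiC] := compact_continuous_bound cyl_compact (continuous_subspaceT cphi).
have [Cd driftC] := compact_continuous_bound cyl_compact (continuous_subspaceT cdrift).
have mF (F : state * U -> R) : continuous F -> measurable_fun (cyl Y : set (borel (state * U)%type)) (F : borel (state * U)%type -> R).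
  by move=> cF; apply: measurable_funTS; exact: (@continuous_borel_measurable (state * U)%type R F cF).
have iphi : g.-integrable (cyl Y) (EFin \o (fun z : state * U => phi z.1)) := bounded_integrable g_fin mcyl (mF _ cphi) phiC.
have idrift : xi.-integrable (cyl Y) (EFin \o drift f phi) := bounded_integrable xi_fin mcyl (mF _ cdrift) driftC.
have icst (P : {measure set (borel (state * U)%type) -> \bar R}) (a : R) : (P (cyl Y) < +oo)%E -> P.-integrable (cyl Y) (EFin \o (fun=> a)).
  by move=> PY; exact: (bounded_integrable (M := `|a|) PY mcyl).
have E : phi y0 - \int[g]_(z in cyl Y) phi z.1 + \int[xi]_(z in cyl Y) drift f phi z = 0.
  have := Om phi phi_C1.
  have -> : (\int[g]_(z in cyl Y) (phi y0 - phi z.1)%:E)%E = (phi y0 - \int[g]_(z in cyl Y) phi z.1)%:E.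
    rewrite -[LHS]fineK; last first.
      by apply: integrable_fin_num => //; apply: (integrable_subr mcyl (icst g (phi y0) g_fin) iphi).
    congr EFin; rewrite -[LHS]/(\int[g]_(z in cyl Y) (phi y0 - phi z.1)).
    rewrite (RintegralB mcyl (icst g (phi y0) g_fin) iphi) Rintegral_cst//.
    by rewrite [X in _ * X - _]g1 mulr1.
  have -> : (\int[xi]_(z in cyl Y) (drift f phi z)%:E)%E = (\int[xi]_(z in cyl Y) drift f phi z)%:E.
    by rewrite /Rintegral fineK//; exact: integrable_fin_num.
  by rewrite -EFinD => -[].
have low : - (2 * M * kappa + eps) * XI <= \int[xi]_(z in cyl Y) drift f phi z.
  have <- : \int[xi]_(z in cyl Y) (- (2 * M * kappa + eps)) = - (2 * M * kappa + eps) * XI.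
    by rewrite Rintegral_cst.
  apply: le_Rintegral => //; first exact: icst.
  by move=> [x u] [Yx _]; exact: phi_drift.
have := phi_v y0; rewrite ler_norml => /andP[h _].
move: E H1 low; set I1 := \int[g]_(z in _) phi z.1; set I2 := \int[xi]_(z in _) _; set I3 := \int[g]_(z in _) k z.
move=> E H1 low.
have -> : eps * (4 + 4 * M + XI) = eps + eps * (3 + 4 * M) + eps * XI by ring.
have : - (2 * M * kappa + eps) * XI = - (2 * M * kappa * XI) - eps * XI by ring.
lra.
Qed.

End upper_bound.

(** * Limits inferior and superior along a filter *)

Section limits.
Context {R : realType} (F : set_system R) {FF : ProperFilter F} (v : R -> \bar R).
Local Open Scope ereal_scope.

Lemma limf_einf_le_esup : limf_einf v F <= limf_esup v F.
Proof.
rewrite limf_einfE limf_esupE; apply: ge_ereal_sup => _ [A FA <-].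
apply: le_ereal_inf_tmp => _ [B FB <-].
have [T [AT BT]] : (A `&` B) !=set0 := filter_ex (filterI FA FB).
apply: (@le_trans _ _ (v T)).
  by apply: ereal_inf_lbound; exists T.
by apply: ereal_sup_ubound; exists T.
Qed.

Lemma near_limf_einf_gt (a : R) : a%:E < limf_einf v F -> \forall T \near F, a%:E < v T.
Proof.
rewrite limf_einfE => /ereal_sup_gt[_ [A FA <-] aA].
apply: filterS FA => T AT; apply: (lt_le_trans aA).
by apply: ereal_inf_lbound; exists T.
Qed.

Lemma near_limf_esup_lt (a : R) : limf_esup v F < a%:E -> \forall T \near F, v T < a%:E.
Proof.
rewrite limf_esupE => /ereal_inf_lt[_ [A FA <-] aA].
apply: filterS FA => T AT; apply: le_lt_trans aA.
by apply: ereal_sup_ubound; exists T.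
Qed.

Lemma limf_esup_le (x : \bar R) :
  (forall e : R, (0 < e)%R -> \forall T \near F, v T <= x + e%:E) -> limf_esup v F <= x.
Proof.
move=> H; apply/lee_addgt0Pr => e e0; rewrite limf_esupE.
apply: ge_ereal_inf; exists (ereal_sup (v @` [set T | v T <= x + e%:E])).
  by exists [set T | v T <= x + e%:E] => //; exact: H.
by apply: ge_ereal_sup => _ [T vT <-].
Qed.

Lemma limf_einf_ge (c : R) :
  (forall e : R, (0 < e)%R -> \forall T \near F, (c - e)%:E <= v T) -> c%:E <= limf_einf v F.
Proof.
move=> H; apply/lee_addgt0Pr => e e0; rewrite -leeBlDr// -EFinB limf_einfE.
apply: le_ereal_sup_tmp; exists (ereal_inf (v @` [set T | (c - e)%:E <= v T])).
  by exists [set T | (c - e)%:E <= v T] => //; exact: H.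
by apply: le_ereal_inf_tmp => _ [T vT <-].
Qed.

Lemma limf_cvg (l : R) : limf_einf v F = l%:E -> limf_esup v F = l%:E ->
  v T @[T --> F] --> l%:E.
Proof.
move=> vi vs.
have near_l (e : R) : (0 < e)%R -> \forall T \near F, (l - e)%:E < v T /\ v T < (l + e)%:E.
  move=> e0; apply: filterI.
    by apply: near_limf_einf_gt; rewrite vi lte_fin ltrBlDr ltrDl.
  by apply: near_limf_esup_lt; rewrite vs lte_fin ltrDl.
apply/fine_cvgP; split.
  apply: filterS (near_l 1%R ltr01) => T []; case: (v T) => //.
apply/cvgrPdist_lt => e e0; apply: filterS (near_l e e0) => T /= [].
case: (v T) => [r| |]//=; rewrite !lte_fin => h1 h2.
by rewrite distrC ltr_norml; apply/andP; split; lra.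
Qed.

End limits.

(** * The enlarged constraint sets *)

Section enlarged.
Context {R : realType} {m : nat} {U : pmetricType R}.
Local Notation state := 'rV[R]_m.

Lemma norm_le_enorm (z : state) : `|z| <= enorm z.
Proof.
apply: row_norm_le; first exact: sqrtr_ge0.
move=> i; rewrite /enorm -sqrtr_sqr ler_sqrt ?sumr_ge0//; last by move=> j _; exact: sqr_ge0.
by rewrite (bigD1 i)//= lerDl sumr_ge0// => j _; exact: sqr_ge0.
Qed.

(** The factor [m + 1] replaces the sharp [sqrt m]: any margin will do, and it is nonzero also when
    [m = 0]. *)
Lemma enorm_le (z : state) (b : R) : 0 <= b -> `|z| <= b / m.+1%:R -> enorm z <= b.
Proof.
move=> b0 zb; rewrite /enorm -(ger0_norm b0) -sqrtr_sqr ler_sqrt ?sqr_ge0//.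
have zi i : z ord0 i ^+ 2 <= (b / m.+1%:R) ^+ 2.
  rewrite -(real_normK (num_real (z ord0 i))) lerXn2r ?nnegrE ?divr_ge0//.
  exact: (le_trans (row_coord_le _ _)).
apply: (@le_trans _ _ (\sum_(i < m) (b / m.+1%:R) ^+ 2)); first exact: ler_sum.
rewrite sumr_const card_ord -[_ *+ m]mulr_natl expr_div_n mulrA ler_pdivrMr ?exprn_gt0//.
rewrite mulrC ler_wpM2l ?sqr_ge0// -natrX ler_nat.
by rewrite (leq_trans (leqnSn m))// leq_pmulr.
Qed.

Lemma enlarge_margin (Y : set state) (delta : R) : 0 < delta ->
  forall y x, Y y -> `|x - y| <= 2 * (delta / (2 * m.+1%:R)) -> enlarge Y delta x.
Proof.
move=> d0 y x Yy xy; exists y => //; exists (x - y); last by rewrite addrC subrK.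
apply: enorm_le; first exact: ltW.
by apply: (le_trans xy); rewrite le_eqVlt; apply/orP; left; apply/eqP; field.
Qed.

Lemma cyl_bound (V : normedModType R) (K : set state) (F : state * U -> V) :
  compact [set: U] -> compact K -> continuous F ->
  exists C, forall z, K z.1 -> `|F z| <= C.
Proof.
move=> cU cK cF.
have cN : continuous (fun z => `|F z|).
  by move=> z; apply: (@continuous_comp _ _ _ F (fun x => `|x|) z); [exact: cF|exact: norm_continuous].
have [C H] := compact_continuous_bound (compact_setX cK cU) (continuous_subspaceT cN).
by exists C => z Kz; rewrite -normr_id; exact: H.
Qed.

Lemma enlarge_bound (V : normedModType R) (Y : set state) (delta : R) (F : state * U -> V) :
  compact [set: U] -> compact Y -> continuous F ->
  exists C, forall z, enlarge Y delta z.1 -> `|F z| <= C.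
Proof.
move=> cU cY cF.
have [b [_ Yb]] := compact_bounded cY.
(* A closed max-norm ball containing the enlarged set provides the compactness; [b + 1] appears
   because only numbers beyond [b] are known to bound [Y]. *)
pose K : set state := [set x | `|x| <= b + 1 + delta].
have cK : compact K.
  apply: bounded_closed_compact.
    exists (b + 1 + delta); split; first exact: num_real.
    by move=> c bc x /= xb; rewrite (le_trans xb)// ltW.
  apply: (closed_comp (f := fun x : state => `|x|) _ (@closed_le R _)) => x _.
  exact: norm_continuous.
have [C H] := cyl_bound cU cK cF.
exists C => z [y Yy [d /= dd zE]]; apply: H.
rewrite /K /= -zE (le_trans (ler_normD _ _))// lerD//.
  by apply: (Yb (b + 1)) => //; rewrite ltrDl.
exact: le_trans (norm_le_enorm d) dd.
Qed.

End enlarged.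

Lemma near_lt_of_cvg0 {R : realType} {T : Type} (G : set_system T) {FG : ProperFilter G}
    (v : T -> \bar R) (e : R) : 0 < e -> v x @[x --> G] --> 0%E ->
  \forall x \near G, (v x < e%:E)%E.
Proof.
move=> e0 /fine_cvgP[v_fin /cvgrPdist_lt/(_ e e0) v_e].
near=> x.
have fx : v x \is a fin_num by near: x.
rewrite -(fineK fx) lte_fin; apply: le_lt_trans (ler_norm _) _.
by rewrite -normrN -sub0r; near: x.
Unshelve. all: by end_near. Qed.

Lemma lee_of_dist {R : realType} (a b : \bar R) (e : R) :
  (`|a - b| < e%:E -> a <= b + e%:E)%E.
Proof.
case: a b => [a| |] [b| |]//=; rewrite ?leNye ?leey//.
rewrite lte_fin -EFinD lee_fin => /ltW; rewrite ler_norml => /andP[_]; lra.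
Qed.

(** * The limit argument, common to both problems *)

Section long_run.
Context {R : realType} {m : nat} {U : pmetricType R}.
Local Notation state := 'rV[R]_m.
Variables (f : state * U -> state) (k : state * U -> R) (Y : set state).
Variables (q : nat -> state * U -> R) (y0 : state) (delta0 : R).
Hypotheses (U_compact : compact [set: U]) (Y_compact : compact Y).
Hypotheses (f_cont : continuous f) (k_cont : continuous k) (f_lip : lipschitz_in_state f).
Hypotheses (viable : forall x, Y x -> adm_inf f Y x !=set0) (Yy0 : Y y0).
Hypotheses (q_test : test_sequence Y q) (delta0_gt0 : 0 < delta0).

(* [F] is the filter of large horizons [T] or of small discount rates
   [lambda], and [kappa] is [1 / T] or [lambda]. *)
Variables (F : set_system R) (kappa : R -> R).
Context {FF : ProperFilter F}.
Variables (val : set state -> R -> state -> \bar R) (occ : R -> set (@prob R m U)).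
Hypothesis kappa_small : forall e : R, 0 < e ->
  \forall T \near F, 0 < T /\ 0 <= kappa T <= e.
Hypothesis averaging : forall T : R, 0 < T -> exists nu : probability (measurableTypeR R) R,
  [/\ slow (kappa T) nu, occ T `<=` occupation f Y nu &
      forall (K : set state) (B M : R), (forall z, K z.1 -> `|f z| <= B) ->
        (forall z, K z.1 -> `|k z| <= M) -> (forall x, K x -> adm_inf f K x !=set0) ->
        forall x, val K T x = value f K k nu x].

Let v T : \bar R := val Y T y0.

(** Keeps the common limit finite, so that convergence is to a real number. *)
Lemma near_val_bound : exists M : R, \forall T \near F, (- M%:E <= v T <= M%:E)%E.
Proof.
have [B fB] := cyl_bound U_compact Y_compact f_cont.
have [M kM] := cyl_bound U_compact Y_compact k_cont.
exists M; apply: filterS (kappa_small ltr01) => T [T0 _].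
have [nu [_ _ /(_ Y B M fB kM viable) vE]] := averaging T0.
rewrite /v vE (value_ge f k_cont kM)/=.
have [p /traj_of_adm Tp] := viable Yy0.
by have := value_le_bound k_cont kM nu Tp.
Qed.

(** The bound [E] on [eta] depends on the dual triplet, so the triplet is fixed while [kappa] tends
    to 0, and the supremum is taken last. *)
Lemma dstar_le_liminf : (dstar f k Y y0 <= limf_einf v F)%E.
Proof.
have [B fB] := cyl_bound U_compact Y_compact f_cont.
have [M kM] := cyl_bound U_compact Y_compact k_cont.
apply: ge_ereal_sup => _ [c [psi [eta feas]] <-].
have [_ [eta_diff _] _] := feas.
have [E etaE] : exists E, forall z, Y z -> `|eta z| <= E.
  apply: (compact_continuous_bound Y_compact); apply: continuous_subspaceT => x.
  exact: differentiable_continuous.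
apply: limf_einf_ge => e e0.
have EM0 : 0 <= 2 * (E + M).
  have [p [_ _ _]] := viable Yy0.
  by rewrite mulr_ge0// addr_ge0//; [exact: le_trans (etaE _ Yy0)|exact: le_trans (kM (y0, point) Yy0)].
have d0 : 0 < e / (2 * (E + M) + 1) by rewrite divr_gt0// ltr_wpDl.
apply: filterS (kappa_small d0) => T [T0 /andP[kT0 kTe]].
have [nu [nu_slow _ /(_ Y B M fB kM viable) vE]] := averaging T0.
rewrite /v vE; apply: le_trans (dual_value_bound f_cont k_cont fB kM nu_slow feas etaE).
rewrite lee_fin lerD2l lerN2.
move: kTe; rewrite ler_pdivlMr ?ltr_wpDl// => kTe.
by apply: le_trans kTe; rewrite mulrC ler_wpM2l// lerDl.
Qed.

Lemma limsup_le_kstar : A1 f Y delta0 ->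
  (forall delta T : R, 0 < delta < delta0 -> 0 < T ->
     lipschitz_ext (enlarge Y delta) (val (enlarge Y delta) T)) ->
  `|val Y p.1 y0 - val (enlarge Y p.2) p.1 y0|%E
     @[p --> filter_prod F (at_right (0 : R))] --> 0%E ->
  rhoH Y q (co (occ T)) (W f Y) @[T --> F] --> 0%E ->
  (limf_esup v F <= kstar f k Y y0)%E.
Proof.
move=> viable_enlarge val_lip val_cvg rho_cvg.
have [M0 kM0] := cyl_bound U_compact Y_compact k_cont.
apply: le_ereal_inf_tmp => _ [p Op <-]; apply: limf_esup_le => e e0.
have e20 : 0 < e / 2 by rewrite divr_gt0.
(* The joint limit provides a rectangle: [delta] is chosen once in [D], and afterwards only the
   parameter in [A] moves. *)
have [[A D] /= [FA D0] near_val] := near_lt_of_cvg0 e20 val_cvg.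
have [delta [Dd dd]] : exists delta : R, D delta /\ 0 < delta < delta0.
  have : \forall d \near at_right (0 : R), D d /\ 0 < d < delta0.
    near=> d; split; first by near: d.
    by apply/andP; split; near: d; [exact: nbhs_right_gt|exact: nbhs_right_lt].
  by move=> /filter_ex.
have delta_gt0 : 0 < delta by case/andP: dd.
pose K := enlarge Y delta.
have [B fB] := enlarge_bound delta U_compact Y_compact f_cont.
have [M kM] := enlarge_bound delta U_compact Y_compact k_cont.
have [L0 f_lip0] := f_lip.
have f_lipL u x x' : `|f (x, u) - f (x', u)| <= `|L0| * `|x - x'|.
  by apply: (le_trans (f_lip0 u x x')); rewrite ler_wpM2r// ler_norm.
have rad0 : 0 < delta / (2 * m.+1%:R) by rewrite divr_gt0// mulr_gt0.
have YK := @enlarge_margin R m Y delta delta_gt0.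
have approx g : W f Y g -> forall e' : R, 0 < e' ->
    exists (kappa' : R) (nu' : probability (measurableTypeR R) R) (g' : @prob R m U),
      [/\ kappa' <= e', slow kappa' nu', co (occupation f Y nu') g' & (rho Y q g g' < e'%:E)%E].
  move=> Wg e' e'0.
  (* This [T] only serves to approximate [g]; it is unrelated to the parameter of the value being
     bounded and can be taken as far along [F] as [e'] requires. *)
  have [T [[T0 /andP[_ kTe]] rT]] := filter_ex (filterI (kappa_small e'0) (near_lt_of_cvg0 e'0 rho_cvg)).
  have [nu [nu_slow occ_nu _]] := averaging T0.
  have /ereal_inf_lt[_ [g' [n [a [gs [a0 a1 gsT g'E]]]] <-] gg'] :
      (rho_set Y q g (co (occ T)) < e'%:E)%E.
    apply: le_lt_trans rT; rewrite /rhoH le_max; apply/orP; right.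
    by apply: ereal_sup_ubound; exists g.
  exists (kappa T), nu, g'; split => //.
  by exists n, a, gs; split => // i; exact: occ_nu.
pose C := 2 * `|M| * fine (p.2 (cyl Y)).
have C0 : 0 <= C by rewrite !mulr_ge0// fine_ge0.
(* Half of [e] went to the difference between [Y] and its enlargement; this threshold makes the term
   in the mass of [p.2] at most the other half. *)
have d0 : 0 < e / 2 / (C + 1) by rewrite divr_gt0// ltr_wpDl.
apply: filterS (filterI FA (kappa_small d0)) => T [AT [T0 /andP[kT0 kTe]]].
have [nu [nu_slow _ nu_val]] := averaging T0.
have vK := nu_val K B M fB kM (viable_enlarge delta dd).
have lipK : lipschitz_ext K (value f K k nu).
  have [l H] := val_lip delta T dd T0.
  by exists l => x x' Kx Kx'; rewrite -!vK; exact: H.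
have H := value_le_Omega U_compact Y_compact f_cont k_cont fB kM f_lipL (normr_ge0 L0)
  nu_slow q_test rad0 YK lipK approx Yy0 Op.
have := lee_of_dist (near_val (T, delta) (conj AT Dd)); rewrite /= -/K vK => vTK.
apply: (le_trans vTK); apply: le_trans (leeD2r _ H) _.
have Y_closed : closed Y by apply: compact_closed => //; exact: norm_hausdorff.
have intE : (\int[p.1]_(z in cyl Y) (k z)%:E)%E = (\int[p.1]_(z in cyl Y) k z)%:E.
  rewrite /Rintegral fineK//; apply: integrable_fin_num; first exact: measurable_cyl.
  apply: (bounded_integrable (M := M0)) => //.
  - by rewrite (le_lt_trans (probability_le1 _ (measurable_cyl Y_closed (U := U))))// ltry.
  - exact: measurable_cyl.
  - by apply: measurable_funTS; exact: (@continuous_borel_measurable (state * U)%type R k k_cont).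
  - by move=> z [Yz _]; exact: kM0.
rewrite intE -!EFinD lee_fin -addrA lerD2l.
have : 2 * M * kappa T * fine (p.2 (cyl Y)) <= C * kappa T.
  rewrite /C mulrAC ler_wpM2r// ler_wpM2r ?fine_ge0//.
  by rewrite ler_wpM2l// ler_norm.
move: kTe; rewrite ler_pdivlMr ?ltr_wpDl//; lra.
Unshelve. all: by end_near. Qed.

Lemma long_run_limit :
  (dstar f k Y y0 <= limf_einf v F)%E -> (limf_esup v F <= kstar f k Y y0)%E ->
  dstar f k Y y0 = kstar f k Y y0 ->
  [/\ dstar f k Y y0 = limf_einf v F, limf_einf v F = limf_esup v F,
      limf_esup v F = kstar f k Y y0, dstar f k Y y0 \is a fin_num & v T @[T --> F] --> dstar f k Y y0].
Proof.
move=> dv vk dk.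
have vv := @limf_einf_le_esup R F FF v.
have dvE : dstar f k Y y0 = limf_einf v F.
  by apply/le_anti/andP; split=> //; rewrite dk; exact: le_trans vv vk.
have vkE : limf_esup v F = kstar f k Y y0.
  by apply/le_anti/andP; split=> //; rewrite -dk dvE.
have vvE : limf_einf v F = limf_esup v F by rewrite -dvE vkE dk.
have fin : dstar f k Y y0 \is a fin_num.
  have [M vM] := near_val_bound.
  rewrite fin_numElt; apply/andP; split.
    rewrite dvE; apply: (@lt_le_trans _ _ (- M)%:E); first exact: ltNyr.
    by apply: limf_einf_ge => e e0; apply: filterS vM => T /andP[+ _]; apply: le_trans; rewrite -EFinN lee_fin lerBlDr lerDl ltW.
  rewrite dk -vkE; apply: (@le_lt_trans _ _ M%:E); last exact: ltry.
  by apply: limf_esup_le => e e0; apply: filterS vM => T /andP[_ vT]; rewrite (le_trans vT)// -EFinD lee_fin lerDl ltW.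
split => //; rewrite -(fineK fin); apply: limf_cvg; rewrite fineK//.
by rewrite -vvE.
Qed.

End long_run.

(** * The two instances: large horizon and small discount rate *)

Section horizon_and_discount.
Context {R : realType} {m : nat} {U : pmetricType R}.
Variables (f : 'rV[R]_m * U -> 'rV[R]_m) (k : 'rV[R]_m * U -> R) (Y : set 'rV[R]_m).
Hypotheses (f_cont : continuous f) (k_cont : continuous k).

Lemma near_inv_small (e : R) : 0 < e -> \forall T \near +oo, 0 < T /\ 0 <= T^-1 <= e.
Proof.
move=> e0; near=> T.
have T0 : 0 < T by near: T; exact: nbhs_pinfty_gt.
have eT : e^-1 <= T by near: T; apply: nbhs_pinfty_ge; exact: num_real.
by split=> //; rewrite invr_ge0 ltW//= -[leRHS]invrK lef_pV2 ?posrE ?invr_gt0.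
Unshelve. all: by end_near. Qed.

Lemma near_right0_small (e : R) : 0 < e -> \forall l \near at_right 0, 0 < l /\ 0 <= l <= e.
Proof.
move=> e0; near=> l.
have l0 : 0 < l by near: l; exact: nbhs_right_gt.
by split=> //; rewrite ltW//=; near: l; exact: nbhs_right_le.
Unshelve. all: by end_near. Qed.

Lemma horizon_averaging (B : R) : (forall z, Y z.1 -> `|f z| <= B) ->
  (forall x, Y x -> adm_inf f Y x !=set0) ->
  forall T : R, 0 < T -> exists nu : probability (measurableTypeR R) R,
  [/\ slow T^-1 nu, Gamma f Y T `<=` occupation f Y nu &
      forall (K : set 'rV[R]_m) (B M : R), (forall z, K z.1 -> `|f z| <= B) ->
        (forall z, K z.1 -> `|k z| <= M) -> (forall x, K x -> adm_inf f K x !=set0) ->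
        forall x, V f k K T x = value f K k nu x].
Proof.
move=> fB viable T T0; exists (unif T0); split.
- exact: slow_unif.
- by move=> g; exact: (Gamma_occupation f_cont fB T0 viable).
- by move=> K B' M fB' kM vK x; have := @V_value R m U f K k B' M f_cont k_cont fB' kM T T0 x vK.
Qed.

Lemma discount_averaging (l : R) : 0 < l -> exists nu : probability (measurableTypeR R) R,
  [/\ slow l nu, Theta f Y l `<=` occupation f Y nu &
      forall (K : set 'rV[R]_m) (B M : R), (forall z, K z.1 -> `|f z| <= B) ->
        (forall z, K z.1 -> `|k z| <= M) -> (forall x, K x -> adm_inf f K x !=set0) ->
        forall x, h f k K l x = value f K k nu x].
Proof.
move=> l0; exists (expo l0); split.
- exact: slow_expo.
- by move=> g; exact: Theta_occupation.
- by move=> K B M _ kM _ x; have := @h_value R m U f K k M k_cont kM l l0 x.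
Qed.

End horizon_and_discount.

Local Open Scope ereal_scope.

Theorem mainTheorem3 (R : realType) (m : nat) (U : pmetricType R)
  (f : 'rV[R]_m * U -> 'rV[R]_m) (k : 'rV[R]_m * U -> R)
  (Y : set 'rV[R]_m) (q : nat -> 'rV[R]_m * U -> R)
  (delta0 : R) (y0 : 'rV[R]_m)
  (U_compact : compact [set: U])
  (f_cont : continuous f) (f_lip : lipschitz_in_state f)
  (k_cont : continuous k)
  (Y_neq0 : Y !=set0) (Y_compact : compact Y) (Y_reg : Y = closure Y°)
  (viable : forall x, Y x -> adm_inf f Y x !=set0)
  (q_test : test_sequence Y q)
  (delta0_gt0 : (0 < delta0)%R) (Yy0 : Y y0) :
  [/\ A1 f Y delta0 -> A2 f k Y delta0 -> A4 f k Y -> A5 f Y q ->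
        [/\ dstar f k Y y0 <= liminf_V f k Y y0,
            liminf_V f k Y y0 <= limsup_V f k Y y0 &
            limsup_V f k Y y0 <= kstar f k Y y0],
      A1 f Y delta0 -> A3 f k Y delta0 -> A6 f k Y -> A7 f Y q ->
        [/\ dstar f k Y y0 <= liminf_h f k Y y0,
            liminf_h f k Y y0 <= limsup_h f k Y y0 &
            limsup_h f k Y y0 <= kstar f k Y y0] &
      A1 f Y delta0 -> A2 f k Y delta0 -> A3 f k Y delta0 -> A4 f k Y ->
      A5 f Y q -> A6 f k Y -> A7 f Y q ->
      dstar f k Y y0 = kstar f k Y y0 ->
        [/\ [/\ dstar f k Y y0 = liminf_V f k Y y0,
                liminf_V f k Y y0 = limsup_V f k Y y0 &
                limsup_V f k Y y0 = kstar f k Y y0],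
            [/\ dstar f k Y y0 = liminf_h f k Y y0,
                liminf_h f k Y y0 = limsup_h f k Y y0 &
                limsup_h f k Y y0 = kstar f k Y y0] &
            exists l : R,
              [/\ V f k Y T y0 @[T --> +oo%R] --> l%:E,
                  h f k Y lambda y0 @[lambda --> 0%R^'+] --> l%:E,
                  dstar f k Y y0 = l%:E & kstar f k Y y0 = l%:E]]].
Proof.
have [B fB] := cyl_bound U_compact Y_compact f_cont.
pose avV := horizon_averaging f_cont k_cont fB viable.
pose avh := @discount_averaging R m U f k Y k_cont.
have lower_V := dstar_le_liminf U_compact Y_compact f_cont k_cont viable Yy0 near_inv_small avV.
have lower_h := dstar_le_liminf U_compact Y_compact f_cont k_cont viable Yy0 near_right0_small avh.
have upper_V a1 a2 a4 a5 := limsup_le_kstar U_compact Y_compact f_cont k_cont f_lip Yy0 q_test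
  delta0_gt0 near_inv_small avV a1 a2 (a4 y0 Yy0) a5.
have upper_h a1 a3 a6 a7 := limsup_le_kstar U_compact Y_compact f_cont k_cont f_lip Yy0 q_test
  delta0_gt0 near_right0_small avh a1 a3 (a6 y0 Yy0) a7.
split.
- move=> a1 a2 a4 a5; split; [exact: lower_V|exact: limf_einf_le_esup|exact: upper_V].
- move=> a1 a3 a6 a7; split; [exact: lower_h|exact: limf_einf_le_esup|exact: upper_h].
move=> a1 a2 a3 a4 a5 a6 a7 dk.
have [V1 V2 V3 fin cvgV] := long_run_limit U_compact Y_compact f_cont k_cont viable Yy0
  near_inv_small avV (lower_V _) (upper_V _ a1 a2 a4 a5) dk.
have [h1 h2 h3 _ cvgh] := long_run_limit U_compact Y_compact f_cont k_cont viable Yy0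
  near_right0_small avh (lower_h _) (upper_h _ a1 a3 a6 a7) dk.
split; [by split|by split|].
exists (fine (dstar f k Y y0)); split; rewrite ?fineK//.
Qed.
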